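(* There exists an algorithm which, given finite index subgroups $\Gamma\subseteq\Gamma'\subseteq SL_2(\mathbb{Z})$ with $\Gamma$ normal in $\Gamma'$, a character $\varepsilon:\Gamma'/\Gamma\to\mathbb{Q}(\zeta)^\times$, and an integer $k\ge2$, computes a basis of $\mathbb{S}_k(\Gamma,\varepsilon)$ using $O\big([SL_2(\mathbb{Z}):\Gamma']\cdot c_\varepsilon(\Gamma)+[SL_2(\mathbb{Z}):\Gamma]\big)$ $\operatorname{CosetIndex}$ operations.
   Context: $\mathbb{M}_2$ is the free abelian group on symbols $\{a,b\}$, $a,b\in\mathbb{P}^1(\mathbb{Q})$, modulo the relations $\{a,b\}+\{b,c\}+\{c,a\}=0$ and torsion; $\mathbb{M}_k=\operatorname{Sym}^{k-2}\mathbb{Z}^2\otimes\mathbb{M}_2$ with $GL_2(\mathbb{Q})$ acting by $g(v\otimes\{a,b\})=gv\otimes\{ga,gb\}$; $\mathbb{M}_k(\Gamma)$ is the group of $\Gamma$-coinvariants. $\Gamma'$ acts on $\mathbb{M}_k(\Gamma)$; $\mathbb{M}_k(\Gamma,\varepsilon)$ is the quotient of $\mathbb{M}_k(\Gamma)\otimes\mathbb{Z}[\zeta]$ by the relations $\gamma'x-\varepsilon(\gamma')x$ ($\gamma'\in\Gamma'$) and by $\mathbb{Z}$-torsion. Similarly $\mathbb{B}_2$ is the free abelian group on symbols $\{a\}$, $a\in\mathbb{P}^1(\mathbb{Q})$, $\mathbb{B}_k=\operatorname{Sym}^{k-2}\mathbb{Z}^2\otimes\mathbb{B}_2$, and $\mathbb{B}_k(\Gamma,\varepsilon)$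 is defined analogously. The boundary map $\partial:\mathbb{M}_k(\Gamma,\varepsilon)\to\mathbb{B}_k(\Gamma,\varepsilon)$ is $\partial(v\otimes\{a,b\})=v\otimes\{a\}-v\otimes\{b\}$, and $\mathbb{S}_k(\Gamma,\varepsilon)=\ker\partial$. $c_\varepsilon(\Gamma)=\dim\mathbb{B}_2(\Gamma,\varepsilon)$. A $\operatorname{CosetIndex}$ operation takes $x\in SL_2(\mathbb{Z})$ and a list $R$ of representatives of $\Delta\backslash SL_2(\mathbb{Z})$ (for $\Delta\in\{\Gamma,\Gamma'\}$) and returns the unique $i$ with $x\in\Delta R[i]$. *)

(* Defs.v *)
From HB Require Import structures.
From mathcomp Require Import all_boot all_order all_algebra all_field.
From mathcomp.multinomials Require Import freeg.

Set Implicit Arguments.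
Unset Strict Implicit.
Unset Printing Implicit Defensive.

Import Order.TTheory GRing.Theory Num.Theory.
Local Open Scope ring_scope.

(** ** Subgroups of SL_2(Z), cosets, characters *)

Definition SL2Z (g : 'M[int]_2) : Prop := \det g = 1.

Definition subgroup_SL2Z (G : 'M[int]_2 -> Prop) : Prop :=
  [/\ forall g, G g -> SL2Z g,
      G 1%:M,
      forall g h, G g -> G h -> G (g *m h)
    & forall g, G g -> G (invmx g)].

Definition normal_in (G G' : 'M[int]_2 -> Prop) : Prop :=
  forall g h, G' g -> G h -> G (g *m h *m invmx g).

Definition in_coset (G : 'M[int]_2 -> Prop) (x r : 'M[int]_2) : Prop :=
  exists2 g, G g & x = g *m r.

(* [L] lists representatives of G \ H, one for each coset; in particular G has
   finite index in H, and this index is [size L]. *)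
Definition coset_reps (G H : 'M[int]_2 -> Prop) (L : seq 'M[int]_2) : Prop :=
  (forall r, r \in L -> H r) /\
  (forall x, H x ->
     exists! i : nat, (i < size L)%N /\ in_coset G x (nth 0 L i)).

Definition evalZ (z : algC) (p : {poly int}) : algC := (map_poly intr p).[z].
Definition evalQ (z : algC) (p : {poly rat}) : algC := (map_poly ratr p).[z].

Definition in_Zz (z c : algC) : Prop := exists p, c = evalZ z p.
(* Q(z) = Q[z], since z is algebraic. *)
Definition in_Qz (z c : algC) : Prop := exists p, c = evalQ z p.

(* A character of G'/G with values in Q(z)^x, as a function on G' trivial on G;
   its values off G' are irrelevant. *)
Definition character_mod (z : algC) (G G' : 'M[int]_2 -> Prop)
    (eps : 'M[int]_2 -> algC) : Prop :=
  [/\ forall g h, G' g -> G' h -> eps (g *m h) = eps g * eps h,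
      forall g, G g -> eps g = 1
    & forall g, G' g -> in_Qz z (eps g) /\ eps g != 0].

(* The table of values of eps on representatives of G \ G' = G'/G. *)
Definition character_table (z : algC) (G G' : 'M[int]_2 -> Prop)
    (eps : 'M[int]_2 -> algC) (E : seq ('M[int]_2 * {poly rat})) : Prop :=
  coset_reps G G' (unzip1 E) /\
  (forall gp, gp \in E -> eps gp.1 = evalQ z gp.2).

(** ** Modular symbols *)

(* P^1(Q), with [None] the point at infinity. *)
Definition P1Q : choiceType := option rat.

Definition mobius (g : 'M[int]_2) (x : P1Q) : P1Q :=
  let: (a, b, c, d) := ((g 0 0)%:Q, (g 0 1)%:Q, (g 1 0)%:Q, (g 1 1)%:Q) in
  match x with
  | None => if c == 0 then None else Some (a / c)
  | Some x => if c * x + d == 0 then None else Some ((a * x + b) / (c * x + d))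
  end.

Definition mobius2 (g : 'M[int]_2) (ab : P1Q * P1Q) : P1Q * P1Q :=
  (mobius g ab.1, mobius g ab.2).

Section Symbols.
Variables (T : choiceType) (act : 'M[int]_2 -> T -> T) (k : nat).

(* The generator (i, t) stands for X^i Y^(k-2-i) (x) t, where X, Y is the
   standard basis of Z^2. Thus [symb] is Sym^(k-2)(algC^2) (x) algC[T], which
   contains Sym^(k-2)(Z^2) (x) Z[z][T] as the lattice [integral] below. *)
Definition symb : lmodType algC := {freeg ('I_k.-1 * T) / algC}.

(* g sends X to g00 X + g10 Y and Y to g01 X + g11 Y; the homogeneous
   polynomial g (X^i Y^(k-2-i)) is dehomogenized at Y = 1. *)
Definition sym_act (g : 'M[int]_2) (i : 'I_k.-1) : {poly int} :=
  ((g 0 0)%:P * 'X + (g 1 0)%:P) ^+ i *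
  ((g 0 1)%:P * 'X + (g 1 1)%:P) ^+ (k - 2 - i).

Definition symb_act (g : 'M[int]_2) : symb -> symb :=
  fglift (fun it : 'I_k.-1 * T =>
    \sum_(j < k.-1) << ((sym_act g it.1)`_j)%:~R *g (j, act g it.2) >> : symb).

Variables (z : algC) (G G' : 'M[int]_2 -> Prop) (eps : 'M[int]_2 -> algC).

Definition integral (x : symb) : Prop := forall it, in_Zz z (coeff it x).

(* The kernel of the projection of the lattice [integral] onto the module
   presented by the relations [rel0], the G-coinvariance relations and the
   eps-relations, modulo torsion. The torsion killed at the intermediate stages
   of the construction becomes torsion of the final module, so that
   [rels_torsion] accounts for all of it. *)
Inductive rels (rel0 : symb -> Prop) : symb -> Prop :=
| rels_base x : rel0 x -> rels rel0 x
| rels_coinv g x : G g -> integral x -> rels rel0 (symb_act g x - x)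
| rels_eps g x : G' g -> integral x ->
    rels rel0 (symb_act g x - eps g *: x)
| rels_0 : rels rel0 0
| rels_add x y : rels rel0 x -> rels rel0 y -> rels rel0 (x + y)
| rels_scale c x : in_Zz z c -> rels rel0 x -> rels rel0 (c *: x)
| rels_torsion (m : nat) x : (0 < m)%N -> integral x ->
    rels rel0 (x *+ m) -> rels rel0 x.

(* [B] represents a basis over Q(z) of (V / N) (x) Q consisting of elements of
   V / N, where V is a Z[z]-submodule of [integral] and N is a submodule of V
   with torsion-free quotient. (Z[z] need not be principal, and V / N is in
   general not free over Z[z].) *)
Definition basis_mod (V N : symb -> Prop) (B : seq symb) : Prop :=
  [/\ forall b, b \in B -> V b,
      forall c : nat -> algC,
        (forall i, in_Zz z (c i)) ->
        N (\sum_(i < size B) c i *: B`_i) ->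
        forall i, (i < size B)%N -> c i = 0
    & forall x, V x ->
        exists (m : nat) (c : nat -> algC),
          [/\ (0 < m)%N, forall i, in_Zz z (c i)
            & N (x *+ m - \sum_(i < size B) c i *: B`_i)]].

Definition has_dim (V N : symb -> Prop) (d : nat) : Prop :=
  exists2 B, basis_mod V N B & size B = d.

End Symbols.

Notation Msymb k := (symb (P1Q * P1Q)%type k).
Notation Bsymb k := (symb P1Q k).

Inductive three_term (k : nat) : Msymb k -> Prop :=
| ThreeTerm (i : 'I_k.-1) (a b c : P1Q) :
    three_term (<< (i, (a, b)) >> + << (i, (b, c)) >> + << (i, (c, a)) >>).

Section ModularSymbols.
Variables (z : algC) (G G' : 'M[int]_2 -> Prop) (eps : 'M[int]_2 -> algC).
Variable k : nat.

(* M_k(G, eps) is [integral] modulo [Mrels], B_k(G, eps) is [integral] modulo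
   [Brels]. *)
Definition Mrels : Msymb k -> Prop :=
  rels mobius2 z G G' eps (@three_term k).

Definition Brels : Bsymb k -> Prop :=
  rels mobius z G G' eps (fun _ => False).

Definition boundary : Msymb k -> Bsymb k :=
  fglift (fun it : 'I_k.-1 * (P1Q * P1Q) =>
    << (it.1, it.2.1) >> - << (it.1, it.2.2) >> : Bsymb k).

Definition in_S (x : Msymb k) : Prop := integral z x /\ Brels (boundary x).

Definition basis_S : seq (Msymb k) -> Prop := basis_mod z in_S Mrels.

End ModularSymbols.

(* c_eps(G) = d *)
Definition dim_B2 (z : algC) (G G' : 'M[int]_2 -> Prop)
    (eps : 'M[int]_2 -> algC) (d : nat) : Prop :=
  has_dim z (@integral P1Q 2 z) (@Brels z G G' eps 2) d.

(** ** Algorithms with CosetIndex operations *)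

Inductive value := VInt of int | VPair of value & value.

(* Programs of a Turing-complete first-order language: each denotes a partial
   function from values to values. *)
Inductive prog :=
| Id
| Const of int
| Fst
| Snd
| MkPair of prog & prog
| Seq of prog & prog
| Add
| Sub
| Mul
| Leq
| If of prog & prog & prog
| While of prog & prog
| CosetIndex.

Definition enc_nat (n : nat) : value := VInt n%:Z.

Fixpoint enc_seq (A : Type) (enc : A -> value) (s : seq A) : value :=
  if s is x :: s' then VPair (enc x) (enc_seq enc s') else VInt 0.

Definition enc_mx (g : 'M[int]_2) : value :=
  VPair (VPair (VInt (g 0 0)) (VInt (g 0 1)))
        (VPair (VInt (g 1 0)) (VInt (g 1 1))).

Definition enc_rat (x : rat) : value := VPair (VInt (numq x)) (VInt (denq x)).

Definition enc_P1Q (x : P1Q) : value :=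
  if x is Some q then enc_rat q else VPair (VInt 1) (VInt 0).

Section Run.
Variables G G' : 'M[int]_2 -> Prop.

(* [run p x y q]: on input x, the program p terminates with output y after
   having performed q CosetIndex operations. CosetIndex takes a flag telling
   which of G and G' is meant, a matrix x and a list L; a program calling it on
   an x outside SL_2(Z), or on a list L that is not a list of representatives
   for the group meant, is stuck. So is a program applying an operation to a
   value of the wrong shape. The value VInt 0 is false (and the empty list),
   any other value is true. *)
Inductive run : prog -> value -> value -> nat -> Prop :=
| run_Id x : run Id x x 0
| run_Const c x : run (Const c) x (VInt c) 0
| run_Fst x y : run Fst (VPair x y) x 0
| run_Snd x y : run Snd (VPair x y) y 0
| run_MkPair p1 p2 x y1 y2 q1 q2 :
    run p1 x y1 q1 -> run p2 x y2 q2 ->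
    run (MkPair p1 p2) x (VPair y1 y2) (q1 + q2)
| run_Seq p1 p2 x y w q1 q2 :
    run p1 x y q1 -> run p2 y w q2 -> run (Seq p1 p2) x w (q1 + q2)
| run_Add a b : run Add (VPair (VInt a) (VInt b)) (VInt (a + b)) 0
| run_Sub a b : run Sub (VPair (VInt a) (VInt b)) (VInt (a - b)) 0
| run_Mul a b : run Mul (VPair (VInt a) (VInt b)) (VInt (a * b)) 0
| run_Leq a b :
    run Leq (VPair (VInt a) (VInt b)) (VInt (if a <= b then 1 else 0)) 0
| run_If_true c p1 p2 x t y q1 q2 :
    run c x t q1 -> t <> VInt 0 -> run p1 x y q2 ->
    run (If c p1 p2) x y (q1 + q2)
| run_If_false c p1 p2 x y q1 q2 :
    run c x (VInt 0) q1 -> run p2 x y q2 ->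
    run (If c p1 p2) x y (q1 + q2)
| run_While_true c p x t y w q1 q2 q3 :
    run c x t q1 -> t <> VInt 0 -> run p x y q2 -> run (While c p) y w q3 ->
    run (While c p) x w (q1 + q2 + q3)
| run_While_false c p x q :
    run c x (VInt 0) q -> run (While c p) x x q
| run_CosetIndex (primed : bool) x L i :
    let D := if primed then G' else G in
    SL2Z x -> coset_reps D SL2Z L ->
    (i < size L)%N -> in_coset D x (nth 0 L i) ->
    run CosetIndex
      (VPair (enc_nat primed) (VPair (enc_mx x) (enc_seq enc_mx L)))
      (enc_nat i) 1.

End Run.

Definition enc_input (n k : nat) (R R' : seq 'M[int]_2)
    (E : seq ('M[int]_2 * {poly rat})) : value :=
  VPair (enc_nat n) (VPair (enc_nat k)
    (VPair (enc_seq enc_mx R) (VPair (enc_seq enc_mx R')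
      (enc_seq (fun gp : 'M[int]_2 * {poly rat} =>
         VPair (enc_mx gp.1) (enc_seq enc_rat gp.2)) E)))).

(* Elements of Sym^(k-2)(Z^2) (x) Z[z][P^1(Q)^2] are output as lists of terms
   (p, (i, (a, b))), meaning p(z) X^i Y^(k-2-i) (x) {a, b}. *)
Definition symb_term (k : nat) : Type :=
  ({poly int} * ('I_k.-1 * (P1Q * P1Q)))%type.

Definition symb_of_terms (z : algC) (k : nat) (s : seq (symb_term k)) : Msymb k :=
  \sum_(t <- s) << evalZ z t.1 *g t.2 >>.

Definition enc_term (k : nat) (t : symb_term k) : value :=
  VPair (enc_seq VInt t.1)
    (VPair (enc_nat t.2.1) (VPair (enc_P1Q t.2.2.1) (enc_P1Q t.2.2.2))).

Definition enc_output (k : nat) (B : seq (seq (symb_term k))) : value :=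
  enc_seq (enc_seq (@enc_term k)) B.

(* Main.v *)
Require Import Defs.
From HB Require Import structures.
From Stdlib Require Import IndefiniteDescription.
From mathcomp Require Import all_boot all_order all_algebra all_field.
From mathcomp.multinomials Require Import freeg.
From mathcomp Require Import zify ring.

(** Let the r_i represent the cosets G' \ SL_2(Z).  By Manin's
    continued fraction argument, M_k(G, eps) tensored with Q(z) is generated by
    the symbols X^a Y^(k-2-a) (x) {r_i 0, r_i oo}, and its relations are x + xS = 0
    and x + xU + xU^2 = 0 with S of order 4 and U of order 3; likewise
    B_k(G, eps) is generated by the X^a Y^(k-2-a) (x) {r_i oo}, with the relations
    x = xT and x = x(-1), and the boundary map is x |-> xS - x.  Rewriting r_i h,
    for the six matrices h involved, as g r_j with g in G', and evaluating eps(g)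
    by locating g among the cosets of G, takes 12 [SL_2(Z) : G'] + [G' : G] coset
    queries; this is at most 13 [SL_2(Z) : G], and no further query is made.

    What remains is linear algebra over Q(z), where the number of steps does not
    matter: the program searches blindly for matrices over Z[z] certifying that
    the rows of a matrix form a basis of the kernel of the boundary map.  Identities in
    Z[z] are decidable, and a certificate exists by linear algebra over the
    number field Q(z). *)

Set Implicit Arguments.
Unset Strict Implicit.
Unset Printing Implicit Defensive.

Import Order.TTheory GRing.Theory Num.Theory.
Local Open Scope ring_scope.

(** * Computable functions *)

(** That finitely many generators and relations present the coinvariants is proved by duality. Every
    functional on the generators that kills the listed relations extends to a functional on all
    symbols that kills [rels]. For modular symbols the extension comes from a potential: Manin's two
    relations say that a function on the edges of the Farey graph is a gradient. For cusps it comes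
    from constancy along the stabilizer of infinity. Together with the fact that the generators span
    rationally, this lets finite matrices decide questions about the infinite module.

    The certificate separates soundness from termination. [Phi] supplies the functionals that prove
    independence, [P] and [X] prove generation, so soundness uses matrix identities only;
    elimination over Q(z) merely shows that the search ends. The scalar [e] in place of 1 absorbs
    denominators, because the candidates have entries in Z[z]. Torsion and denominators are handled
    by [relsQ], where membership is required of some positive multiple only.

    The dimension of B_2 exists by the same certificate theorem, applied in weight 2 with zero
    boundary map. *)

Class Enc (A : Type) := enc : A -> value.
#[export] Hint Mode Enc ! : typeclass_instances.

#[export] Instance Enc_nat : Enc nat := enc_nat.
#[export] Instance Enc_int : Enc int := VInt.
#[export] Instance Enc_bool : Enc bool := fun b => VInt (if b then 1 else 0).
#[export] Instance Enc_prod A B `{Enc A} `{Enc B} : Enc (A * B) :=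
  fun x => VPair (enc x.1) (enc x.2).
#[export] Instance Enc_seq A `{Enc A} : Enc (seq A) := enc_seq enc.
#[export] Instance Enc_poly : Enc {poly int} := fun p => enc_seq VInt p.
#[export] Instance Enc_mx : Enc 'M[int]_2 := enc_mx.
#[export] Instance Enc_rat : Enc rat := enc_rat.
#[export] Instance Enc_ratpoly : Enc {poly rat} := fun p => enc_seq enc_rat p.

(** The program costs no query and is uniform in [G] and [G'], so such pieces can be inserted
    anywhere without affecting the query count. *)
Definition computable A B `{Enc A} `{Enc B} (f : A -> B) : Prop :=
  exists p, forall G G' x, run G G' p (enc x) (enc (f x)) 0.

Lemma comp_ext A B `{Enc A} `{Enc B} (f g : A -> B) :
  f =1 g -> computable f -> computable g.
Proof. by move=> fg [p Hp]; exists p => G G' x; rewrite -fg. Qed.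

Lemma comp_same A B `{Enc A} `{Enc B} (f : A -> B) :
  (forall x, enc (f x) = enc x) -> computable f.
Proof. by move=> E; exists Id => G G' x; rewrite E; apply: run_Id. Qed.

Lemma comp_id A `{Enc A} : computable (fun x : A => x).
Proof. exact: comp_same. Qed.

Fixpoint const_prog (v : value) : prog :=
  match v with
  | VInt c => Const c
  | VPair v w => MkPair (const_prog v) (const_prog w)
  end.

Lemma run_const_prog G G' v x : run G G' (const_prog v) x v 0.
Proof.
elim: v => [c|v IHv w IHw] /=; first exact: run_Const.
exact: (run_MkPair IHv IHw).
Qed.

Lemma comp_const A B `{Enc A} `{Enc B} (c : B) : computable (fun _ : A => c).
Proof. by exists (const_prog (enc c)) => G G' x; apply: run_const_prog. Qed.

Lemma comp_seq A B C `{Enc A} `{Enc B} `{Enc C} (g : B -> C) (f : A -> B) :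
  computable g -> computable f -> computable (fun x => g (f x)).
Proof.
move=> [q Hq] [p Hp]; exists (Seq p q) => G G' x.
exact: (run_Seq (Hp G G' x) (Hq G G' (f x))).
Qed.

Lemma comp_pair A B C `{Enc A} `{Enc B} `{Enc C} (f : A -> B) (g : A -> C) :
  computable f -> computable g -> computable (fun x => (f x, g x)).
Proof.
move=> [p Hp] [q Hq]; exists (MkPair p q) => G G' x.
exact: (run_MkPair (Hp G G' x) (Hq G G' x)).
Qed.

Lemma comp_fst A B C `{Enc A} `{Enc B} `{Enc C} (f : A -> B * C) :
  computable f -> computable (fun x => (f x).1).
Proof. by apply: comp_seq; exists Fst => G G' x; apply: run_Fst. Qed.

Lemma comp_snd A B C `{Enc A} `{Enc B} `{Enc C} (f : A -> B * C) :
  computable f -> computable (fun x => (f x).2).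
Proof. by apply: comp_seq; exists Snd => G G' x; apply: run_Snd. Qed.

Lemma comp_2 A B C D `{Enc A} `{Enc B} `{Enc C} `{Enc D} (op : B -> C -> D)
    (f : A -> B) (g : A -> C) :
  computable (fun x => op x.1 x.2) -> computable f -> computable g ->
  computable (fun x => op (f x) (g x)).
Proof. by move=> cop cf cg; exact: comp_seq cop (comp_pair cf cg). Qed.

Ltac comp_step0 := match goal with
  | |- computable (fun x => x) => apply: comp_id
  | |- computable (fun _ => ?c) => apply: comp_const
  | H : computable ?f |- computable ?f => exact: H
  | |- computable (@fst _ _) => apply: (@comp_fst _ _ _ _ _ _ (fun x => x))
  | |- computable (@snd _ _) => apply: (@comp_snd _ _ _ _ _ _ (fun x => x))
  | |- computable (fun x => (_, _)) => apply: comp_pair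
  | |- computable (fun x => fst _) => apply: comp_fst
  | |- computable (fun x => snd _) => apply: comp_snd
  | H : computable ?f |- computable (fun x => ?f _) => apply: (comp_seq H)
  | |- @computable ?A ?B ?HA ?HB ?f =>
      lazymatch f with
      | fun x => _ => fail
      | _ => change (@computable A B HA HB (fun x => f x))
      end
  end.

Lemma comp_if A B `{Enc A} `{Enc B} (b : A -> bool) (f g : A -> B) :
  computable b -> computable f -> computable g -> computable (fun x => if b x then f x else g x).
Proof.
move=> [pb Hb] [p Hp] [q Hq]; exists (If pb p q) => G G' x.
have Hbx := Hb G G' x; case: (b x) Hbx => Hbx.
  by apply: (@run_If_true _ _ _ _ _ _ _ _ 0 0 Hbx _ (Hp G G' x)).
exact: (@run_If_false _ _ _ _ _ _ _ 0 0 Hbx (Hq G G' x)).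
Qed.

Lemma comp_addz A `{Enc A} (f g : A -> int) : computable f -> computable g -> computable (fun x => f x + g x).
Proof. by move=> cf cg; apply: (comp_2 (op := fun a b => a + b) _ cf cg); exists Add => G G' x; apply: run_Add. Qed.

Lemma comp_subz A `{Enc A} (f g : A -> int) : computable f -> computable g -> computable (fun x => f x - g x).
Proof. by move=> cf cg; apply: (comp_2 (op := fun a b => a - b) _ cf cg); exists Defs.Sub => G G' x; apply: run_Sub. Qed.

Lemma comp_mulz A `{Enc A} (f g : A -> int) : computable f -> computable g -> computable (fun x => f x * g x).
Proof. by move=> cf cg; apply: (comp_2 (op := fun a b => a * b) _ cf cg); exists Mul => G G' x; apply: run_Mul. Qed.

Lemma comp_oppz A `{Enc A} (f : A -> int) : computable f -> computable (fun x => - f x).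
Proof.
move=> cf; apply: (@comp_ext _ _ _ _ (fun x => 0 - f x)) => [x|].
  by rewrite sub0r.
exact: comp_subz (comp_const _) cf.
Qed.

Lemma comp_lez A `{Enc A} (f g : A -> int) : computable f -> computable g -> computable (fun x => f x <= g x).
Proof.
by move=> cf cg; apply: (comp_2 (op := fun a b => a <= b) _ cf cg); exists Leq => G G' x; apply: run_Leq.
Qed.

Lemma comp_andb A `{Enc A} (f g : A -> bool) : computable f -> computable g -> computable (fun x => f x && g x).
Proof. by move=> cf cg; exact: comp_if cf cg (comp_const _). Qed.

Lemma comp_negb A `{Enc A} (f : A -> bool) : computable f -> computable (fun x => ~~ f x).
Proof. by move=> cf; exact: comp_if cf (comp_const _) (comp_const _). Qed.

Lemma comp_eqz A `{Enc A} (f g : A -> int) : computable f -> computable g -> computable (fun x => f x == g x).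
Proof.
move=> cf cg; apply: (@comp_ext _ _ _ _ (fun x => (f x <= g x) && (g x <= f x))).
  by move=> x; rewrite eq_le.
by apply: comp_andb; apply: comp_lez.
Qed.

Lemma comp_Posz A `{Enc A} (f : A -> nat) : computable f -> computable (fun x => (f x)%:Z).
Proof. by apply: comp_seq; exact: comp_same. Qed.

Lemma comp_nat_of_int A `{Enc A} (f : A -> nat) : computable (fun x => (f x)%:Z) -> computable f.
Proof. by case=> p Hp; exists p. Qed.

Lemma comp_addn A `{Enc A} (f g : A -> nat) :
  computable f -> computable g -> computable (fun x => (f x + g x)%N).
Proof.
move=> /comp_Posz cf /comp_Posz cg; apply: comp_nat_of_int.
by apply: comp_ext (comp_addz cf cg) => x; rewrite PoszD.
Qed.

Lemma comp_muln A `{Enc A} (f g : A -> nat) :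
  computable f -> computable g -> computable (fun x => (f x * g x)%N).
Proof.
move=> /comp_Posz cf /comp_Posz cg; apply: comp_nat_of_int.
by apply: comp_ext (comp_mulz cf cg) => x; rewrite PoszM.
Qed.

Lemma comp_succn A `{Enc A} (f : A -> nat) : computable f -> computable (fun x => (f x).+1).
Proof.
move=> cf; apply: comp_ext (comp_addn cf (comp_const 1%N)) => x.
by rewrite addn1.
Qed.

Lemma comp_leq A `{Enc A} (f g : A -> nat) :
  computable f -> computable g -> computable (fun x => (f x <= g x)%N).
Proof.
move=> /comp_Posz cf /comp_Posz cg.
by apply: comp_ext (comp_lez cf cg) => x; rewrite lez_nat.
Qed.

Lemma comp_eqn A `{Enc A} (f g : A -> nat) :
  computable f -> computable g -> computable (fun x => f x == g x).
Proof.
move=> /comp_Posz cf /comp_Posz cg.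
by apply: comp_ext (comp_eqz cf cg) => x; rewrite eqz_nat.
Qed.

Lemma comp_subn A `{Enc A} (f g : A -> nat) :
  computable f -> computable g -> computable (fun x => (f x - g x)%N).
Proof.
move=> cf cg; apply: comp_nat_of_int.
apply: (@comp_ext _ _ _ _
  (fun x => if (f x <= g x)%N then 0 else (f x)%:Z - (g x)%:Z)) => [x|].
  by case: leqP => [/eqP->//|/ltnW/subzn].
apply: comp_if (comp_leq cf cg) (comp_const _) _.
exact: comp_subz (comp_Posz cf) (comp_Posz cg).
Qed.

Ltac comp_step1 := match goal with
  | |- computable (fun x => if _ then _ else _) => apply: comp_if
  | |- computable (fun x => _ && _) => apply: comp_andb
  | |- computable (fun x => ~~ _) => apply: comp_negb
  | |- computable (fun x => addn _ _) => apply: comp_addn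
  | |- computable (fun x => muln _ _) => apply: comp_muln
  | |- computable (fun x => subn _ _) => apply: comp_subn
  | |- computable (fun x => S _) => apply: comp_succn
  | |- computable (fun x => leq _ _) => apply: comp_leq
  | |- computable (fun x => Posz _) => apply: comp_Posz
  | |- computable (fun x => Order.le _ _) => apply: comp_lez
  | |- computable (fun x => (_ : nat) == _) => apply: comp_eqn
  | |- computable (fun x => (_ : int) == _) => apply: comp_eqz
  | |- computable (fun x => GRing.add _ (GRing.opp _)) => apply: comp_subz
  | |- computable (fun x => GRing.add _ _) => apply: comp_addz
  | |- computable (fun x => GRing.opp _) => apply: comp_oppz
  | |- computable (fun x => GRing.mul _ _) => apply: comp_mulz
  | _ => comp_step0
  end.
Ltac comp1 := repeat comp_step1.

(** A [While] loop has a single value as state, so the argument [x] and a decreasing counter travel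
    with the accumulator as [((x, m), y)]; the loop runs while [1 <= m]. *)
Lemma comp_iter A `{Enc A} B `{Enc B} (n : A -> nat) (s : A -> B -> B) (i : A -> B) :
  computable n -> computable (fun xy => s xy.1 xy.2) -> computable i ->
  computable (fun x => iter (n x) (s x) (i x)).
Proof.
move=> [pn Hn] [ps Hs] [pi Hi].
pose cond := Seq (MkPair (Const 1) (Seq Fst Snd)) Leq.
pose body := MkPair (MkPair (Seq Fst Fst) (Seq (MkPair (Seq Fst Snd) (Const 1)) Defs.Sub))
                    (Seq (MkPair (Seq Fst Fst) Snd) ps).
exists (Seq (Seq (MkPair (MkPair Id pn) pi) (While cond body)) Snd) => G G' x.
have Hcond (m : nat) (y : B) : run G G' cond (VPair (VPair (enc x) (enc m)) (enc y))
    (VInt (if 1 <= m%:Z :> int then 1 else 0)) 0.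
  apply: (@run_Seq _ _ _ _ _ (VPair (VInt 1) (enc m)) _ 0 0); last exact: run_Leq.
  apply: (@run_MkPair _ _ _ _ _ _ _ 0 0); first exact: run_Const.
  by apply: (@run_Seq _ _ _ _ _ _ _ 0 0); [exact: run_Fst | exact: run_Snd].
have Hbody (m : nat) (y : B) : run G G' body (VPair (VPair (enc x) (enc m.+1)) (enc y))
    (VPair (VPair (enc x) (enc m)) (enc (s x y))) 0.
  apply: (@run_MkPair _ _ _ _ _ _ _ 0 0).
    apply: (@run_MkPair _ _ _ _ _ _ _ 0 0).
      by apply: (@run_Seq _ _ _ _ _ _ _ 0 0); exact: run_Fst.
    apply: (@run_Seq _ _ _ _ _ (VPair (enc m.+1) (VInt 1)) _ 0 0).
      apply: (@run_MkPair _ _ _ _ _ _ _ 0 0); last exact: run_Const.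
      by apply: (@run_Seq _ _ _ _ _ _ _ 0 0); [exact: run_Fst | exact: run_Snd].
    have -> : enc m = VInt (m.+1%:Z - 1) by congr VInt; lia.
    exact: run_Sub.
  apply: (@run_Seq _ _ _ _ _ (enc (x, y)) _ 0 0); last exact: Hs.
  apply: (@run_MkPair _ _ _ _ _ _ _ 0 0); last exact: run_Snd.
  by apply: (@run_Seq _ _ _ _ _ _ _ 0 0); exact: run_Fst.
have Hwhile (m : nat) (y : B) : run G G' (While cond body)
    (VPair (VPair (enc x) (enc m)) (enc y))
    (VPair (VPair (enc x) (enc 0%N)) (enc (iter m (s x) y))) 0.
  elim: m y => [|m IHm] y; first by apply: run_While_false; exact: Hcond.
  rewrite iterSr; have Hc := Hcond m.+1 y.
  by apply: (@run_While_true _ _ _ _ _ _ _ _ 0 0 0 Hc _ (Hbody m y) (IHm (s x y))).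
apply: (@run_Seq _ _ _ _ _ (VPair (VPair (enc x) (enc 0%N)) (enc (iter (n x) (s x) (i x)))) _ 0 0);
  last exact: run_Snd.
apply: (@run_Seq _ _ _ _ _ _ _ 0 0); last exact: Hwhile.
apply: (@run_MkPair _ _ _ _ _ _ _ 0 0) (Hi _ _ _).
exact: (@run_MkPair _ _ _ _ _ _ _ 0 0 (run_Id _ _ _) (Hn _ _ _)).
Qed.

Lemma comp_iteri A `{Enc A} B `{Enc B} (n : A -> nat) (s : A -> nat -> B -> B) (i : A -> B) :
  computable n -> computable (fun xy => s xy.1.1 xy.1.2 xy.2) -> computable i ->
  computable (fun x => iteri (n x) (s x) (i x)).
Proof.
move=> cn cs ci.
apply: (@comp_ext _ _ _ _
  (fun x => (iter (n x) (fun y : nat * B => (y.1.+1, s x y.1 y.2)) (0%N, i x)).2)).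
  move=> x; suff -> m : iter m (fun y : nat * B => (y.1.+1, s x y.1 y.2)) (0%N, i x)
    = (m, iteri m (s x) (i x)) by [].
  by elim: m => //= m ->.
apply: comp_snd; apply: comp_iter => //; last by comp1.
apply: comp_pair; first by comp1.
apply: (comp_seq cs (_ : computable (fun x : A * (nat * B) => ((x.1, x.2.1), x.2.2)))).
by comp1.
Qed.

(** A nonempty list is encoded as a pair, which counts as true, and the empty list as [VInt 0],
    which is false; hence the remaining list itself serves as the loop condition. *)
Lemma comp_size A `{Enc A} B `{Enc B} (f : A -> seq B) : computable f -> computable (fun x => size (f x)).
Proof.
apply: comp_seq.
pose body := MkPair (Seq Fst Snd) (Seq (MkPair Snd (Const 1)) Add).
exists (Seq (Seq (MkPair Id (Const 0)) (While Fst body)) Snd) => G G' s.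
have Hbody (y : B) (t : seq B) (m : nat) : run G G' body (VPair (enc (y :: t)) (enc m))
    (VPair (enc t) (enc m.+1)) 0.
  apply: (@run_MkPair _ _ _ _ _ _ _ 0 0).
    by apply: (@run_Seq _ _ _ _ _ _ _ 0 0); [exact: run_Fst | exact: run_Snd].
  apply: (@run_Seq _ _ _ _ _ (VPair (enc m) (VInt 1)) _ 0 0).
    apply: (@run_MkPair _ _ _ _ _ _ _ 0 0); last exact: run_Const.
    exact: run_Snd.
  have -> : enc m.+1 = VInt (m%:Z + 1) by congr VInt; lia.
  exact: run_Add.
have Hwhile (t : seq B) (m : nat) : run G G' (While Fst body) (VPair (enc t) (enc m))
    (VPair (enc ([::] : seq B)) (enc (size t + m)%N)) 0.
  elim: t m => [|y t IHt] m; first by apply: run_While_false; exact: run_Fst.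
  rewrite /= addSnnS.
  by apply: (@run_While_true _ _ _ _ _ _ _ _ 0 0 0 (run_Fst _ _ _ _) _ (Hbody y t m)
           (IHt m.+1)).
apply: (@run_Seq _ _ _ _ _ (VPair (enc ([::] : seq B)) (enc (size s))) _ 0 0);
  last exact: run_Snd.
apply: (@run_Seq _ _ _ _ _ (VPair (enc s) (enc 0%N)) _ 0 0).
  exact: (@run_MkPair _ _ _ _ _ _ _ 0 0 (run_Id _ _ _) (run_Const _ _ _ _)).
by rewrite -[size s]addn0; exact: Hwhile.
Qed.

Lemma comp_cons A `{Enc A} B `{Enc B} (f : A -> B) (g : A -> seq B) :
  computable f -> computable g -> computable (fun x => f x :: g x).
Proof. by move=> cf cg; apply: (comp_2 (op := cons) _ cf cg); exact: comp_same. Qed.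

Lemma comp_behead A `{Enc A} B `{Enc B} (f : A -> seq B) : computable f -> computable (fun x => behead (f x)).
Proof.
apply: comp_seq; exists (If Id Snd (Const 0)) => G G' [|y s].
  exact: (@run_If_false _ _ _ _ _ _ _ 0 0 (run_Id _ _ _) (run_Const _ _ _ _)).
by apply: (@run_If_true _ _ _ _ _ _ _ _ 0 0 (run_Id _ _ _) _ (run_Snd _ _ _ _)).
Qed.

Lemma comp_head A `{Enc A} B `{Enc B} d (f : A -> seq B) : computable f -> computable (fun x => head d (f x)).
Proof.
apply: comp_seq; exists (If Id Fst (const_prog (enc d))) => G G' [|y s].
  exact: (@run_If_false _ _ _ _ _ _ _ 0 0 (run_Id _ _ _) (run_const_prog _ _ _ _)).
by apply: (@run_If_true _ _ _ _ _ _ _ _ 0 0 (run_Id _ _ _) _ (run_Fst _ _ _ _)).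
Qed.

Lemma comp_nth A `{Enc A} B `{Enc B} d (f : A -> seq B) (i : A -> nat) :
  computable f -> computable i -> computable (fun x => nth d (f x) (i x)).
Proof.
(* The loop drops [i x] elements; past the end [behead] stays at the empty list, where [head]
   returns the same default as [nth]. *)
move=> cf ci; apply: (@comp_ext _ _ _ _
  (fun x => head d (iter (i x) (fun s => behead s) (f x)))) => [x|].
  rewrite -nth0; suff -> j (s : seq B) : iter j (fun s => behead s) s = drop j s.
    by rewrite nth_drop addn0.
  by elim: j s => [|j IHj] s; [rewrite drop0|rewrite iterSr IHj; case: s].
apply: comp_head; apply: (comp_iter ci _ cf) => /=.
by apply: comp_behead; comp1.
Qed.

Lemma comp_foldr A `{Enc A} B C `{Enc B} `{Enc C} (d : B) (s : A -> seq B)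
    (f : A -> B -> C -> C) (c : A -> C) :
  computable s -> computable (fun x => f x.1.1 x.1.2 x.2) -> computable c ->
  computable (fun x => foldr (f x) (c x) (s x)).
Proof.
(* [foldr] consumes the list from its end while the loop counts upwards, whence the index
   [size - i.+1]. *)
move=> cs cf cc; apply: (@comp_ext _ _ _ _ (fun x => iteri (size (s x))
  (fun i a => f x (nth d (s x) (size (s x) - i.+1)) a) (c x))) => [x|].
  suff E i : (i <= size (s x))%N -> iteri i
      (fun i a => f x (nth d (s x) (size (s x) - i.+1)) a) (c x) =
      foldr (f x) (c x) (drop (size (s x) - i) (s x)).
    by rewrite E // subnn drop0.
  elim: i => [|i IHi] lei; first by rewrite subn0 drop_size.
  rewrite /= IHi; last exact: ltnW.
  by rewrite [in RHS](drop_nth d) ?subnSK //=; lia.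
apply: comp_iteri => //; first exact: comp_size.
apply: (comp_seq cf (_ : computable (fun x : A * nat * C =>
  ((x.1.1, nth d (s x.1.1) (size (s x.1.1) - x.1.2.+1)), x.2)))).
have cs' : computable (fun x : A * nat * C => s x.1.1) by comp1.
apply: comp_pair; last by comp1.
apply: comp_pair; first by comp1.
by apply: comp_nth => //; comp1; exact: comp_size.
Qed.

Lemma comp_mkseq A `{Enc A} B `{Enc B} (n : A -> nat) (f : A -> nat -> B) :
  computable n -> computable (fun x => f x.1 x.2) -> computable (fun x => mkseq (f x) (n x)).
Proof.
move=> cn cf; apply: (@comp_ext _ _ _ _ (fun x => iteri (n x)
  (fun i a => f x (n x - i.+1)%N :: a) [::])) => [x|].
  suff E i : (i <= n x)%N -> iteri i (fun i a => f x (n x - i.+1)%N :: a) [::] =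
      [seq f x j | j <- iota (n x - i)%N i].
    by rewrite E // subnn.
  elim: i => [|i IHi] //= lei; rewrite IHi; last exact: ltnW.
  by rewrite subnSK.
apply: comp_iteri => //; last by comp1.
apply: comp_cons; last by comp1.
apply: (comp_seq cf (_ : computable (fun x : A * nat * seq B => (x.1.1, (n x.1.1 - x.1.2.+1)%N)))).
by comp1.
Qed.

Lemma comp_all_iota A `{Enc A} (n : A -> nat) (f : A -> nat -> bool) :
  computable n -> computable (fun x => f x.1 x.2) -> computable (fun x => all (f x) (iota 0 (n x))).
Proof.
move=> cn cf; apply: (@comp_ext _ _ _ _ (fun x => iteri (n x)
  (fun i a => a && f x i) true)) => [x|].
  elim: (n x) => // m IHm.
  by rewrite -[in RHS]addn1 iotaD all_cat /= IHm andbT.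
apply: comp_iteri => //; last by comp1.
apply: comp_andb; first by comp1.
by apply: (comp_seq cf); comp1.
Qed.

Lemma comp_sum A `{Enc A} (V : nmodType) `{Enc V} (n : A -> nat) (f : A -> nat -> V) :
  computable (fun x : V * V => x.1 + x.2) -> computable n -> computable (fun x => f x.1 x.2) ->
  computable (fun x => \sum_(0 <= i < n x) f x i).
Proof.
move=> cD cn cf; apply: (@comp_ext _ _ _ _ (fun x => iteri (n x)
  (fun i a => a + f x i) 0)) => [x|].
  elim: (n x) => [|m IHm]; first by rewrite big_geq.
  by rewrite big_nat_recr //= IHm.
apply: comp_iteri => //; last by comp1.
apply: (comp_2 (op := fun a b => a + b) cD); first by comp1.
by apply: (comp_seq cf); comp1.
Qed.

Lemma comp_prod A `{Enc A} (V : pzSemiRingType) `{Enc V} (n : A -> nat) (f : A -> nat -> V) :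
  computable (fun x : V * V => x.1 * x.2) -> computable n -> computable (fun x => f x.1 x.2) ->
  computable (fun x => \prod_(0 <= i < n x) f x i).
Proof.
move=> cM cn cf; apply: (@comp_ext _ _ _ _ (fun x => iteri (n x)
  (fun i a => a * f x i) 1)) => [x|].
  elim: (n x) => [|m IHm]; first by rewrite big_geq.
  by rewrite big_nat_recr //= IHm.
apply: comp_iteri => //; last by comp1.
apply: (comp_2 (op := fun a b => a * b) cM); first by comp1.
by apply: (comp_seq cf); comp1.
Qed.

Lemma comp_edivn A `{Enc A} (f g : A -> nat) : computable f -> computable g ->
  computable (fun x => ((f x %/ g x)%N, (f x %% g x)%N)).
Proof.
(* Division by counting: quotient and remainder are updated [f x] times. The separate case of
   divisor 0 reproduces the conventions of [divn0] and [modn0]. *)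
move=> cf cg; apply: (@comp_ext _ _ _ _ (fun x =>
  if g x == 0%N then (0%N, f x) else iter (f x) (fun qr : nat * nat =>
    if qr.2.+1 == g x then (qr.1.+1, 0%N) else (qr.1, qr.2.+1)) (0%N, 0%N))) => [x|].
  case: eqP => [->|/eqP]; first by rewrite divn0 modn0.
  rewrite -lt0n => g0; elim: (f x) => [|m IHm]; first by rewrite div0n mod0n.
  rewrite /= IHm /=; have lt_r := ltn_pmod m g0.
  have Em := divn_eq m (g x); case: eqP => Er.
    have -> : m.+1 = ((m %/ g x).+1 * g x + 0)%N by lia.
    by rewrite divnMDl // modnMDl div0n mod0n addn0.
  have lt_r1 : ((m %% g x).+1 < g x)%N by lia.
  have -> : m.+1 = (m %/ g x * g x + (m %% g x).+1)%N by lia.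
  by rewrite divnMDl // modnMDl (modn_small lt_r1) (divn_small lt_r1) addn0.
by comp1; apply: comp_iter => //; comp1.
Qed.

Lemma comp_divn A `{Enc A} (f g : A -> nat) : computable f -> computable g ->
  computable (fun x => (f x %/ g x)%N).
Proof. by move=> cf cg; exact: comp_fst (comp_edivn cf cg). Qed.

Lemma comp_modn A `{Enc A} (f g : A -> nat) : computable f -> computable g ->
  computable (fun x => (f x %% g x)%N).
Proof. by move=> cf cg; exact: comp_snd (comp_edivn cf cg). Qed.

(** * Integer polynomials as programs' data *)

Lemma comp_polyseq A `{Enc A} (f : A -> {poly int}) : computable f -> computable (fun x => polyseq (f x)).
Proof. by apply: comp_seq; exact: comp_same. Qed.

Lemma comp_ratpolyseq A `{Enc A} (f : A -> {poly rat}) :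
  computable f -> computable (fun x => polyseq (f x)).
Proof. by apply: comp_seq; exact: comp_same. Qed.

Lemma comp_of_polyseq A `{Enc A} (f : A -> {poly int}) : computable (fun x => polyseq (f x)) -> computable f.
Proof. by case=> p Hp; exists p. Qed.

Lemma comp_Poly A `{Enc A} (s : A -> seq int) : computable s -> computable (fun x => Poly (s x)).
Proof.
move=> cs; apply: (comp_foldr 0 cs) (comp_const _).
(* A zero is not prepended to an empty list: the encoding of a polynomial must have no trailing zero
   coefficients. *)
apply: comp_of_polyseq; apply: (@comp_ext _ _ _ _
  (fun x : A * int * {poly int} => if (size (polyseq x.2) == 0%N) && (x.1.2 == 0) then [::]
     else x.1.2 :: polyseq x.2)) => [[[x c] p]|] /=.
  rewrite polyseq_cons /nilp; case: eqP => //= /size0nil ->.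
  by rewrite polyseqC; case: eqP.
have cp : computable (fun x : A * int * {poly int} => polyseq x.2) by apply: comp_polyseq; comp1.
by comp1; [exact: comp_size | apply: comp_cons; comp1].
Qed.

Lemma comp_poly A `{Enc A} (n : A -> nat) (f : A -> nat -> int) :
  computable n -> computable (fun x => f x.1 x.2) -> computable (fun x => \poly_(i < n x) f x i).
Proof.
move=> cn cf; apply: comp_ext (comp_Poly (comp_mkseq cn cf)) => x.
apply/polyP => i; rewrite coef_Poly coef_poly; case: ltnP => lti.
  by rewrite nth_mkseq.
by rewrite nth_default ?size_mkseq.
Qed.

Lemma comp_coef A `{Enc A} (p : A -> {poly int}) (i : A -> nat) :
  computable p -> computable i -> computable (fun x => (p x)`_(i x)).
Proof. by move=> cp ci; exact: comp_nth (comp_polyseq cp) ci. Qed.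

Lemma comp_polyC A `{Enc A} (c : A -> int) : computable c -> computable (fun x => (c x)%:P).
Proof.
move=> cc; apply: comp_ext (comp_Poly (comp_cons cc (comp_const [::]))) => x.
by rewrite /= cons_poly_def mul0r add0r.
Qed.

Lemma comp_Xn A `{Enc A} (n : A -> nat) : computable n -> computable (fun x => 'X^(n x) : {poly int}).
Proof.
move=> cn; apply: (@comp_ext _ _ _ _
  (fun x => \poly_(i < (n x).+1) (if i == n x then 1 else 0 : int))) => [x|].
  apply/polyP => i; rewrite coef_poly coefXn.
  by case: ltnP; case: eqP => //; lia.
by apply: comp_poly; comp1.
Qed.

Section PolynomialRing.
Context {A : Type} `{Enc A}.
Variables p q : A -> {poly int}.
Hypotheses (cp : computable p) (cq : computable q).

Let cS : computable (fun x => size (polyseq (p x)) + size (polyseq (q x)))%N.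
Proof. by apply: comp_addn; apply: comp_size; exact: comp_polyseq. Qed.

Lemma comp_addp : computable (fun x => p x + q x).
Proof.
apply: (@comp_ext _ _ _ _ (fun x =>
  \poly_(i < size (polyseq (p x)) + size (polyseq (q x))) ((p x)`_i + (q x)`_i))) => [x|].
  apply/polyP => i; rewrite coef_poly coefD; case: ltnP => // lei.
  by rewrite !nth_default ?addr0 // ?(leq_trans _ lei) ?leq_addr ?leq_addl.
apply: comp_poly => //.
by apply: comp_addz; apply: comp_coef; comp1.
Qed.

Lemma comp_subp : computable (fun x => p x - q x).
Proof.
apply: (@comp_ext _ _ _ _ (fun x =>
  \poly_(i < size (polyseq (p x)) + size (polyseq (q x))) ((p x)`_i - (q x)`_i))) => [x|].
  apply/polyP => i; rewrite coef_poly coefB; case: ltnP => // lei.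
  by rewrite !nth_default ?subr0 // ?(leq_trans _ lei) ?leq_addr ?leq_addl.
apply: comp_poly => //.
by apply: comp_subz; apply: comp_coef; comp1.
Qed.

Lemma comp_mulp : computable (fun x => p x * q x).
Proof.
apply: (@comp_ext _ _ _ _ (fun x =>
  \poly_(i < size (polyseq (p x)) + size (polyseq (q x)))
     \sum_(0 <= j < i.+1) (p x)`_j * (q x)`_(i - j))) => [x|].
  apply/polyP => i; rewrite coef_poly; case: ltnP => [_|lei]; first by rewrite coefM big_mkord.
  rewrite nth_default //; apply: leq_trans (size_polyMleq _ _) _.
  by apply: leq_trans (leq_pred _) lei.
apply: comp_poly => //.
apply: comp_sum; [by comp1 | by comp1 |].
by apply: comp_mulz; apply: comp_coef; comp1.
Qed.

End PolynomialRing.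

Lemma comp_expp A `{Enc A} (p : A -> {poly int}) (n : A -> nat) :
  computable p -> computable n -> computable (fun x => p x ^+ n x).
Proof.
move=> cp cn; apply: (@comp_ext _ _ _ _ (fun x => iter (n x) (fun y => p x * y) 1)).
  by move=> x; rewrite -Monoid.iteropE; elim: (n x) => //= m ->; rewrite -exprS.
by apply: comp_iter => //; last (by comp1); apply: comp_mulp; comp1.
Qed.

(** * Two-by-two integer matrices *)

Definition mx2 (a b c d : int) : 'M[int]_2 :=
  \matrix_(i, j) (if i == 0 then (if j == 0 then a else b)
                  else (if j == 0 then c else d)).

Lemma comp_mxE A `{Enc A} (g : A -> 'M[int]_2) (i j : 'I_2) :
  computable g -> computable (fun x => g x i j).
Proof.
apply: (comp_seq (g := fun h : 'M[int]_2 => h i j)).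
exists (Seq (if i == 0 then Fst else Snd) (if j == 0 then Fst else Snd)) => G G' h.
have [->|i1] := eqVneq i 0; last have -> : i = 1 by apply/val_inj; case: i i1 => [[|[]]].
  have [->|j1] := eqVneq j 0; last have -> : j = 1 by apply/val_inj; case: j j1 => [[|[]]].
    exact: (@run_Seq _ _ _ _ _ _ _ 0 0 (run_Fst _ _ _ _) (run_Fst _ _ _ _)).
  exact: (@run_Seq _ _ _ _ _ _ _ 0 0 (run_Fst _ _ _ _) (run_Snd _ _ _ _)).
have [->|j1] := eqVneq j 0; last have -> : j = 1 by apply/val_inj; case: j j1 => [[|[]]].
  exact: (@run_Seq _ _ _ _ _ _ _ 0 0 (run_Snd _ _ _ _) (run_Fst _ _ _ _)).
exact: (@run_Seq _ _ _ _ _ _ _ 0 0 (run_Snd _ _ _ _) (run_Snd _ _ _ _)).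
Qed.

Lemma comp_mx2 A `{Enc A} (a b c d : A -> int) :
  computable a -> computable b -> computable c -> computable d ->
  computable (fun x => mx2 (a x) (b x) (c x) (d x)).
Proof.
move=> ca cb cc cd; have [p Hp] := comp_pair (comp_pair ca cb) (comp_pair cc cd).
by exists p => G G' x; rewrite {2}/enc /Enc_mx /enc_mx !mxE; exact: Hp.
Qed.

Lemma mx2P (g h : 'M[int]_2) :
  g 0 0 = h 0 0 -> g 0 1 = h 0 1 -> g 1 0 = h 1 0 -> g 1 1 = h 1 1 -> g = h.
Proof.
move=> e00 e01 e10 e11; apply/matrixP => i j.
have [->|i1] := eqVneq i 0; last have -> : i = 1 by apply/val_inj; case: i i1 => [[|[]]].
  by have [->|j1] := eqVneq j 0; last have -> : j = 1 by apply/val_inj; case: j j1 => [[|[]]].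
by have [->|j1] := eqVneq j 0; last have -> : j = 1 by apply/val_inj; case: j j1 => [[|[]]].
Qed.

Lemma mulmx2E (g h : 'M[int]_2) i j : (g *m h) i j = g i 0 * h 0 j + g i 1 * h 1 j.
Proof.
rewrite mxE big_ord_recl big_ord1; congr (_ + g i _ * h _ j); exact/val_inj.
Qed.

Lemma comp_mulmx A `{Enc A} (g h : A -> 'M[int]_2) :
  computable g -> computable h -> computable (fun x => g x *m h x).
Proof.
move=> cg ch; pose e i j x := g x i 0 * h x 0 j + g x i 1 * h x 1 j.
have ce i j : computable (e i j) by apply: comp_addz; apply: comp_mulz; exact: comp_mxE.
apply: comp_ext (comp_mx2 (ce 0 0) (ce 0 1) (ce 1 0) (ce 1 1)) => x.
by apply: mx2P; rewrite mulmx2E !mxE.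
Qed.

Ltac comp_step := match goal with
  | |- computable (fun x => size _) => apply: comp_size
  | |- computable (fun x => cons _ _) => apply: comp_cons
  | |- computable (fun x => behead _) => apply: comp_behead
  | |- computable (fun x => head _ _) => apply: comp_head
  | |- computable (fun x => nth _ (polyseq _) _) => (apply: comp_coef || apply: comp_nth)
  | |- computable (fun x => nth _ _ _) => apply: comp_nth
  | |- computable (fun x => mkseq _ _) => apply: comp_mkseq
  | |- computable (fun x => all _ (iota 0 _)) => apply: comp_all_iota
  | |- computable (fun x => divn _ _) => apply: comp_divn
  | |- computable (fun x => modn _ _) => apply: comp_modn
  | |- computable (fun x => polyseq _) => (apply: comp_polyseq || apply: comp_ratpolyseq)
  | |- computable (fun x => Poly _) => apply: comp_Poly
  | |- computable (fun x => \poly_(i < _) _) => apply: comp_poly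
  | |- computable (fun x => polyC _) => apply: comp_polyC
  | |- computable (fun x => 'X^_) => apply: comp_Xn
  | |- computable (fun x => GRing.exp _ _) => apply: comp_expp
  | |- computable (fun x => GRing.add (_ : {poly int}) (GRing.opp _)) => apply: comp_subp
  | |- computable (fun x => GRing.add (_ : {poly int}) _) => apply: comp_addp
  | |- computable (fun x => GRing.mul (_ : {poly int}) _) => apply: comp_mulp
  | |- computable (fun x => mx2 _ _ _ _) => apply: comp_mx2
  | |- computable (fun x => mulmx _ _) => apply: comp_mulmx
  | |- computable (fun x => fun_of_matrix _ _ _) => apply: comp_mxE
  | |- computable (fun x => \sum_(0 <= i < _) _) => apply: comp_sum
  | |- computable (fun x => \prod_(0 <= i < _) _) => apply: comp_prod
  | _ => comp_step1
  end.
Ltac solve_comp := repeat (comp_step; cbv beta).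

(** * The Farey graph *)

Lemma det2E (g : 'M[int]_2) : \det g = g 0 0 * g 1 1 - g 0 1 * g 1 0.
Proof.
rewrite (expand_det_row _ 0) big_ord_recl big_ord1 /cofactor !det_mx11 !mxE /=.
rewrite expr0 mul1r [(-1) ^+ _]expr1 mulN1r mulrN.
by congr (g _ _ * g _ _ - g _ _ * g _ _); apply/val_inj.
Qed.

Lemma SL2ZE (g : 'M[int]_2) : SL2Z g <-> g 0 0 * g 1 1 - g 0 1 * g 1 0 = 1.
Proof. by rewrite /SL2Z det2E. Qed.

Lemma SL2Z_unit g : SL2Z g -> g \in unitmx.
Proof. by rewrite /SL2Z unitmxE => ->; rewrite unitr1. Qed.

Lemma SL2ZM g h : SL2Z g -> SL2Z h -> SL2Z (g *m h).
Proof. by rewrite /SL2Z det_mulmx => -> ->; rewrite mulr1. Qed.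

Lemma SL2ZV g : SL2Z g -> SL2Z (invmx g).
Proof. by rewrite /SL2Z det_inv => ->; rewrite invr1. Qed.

(** The adjugate: on determinant 1 it is the inverse, and it is given by a formula that a program
    can evaluate. *)
Definition adj2 (g : 'M[int]_2) : 'M[int]_2 :=
  mx2 (g 1 1) (- g 0 1) (- g 1 0) (g 0 0).

Lemma adj2E g : SL2Z g -> adj2 g = invmx g.
Proof.
move=> Hg; have Ug := SL2Z_unit Hg; move/SL2ZE: Hg => E.
rewrite -[LHS](mulmxK Ug) -[RHS]mul1mx; congr (_ *m _).
by apply: mx2P; rewrite mulmx2E !mxE /=; lia.
Qed.

(** Homogeneous coordinates on the projective line; on them a matrix acts linearly, which avoids the
    case distinctions of [mobius]. *)
Definition pt (p q : int) : P1Q := if q == 0 then None else Some (p%:Q / q%:Q).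

Lemma mobius_inf g : mobius g None = pt (g 0 0) (g 1 0).
Proof. by rewrite /mobius /pt intr_eq0. Qed.

Lemma mobius_0 g : mobius g (Some 0) = pt (g 0 1) (g 1 1).
Proof. by rewrite /mobius /pt !mulr0 !add0r intr_eq0. Qed.

Lemma mobius_pt g (p q : int) : SL2Z g -> (p != 0) || (q != 0) ->
  mobius g (pt p q) = pt (g 0 0 * p + g 0 1 * q) (g 1 0 * p + g 1 1 * q).
Proof.
move=> /SL2ZE E pq; rewrite {1}/pt; move: pq; have [->|q0 _] := eqVneq q 0.
  rewrite orbF => p0; rewrite mobius_inf !mulr0 !addr0 /pt mulf_eq0 (negbTE p0) orbF.
  have [//|c0] := eqVneq (g 1 0) 0; congr Some; rewrite !intrM.
  have p0' : p%:Q != 0 by rewrite intr_eq0.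
  have c0' : (g 1 0)%:Q != 0 by rewrite intr_eq0.
  by field; rewrite c0' p0'.
have q0' : q%:Q != 0 by rewrite intr_eq0.
have Eden : (g 1 0)%:Q * (p%:Q / q%:Q) + (g 1 1)%:Q = (g 1 0 * p + g 1 1 * q)%:Q / q%:Q.
  by rewrite intrD !intrM; field.
rewrite /mobius /pt Eden mulf_eq0 invr_eq0 (negbTE q0') orbF intr_eq0.
have [//|d0] := eqVneq (g 1 0 * p + g 1 1 * q) 0; congr Some.
have d0' : (g 1 0 * p + g 1 1 * q)%:Q != 0 by rewrite intr_eq0.
move: d0'; rewrite !intrD !intrM => d0'; field.
by rewrite d0' q0'.
Qed.

Lemma pt_ratE r : Some r = pt (numq r) (denq r) :> P1Q.
Proof. by rewrite /pt (negbTE (denq_neq0 r)) divq_num_den. Qed.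

Lemma mobiusM g h x : SL2Z g -> SL2Z h -> mobius (g *m h) x = mobius g (mobius h x).
Proof.
move=> Hg Hh; have [p [q [-> pq]]] : exists p q : int, x = pt p q /\ (p != 0) || (q != 0).
  case: x => [r|]; last by exists 1, 0.
  by exists (numq r), (denq r); rewrite -pt_ratE denq_neq0 orbT.
rewrite (mobius_pt Hh) // !mobius_pt //; last exact: SL2ZM.
  by rewrite !mulmx2E; congr pt; ring.
(* The image vector is nonzero: applying the adjugate of [h] recovers [(p, q)], which would vanish
   with it. *)
rewrite -negb_and; apply/negP => /andP[/eqP E1 /eqP E2].
move/SL2ZE: Hh => E; move: pq; rewrite -negb_and => /negP; apply.
have -> : p = (h 0 0 * h 1 1 - h 0 1 * h 1 0) * p by rewrite E mul1r.
have -> : q = (h 0 0 * h 1 1 - h 0 1 * h 1 0) * q by rewrite E mul1r.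
have -> : (h 0 0 * h 1 1 - h 0 1 * h 1 0) * p =
  h 1 1 * (h 0 0 * p + h 0 1 * q) - h 0 1 * (h 1 0 * p + h 1 1 * q) by ring.
have -> : (h 0 0 * h 1 1 - h 0 1 * h 1 0) * q =
  h 0 0 * (h 1 0 * p + h 1 1 * q) - h 1 0 * (h 0 0 * p + h 0 1 * q) by ring.
by rewrite E1 E2 !mulr0 subr0 eqxx.
Qed.

Lemma mobius2M g h x : SL2Z g -> SL2Z h -> mobius2 (g *m h) x = mobius2 g (mobius2 h x).
Proof. by move=> Hg Hh; rewrite /mobius2 /= !mobiusM. Qed.

Lemma ptN (p q : int) : pt (- p) (- q) = pt p q.
Proof.
rewrite /pt oppr_eq0; case: eqP => // _; congr Some.
by rewrite !mulrNz invrN mulrNN.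
Qed.

(** For coprime [p], [q] with [q > 0], [s] is the inverse of [p] modulo [q], and [r/s] is the
    neighbour of [p/q] in the Farey graph with smaller denominator, lying to its left. For [q = 1]
    it is infinity, written [(-1, 0)]. *)
Definition farey_parent (p q : int) : int * int :=
  let s := ((egcdz p q).1 %% q)%Z in (((p * s - 1) %/ q)%Z, s).

Lemma farey_parentP (p q r s : int) : 0 < q -> coprimez p q ->
  farey_parent p q = (r, s) -> [/\ 0 <= s, s < q & p * s - r * q = 1].
Proof.
move=> q0 pq; rewrite /farey_parent; case: egcdzP => u v Euv _ /= [<- <-] {r s}.
have /eqP Eg : gcdz p q == 1 by [].
rewrite Eg in Euv; have q0' : q != 0 by lia.
have dv : (q %| p * (u %% q)%Z - 1)%Z.
  have -> : p * (u %% q)%Z - 1 = q * (- v - p * (u %/ q)%Z).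
    have := divz_eq u q; set m := (u %/ q)%Z; set s := (u %% q)%Z => Eu.
    have : p * u = p * (m * q + s) by rewrite -Eu.
    by lia.
  exact: dvdz_mulr.
split; [exact: modz_ge0 | exact: ltz_pmod |].
by rewrite divzK //; ring.
Qed.

(** The determinant condition fixes [s] modulo [q], and two residues in [[0, q)] that differ by a
    multiple of [q] agree; then [r] is determined by cancelling [q]. *)
Lemma farey_parent_uniq (p q r s : int) : 0 <= s -> s < q -> p * s - r * q = 1 ->
  farey_parent p q = (r, s).
Proof.
move=> s0 sq E; have q0 : 0 < q by lia.
have pq : coprimez p q.
  by apply/coprimezP; exists (s, - r) => /=; lia.
case Er : (farey_parent p q) => [r' s'].
have [s0' sq' E'] := farey_parentP q0 pq Er.
have dv : (q %| s - s')%Z.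
  have : (q %| p * (s - s'))%Z.
    by apply/dvdzP; exists (r - r'); lia.
  by rewrite Gauss_dvdzr // coprimez_sym.
have Es : s = s'.
  move/dvdzP: dv => [m Em]; suff : m = 0 by lia.
  nia.
have Er' : r = r' by subst s'; apply: (mulIf (_ : q != 0)); lia.
by rewrite Es Er'.
Qed.

Lemma SL2Z_coprime g : SL2Z g -> coprimez (g 0 0) (g 1 0).
Proof. by move=> /SL2ZE E; apply/coprimezP; exists (g 1 1, - g 0 1) => /=; lia. Qed.

Lemma SL2Z_coprime1 g : SL2Z g -> coprimez (g 0 1) (g 1 1).
Proof. by move=> /SL2ZE E; apply/coprimezP; exists (- g 1 0, g 0 0) => /=; lia. Qed.

(** Descent to infinity along Farey parents: a finite cusp is [g oo] for the [g] whose columns are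
    the cusp and its parent [g 0], and the denominator strictly drops. *)
Lemma farey_ind (P : P1Q -> Prop) : P None ->
  (forall g, SL2Z g -> P (mobius g (Some 0)) -> P (mobius g None)) -> forall x, P x.
Proof.
move=> P0 PS; suff H n p q : 0 <= q -> (`|q| < n)%N -> coprimez p q -> P (pt p q).
  case=> [r|] //; rewrite pt_ratE; apply: (H `|denq r|.+1) => //.
  exact: coprime_num_den.
elim: n p q => // n IHn p q q0 qn pq.
have [->//|q0'] := eqVneq q 0; have {q0 q0'} q0 : 0 < q by lia.
case Er : (farey_parent p q) => [r s].
have [s0 sq E] := farey_parentP q0 pq Er.
pose g := mx2 p r q s; have Hg : SL2Z g by apply/SL2ZE; rewrite !mxE /=; lia.
have := PS g Hg; rewrite mobius_0 mobius_inf !mxE /=; apply.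
apply: IHn => //; first by lia.
by apply/coprimezP; exists (- q, p) => /=; lia.
Qed.

Lemma mobius_inf_surj x : exists2 g, SL2Z g & x = mobius g None.
Proof.
elim/farey_ind: x => [|g Hg _]; last by exists g.
by exists 1%:M; rewrite ?mobius_inf /pt ?mxE //; exact: det1.
Qed.

(** [Smx] exchanges 0 and infinity, [Umx] permutes infinity, 0, 1 cyclically and [U2mx] is its
    square; [Tmx] and [Nmx] generate the stabilizer of infinity. *)
Definition Smx : 'M[int]_2 := mx2 0 (-1) 1 0.
Definition Umx : 'M[int]_2 := mx2 0 (-1) 1 (-1).
Definition U2mx : 'M[int]_2 := mx2 (-1) 1 (-1) 0.
Definition Tmx : 'M[int]_2 := mx2 1 1 0 1.
Definition Nmx : 'M[int]_2 := mx2 (-1) 0 0 (-1).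

(** * Manin's relations and potentials on the Farey graph *)

Section Manin.
Variables (W : zmodType) (f : 'M[int]_2 -> W).
Hypothesis fS : forall g, SL2Z g -> f g + f (g *m Smx) = 0.
Hypothesis fU : forall g, SL2Z g -> f g + f (g *m Umx) + f (g *m U2mx) = 0.

(** The sum of [f] over the edges of the path of Farey parents from [p/q] to infinity, where the
    potential is normalized to 0. Denominators decrease, so any fuel above [q] suffices. *)
Fixpoint manin_rec (n : nat) (p q : int) : W :=
  if n is n'.+1 then
    if q == 0 then 0 else
    let: (r, s) := farey_parent p q in f (mx2 p r q s) + manin_rec n' r s
  else 0.

Lemma manin_recS n p q r s : q != 0 -> farey_parent p q = (r, s) ->
  manin_rec n.+1 p q = f (mx2 p r q s) + manin_rec n r s.
Proof. by move=> /negbTE /= -> [-> ->]. Qed.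

Lemma manin_rec_fuel n m p q : (`|q| < n)%N -> (`|q| < m)%N ->
  0 <= q -> coprimez p q -> manin_rec n p q = manin_rec m p q.
Proof.
elim: n m p q => // n IHn [|m] p q qn qm // q0 pq.
have [->//|q0'] := eqVneq q 0; have {}q0 : 0 < q by lia.
case Er : (farey_parent p q) => [r s].
have [s0 sq E] := farey_parentP q0 pq Er.
rewrite !(manin_recS _ q0' Er); congr (_ + _); apply: IHn => //; [lia | lia |].
by apply/coprimezP; exists (- q, p) => /=; lia.
Qed.

Definition manin (x : P1Q) : W :=
  if x is Some r then manin_rec `|denq r|.+1 (numq r) (denq r) else 0.

Lemma manin_ptE p q : coprimez p q -> 0 <= q -> manin (pt p q) = manin_rec `|q|.+1 p q.
Proof.
move=> pq q0; rewrite /pt; case: eqP => [->//|/eqP q0'].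
by rewrite /manin coprimeq_num // coprimeq_den // (negbTE q0') gtr0_sg; [rewrite mul1r gtr0_norm //; lia | lia].
Qed.

Let edge g := f g = manin (mobius g None) - manin (mobius g (Some 0)).

Let SL2Z_S : SL2Z Smx. Proof. by apply/SL2ZE; rewrite !mxE. Qed.
Let SL2Z_U : SL2Z Umx. Proof. by apply/SL2ZE; rewrite !mxE. Qed.

Let edgeS g : SL2Z g -> edge (g *m Smx) -> edge g.
Proof.
move=> Hg; rewrite /edge !mobius_inf !mobius_0 !mulmx2E !mxE /=.
rewrite !(mulr0, mulr1, mulrN1, addr0, add0r) ptN => E.
by have /eqP := fS Hg; rewrite addr_eq0 E => /eqP ->; rewrite opprB.
Qed.

(** Here the second column of [g] is the Farey parent of the first, so the edge is the first one on
    the path defining the potential. *)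
Let edge_parent g : SL2Z g -> 0 <= g 1 1 -> g 1 1 < g 1 0 -> edge g.
Proof.
move=> Hg s0 sq; have pq := SL2Z_coprime Hg; move/SL2ZE: (Hg) => E.
rewrite /edge mobius_inf mobius_0.
have rs := SL2Z_coprime1 Hg.
rewrite !manin_ptE //; last lia.
have q0 : g 1 0 != 0 by lia.
rewrite (manin_recS _ q0 (farey_parent_uniq s0 sq E)) (@manin_rec_fuel _ `|g 1 1|.+1) ?addrK //; last by lia.
by congr f; apply: mx2P; rewrite !mxE.
Qed.

(** With bottom row [(q, s)] and [s < 0], the triangle formed by [g], [gU], [gU^2] reduces the claim
    to two edges: [gU] has bottom row [(s, -q-s)] of smaller norm, and [gU^2 S] has bottom row
    [(q, q+s)], which is a parent edge. *)
Let edge_step g : SL2Z g -> 0 < g 1 0 -> - g 1 0 <= g 1 1 -> g 1 1 < g 1 0 ->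
  (forall h, SL2Z h -> (`|h 1%R 0%R| + `|h 1%R 1%R| < `|g 1%R 0%R| + `|g 1%R 1%R|)%N -> edge h) -> edge g.
Proof.
move=> Hg q0 sq1 sq2 IH; have [s0|s0] := lerP 0 (g 1 1); first exact: edge_parent.
have eU : edge (g *m Umx).
  apply: IH; first exact: SL2ZM.
  by rewrite !mulmx2E !mxE /=; lia.
have eU2 : edge (g *m U2mx).
  have HgU2 : SL2Z (g *m U2mx) by apply: SL2ZM => //; apply/SL2ZE; rewrite !mxE.
  apply: edgeS => //; have HgU3 := SL2ZM HgU2 SL2Z_S.
  by apply: edge_parent => //; rewrite !mulmx2E !mxE /=; lia.
have /eqP := fU Hg; rewrite -addrA addr_eq0 /edge => /eqP ->; rewrite eU eU2.
rewrite !mobius_inf !mobius_0 !mulmx2E !mxE /=.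
by rewrite !(mulr0, mulr1, addr0, add0r) addrA addrNK opprB.
Qed.

(** Induction on the sum of absolute values in the bottom row, which right multiplication by [S]
    preserves. *)
Lemma manin_edge g : SL2Z g ->
  f g = manin (mobius g None) - manin (mobius g (Some 0)).
Proof.
have [n] := ubnP (`|g 1%R 0%R| + `|g 1%R 1%R|)%N; elim: n g => // n IHn g gn Hg.
have rot h : SL2Z h -> (`|h 1%R 0%R| + `|h 1%R 1%R| <= n)%N -> 0 < h 1 0 ->
    - h 1 0 <= h 1 1 -> h 1 1 < h 1 0 -> edge h.
  move=> Hh hn h0 h1 h2; apply: edge_step => // h' Hh' h'n.
  by apply: IHn => //; lia.
have HS h : SL2Z h -> SL2Z (h *m Smx) by move=> Hh; apply: SL2ZM.
have E := (iffLR (SL2ZE g) Hg).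
have nz : g 1 0 <> 0 \/ g 1 1 <> 0.
  by case: (eqVneq (g 1 0) 0) => [e0|/eqP]; [right => e1; move: E; rewrite e0 e1 !mulr0 | left].
(* [S] turns the bottom row [(q, s)] into [(s, -q)], a quarter turn. The four rotated copies of the
   cone [-q <= s < q] cover all nonzero rows, so at most three turns reach the case treated by
   [rot]. *)
have [C|[C|[C|C]]] :
  (0 < g 1 0 /\ - g 1 0 <= g 1 1 < g 1 0) \/
  (0 < g 1 1 /\ - g 1 1 <= - g 1 0 < g 1 1) \/
  (0 < - g 1 0 /\ - - g 1 0 <= - g 1 1 < - g 1 0) \/
  (0 < - g 1 1 /\ - - g 1 1 <= g 1 0 < - g 1 1) by lia.
- by apply: rot => //; lia.
- by apply: edgeS => //; apply: rot; rewrite ?mulmx2E ?mxE /=; do 1?[exact: HS | lia].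
- apply: edgeS => //; apply: edgeS; first exact: HS.
  by apply: rot; rewrite ?mulmx2E ?mxE /=; do 1?[exact/HS/HS | lia].
- apply: edgeS => //; apply: edgeS; first exact: HS.
  apply: edgeS; first exact/HS/HS.
  by apply: rot; rewrite ?mulmx2E ?mxE /=; do 1?[exact/HS/HS/HS | lia].
Qed.

End Manin.

(** * Symmetric powers *)

Definition symn (N : nat) (g : 'M[int]_2) (a : nat) : {poly int} :=
  ((g 0 0)%:P * 'X + (g 1 0)%:P) ^+ a * ((g 0 1)%:P * 'X + (g 1 1)%:P) ^+ (N - a).

Lemma size_linear (u v : int) : (size (u%:P * 'X + v%:P)%R <= 2)%N.
Proof. by rewrite size_MXaddC; case: ifP => // _; rewrite ltnS size_polyC_leq1. Qed.

Lemma size_linear_exp (u v : int) n : (size ((u%:P * 'X + v%:P) ^+ n)%R <= n.+1)%N.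
Proof.
apply: leq_trans (size_poly_exp_leq _ _) _; rewrite ltnS.
have := size_linear u v; case: (size _) => [|[|[|m]]] //= _; rewrite ?mul0n //.
by rewrite mul1n.
Qed.

Lemma symn1 N a : symn N 1%:M a = 'X^a.
Proof.
by rewrite /symn !mxE /= mul1r addr0 mul0r add0r expr1n mulr1.
Qed.

Section Homogenization.
Variables L1 L2 : {poly int}.

Let hom N (P : {poly int}) : {poly int} := \sum_(b < N.+1) P`_b *: (L1 ^+ b * L2 ^+ (N - b)).

Let hom_linear N (P : {poly int}) (u v : int) : (size P <= N.+1)%N ->
  hom N.+1 ((u%:P * 'X + v%:P) * P) = (u%:P * L1 + v%:P * L2) * hom N P.
Proof.
move=> sP; rewrite !mul_polyC !mulrDl -!scalerAl mul_polyC /hom.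
under eq_bigr => b _ do rewrite coefD !coefZ scalerDl.
rewrite big_split /=; congr (_ + _).
  rewrite big_ord_recl coefXM /= mulr0 scale0r add0r mulr_sumr scaler_sumr.
  apply: eq_bigr => b _; rewrite coefXM /= -scalerA; congr (_ *: _).
  by rewrite -scalerAr exprS mulrA subSS.
rewrite big_ord_recr /= [P`_N.+1]nth_default // mulr0 scale0r addr0.
rewrite mulr_sumr scaler_sumr; apply: eq_bigr => b _.
rewrite -scalerA; congr (_ *: _); rewrite -scalerAr; congr (_ *: _).
by rewrite mulrCA -exprS -subSn // -ltnS.
Qed.

(** The left side substitutes [(L1, L2)] for [(X, Y)] in the degree [N] form whose dehomogenization
    is [symn N g a]. Substitution is multiplicative, so the product is built one linear factor at a
    time by [hom_linear]. *)
Lemma homogenize_symn N g a : (a <= N)%N ->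
  \sum_(b < N.+1) (symn N g a)`_b *: (L1 ^+ b * L2 ^+ (N - b)) =
  ((g 0 0)%:P * L1 + (g 1 0)%:P * L2) ^+ a *
  ((g 0 1)%:P * L1 + (g 1 1)%:P * L2) ^+ (N - a).
Proof.
have H2 m : hom m (((g 0 1)%:P * 'X + (g 1 1)%:P) ^+ m) =
    ((g 0 1)%:P * L1 + (g 1 1)%:P * L2) ^+ m.
  elim: m => [|m IHm]; first by rewrite /hom big_ord1 !expr0 coef1 mulr1 scale1r.
  by rewrite exprS hom_linear ?size_linear_exp // IHm -exprS.
move=> aN; rewrite -[LHS]/(hom N (symn N g a)) /symn.
have [m ->] : exists m, N = (a + m)%N by exists (N - a)%N; lia.
rewrite addKn {N aN}.
elim: a => [|a IHa]; first by rewrite !expr0 !mul1r add0n H2.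
rewrite !exprS -!mulrA addSn hom_linear ?IHa //.
apply: leq_trans (size_polyMleq _ _) _.
have := size_linear_exp (g 0 0) (g 1 0) a.
have := size_linear_exp (g 0 1) (g 1 1) m.
move: (size _) (size _) => x y; lia.
Qed.

End Homogenization.

(** Homogenized substitution with [L1], [L2] the images of [X], [Y] under [g]: this is functoriality
    of the symmetric power. *)
Lemma symnM N g h a : (a <= N)%N ->
  symn N (g *m h) a = \sum_(b < N.+1) (symn N h a)`_b *: symn N g b.
Proof.
move=> aN; rewrite [LHS]/symn [X in _ = X]homogenize_symn // !mulmx2E.
by congr (_ ^+ _ * _ ^+ _); rewrite !rmorphD !rmorphM /=; ring.
Qed.

(** * The rings Z[z] and Q(z) *)

Section Evaluation.
Variable z : algC.

Lemma evalZE p : evalZ z p = horner_eval z (map_poly intr p).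
Proof. by []. Qed.

Lemma evalZD : {morph evalZ z : p q / p + q}.
Proof. by move=> p q; rewrite !evalZE !rmorphD. Qed.
Lemma evalZB : {morph evalZ z : p q / p - q}.
Proof. by move=> p q; rewrite !evalZE !rmorphB. Qed.
Lemma evalZM : {morph evalZ z : p q / p * q}.
Proof. by move=> p q; rewrite !evalZE !rmorphM. Qed.
Lemma evalZ0 : evalZ z 0 = 0.
Proof. by rewrite evalZE !rmorph0. Qed.
Lemma evalZC c : evalZ z c%:P = c%:~R.
Proof. by rewrite /evalZ map_polyC hornerC. Qed.
Lemma evalZ_sum (I : Type) (r : seq I) (P : pred I) (F : I -> {poly int}) :
  evalZ z (\sum_(i <- r | P i) F i) = \sum_(i <- r | P i) evalZ z (F i).
Proof. exact: (big_morph _ evalZD evalZ0). Qed.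

Lemma in_Zz_eval p : in_Zz z (evalZ z p). Proof. by exists p. Qed.

Lemma in_Zz_int (c : int) : in_Zz z c%:~R.
Proof. by exists c%:P; rewrite evalZC. Qed.

Lemma in_ZzM c d : in_Zz z c -> in_Zz z d -> in_Zz z (c * d).
Proof. by move=> [p ->] [q ->]; exists (p * q); rewrite evalZM. Qed.

Lemma in_ZzMn c m : in_Zz z c -> in_Zz z (c *+ m).
Proof. by move=> Hc; rewrite -mulr_natr; apply: in_ZzM (in_Zz_int m%:Z). Qed.

Lemma evalQE p : evalQ z p = horner_eval z (map_poly ratr p).
Proof. by []. Qed.

Lemma in_QzD c d : in_Qz z c -> in_Qz z d -> in_Qz z (c + d).
Proof. by move=> [p ->] [q ->]; exists (p + q); rewrite !evalQE !rmorphD. Qed.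

Lemma in_QzM c d : in_Qz z c -> in_Qz z d -> in_Qz z (c * d).
Proof. by move=> [p ->] [q ->]; exists (p * q); rewrite !evalQE !rmorphM. Qed.

Lemma in_Qz_rat (c : rat) : in_Qz z (ratr c).
Proof. by exists c%:P; rewrite /evalQ map_polyC hornerC. Qed.

Lemma in_Zz_Qz c : in_Zz z c -> in_Qz z c.
Proof.
move=> [p ->]; exists (map_poly intr p); rewrite /evalQ /evalZ -map_poly_comp.
by congr horner; apply: eq_map_poly => x /=; rewrite ratr_int.
Qed.

Lemma in_Qz_int (c : int) : in_Qz z c%:~R.
Proof. exact/in_Zz_Qz/in_Zz_int. Qed.

Lemma in_Qz_sum (I : Type) (r : seq I) (F : I -> algC) :
  (forall i, in_Qz z (F i)) -> in_Qz z (\sum_(i <- r) F i).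
Proof.
move=> HF; elim/big_ind: _ => // [|x y]; [exact: (in_Qz_int 0) | exact: in_QzD].
Qed.

Lemma in_Qz_clear c : in_Qz z c -> exists2 m : nat, (0 < m)%N & in_Zz z (c *+ m).
Proof.
move=> [p ->]; have [q [a a0 ->]] := rat_poly_scale p.
have E : a%:~R * evalQ z (a%:~R^-1 *: map_poly intr q) = evalZ z q.
  rewrite evalQE map_polyZ /= /horner_eval hornerZ fmorphV /= ratr_int.
  rewrite -map_poly_comp (eq_map_poly (_ : ratr \o intr =1 intr)); last first.
    by move=> x /=; rewrite ratr_int.
  by rewrite mulVKf // intr_eq0.
exists `|a|%N; first by rewrite absz_gt0.
(* The scaling integer [a] may be negative; then its absolute value is used and the sign moves to
   the polynomial. *)
case: a a0 E => n a0 E /=; first by rewrite -mulr_natl E; exact: in_Zz_eval.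
exists (- q); rewrite -mulr_natl -[X in evalZ z X]sub0r evalZB evalZ0 sub0r -E NegzE mulrNz mulNr opprK.
by [].
Qed.

Lemma in_Qz_clear_family (n : nat) (c : nat -> algC) : (forall i, in_Qz z (c i)) ->
  exists2 m : nat, (0 < m)%N & forall i, (i < n)%N -> in_Zz z (c i *+ m).
Proof.
move=> Hc; elim: n => [|n [m m0 Hm]]; first by exists 1%N.
have [m' m'0 Hm'] := in_Qz_clear (Hc n); exists (m * m')%N; first by rewrite muln_gt0 m0.
move=> i; rewrite ltnS leq_eqVlt => /predU1P[->|/Hm Hi].
  by rewrite mulnC mulrnA; exact: in_ZzMn.
by rewrite mulrnA; exact: in_ZzMn.
Qed.

End Evaluation.

(** * Linear maps on free modules *)

Section FreeModule.
Variables (K : choiceType) (V : lmodType algC).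
Implicit Types (f : K -> V) (x : {freeg K / algC}).

HB.instance Definition _ f := GRing.isZmodMorphism.Build {freeg K / algC} V (fglift f)
  (lift_is_additive f).

Lemma fgliftZ f c x : fglift f (c *: x) = c *: fglift f x.
Proof.
have -> : c *: x = \sum_(i <- dom x) << c * coeff i x *g i >> by [].
have E : fglift f x = \sum_(i <- dom x) fglift f << coeff i x *g i >>.
  by rewrite -{1}(freeg_sumE x) raddf_sum.
rewrite E raddf_sum scaler_sumr.
by apply: eq_bigr => i _; rewrite /= !liftU scalerA.
Qed.

Lemma fgliftD f x y : fglift f (x + y) = fglift f x + fglift f y.
Proof. exact: raddfD. Qed.

Lemma fgliftB f x y : fglift f (x - y) = fglift f x - fglift f y.
Proof. exact: raddfB. Qed.

Lemma fglift1 f i : fglift f << i >> = f i.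
Proof. by rewrite liftU scale1r. Qed.

Lemma freeg_scaleU c i : << c *g i >> = c *: (<< i >> : {freeg K / algC}).
Proof.
by apply/eqP/freeg_eqP => j; rewrite coeffZ !coeffU mul1r.
Qed.

Lemma fglift_sum f (I : Type) (r : seq I) (P : pred I) (F : I -> {freeg K / algC}) :
  fglift f (\sum_(i <- r | P i) F i) = \sum_(i <- r | P i) fglift f (F i).
Proof. exact: raddf_sum. Qed.

Lemma freeg_lin_sum x : x = \sum_(i <- dom x) coeff i x *: << i >>.
Proof.
by rewrite -[LHS]freeg_sumE; apply: eq_bigr => i _; rewrite freeg_scaleU.
Qed.

End FreeModule.

(** A pair (coset, monomial exponent) is flattened to [l = j * w + b]; this isolates the block of
    one coset. *)
Lemma sum_divmod (V : nmodType) (r w j : nat) (F : nat -> V) :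
  (0 < w)%N -> (j < r)%N ->
  \sum_(l < r * w | (l %/ w)%N == j) F l = \sum_(b < w) F (j * w + b)%N.
Proof.
move=> w0 jr; rewrite -(big_mkord (fun l => (l %/ w)%N == j) F).
rewrite (@big_cat_nat _ _ _ (j * w)) ?leq_mul2r ?(ltnW jr) ?orbT //=.
rewrite [X in X + _]big_nat_cond [X in X + _]big_pred0 ?add0r; last first.
  move=> l; apply/negP => /andP[/andP[_ lt_l] /eqP E].
  by move: lt_l; rewrite -ltn_divLR // E ltnn.
rewrite (@big_cat_nat _ _ _ (j.+1 * w)) ?leq_mul2r ?leqnSn ?jr ?orbT //=.
rewrite [X in _ + X]big_nat_cond [X in _ + X]big_pred0 ?addr0; last first.
  move=> l; apply/negP => /andP[/andP[lt_l _] /eqP E].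
  by move: lt_l; rewrite -leq_divRL // E ltnn.
rewrite mulSn addnC -{1}[(j * w)%N]add0n big_addn addKn big_mkord.
apply: eq_big => [b|b _]; last by rewrite addnC.
by rewrite addnC divnMDl // divn_small ?ltn_ord // addn0 eqxx.
Qed.

(** * Coinvariants of symbols *)

Section Coinvariants.
Variables (T : choiceType) (act : 'M[int]_2 -> T -> T) (N : nat).
Variables (z : algC) (G G' : 'M[int]_2 -> Prop) (eps : 'M[int]_2 -> algC).
Variable rel0 : symb T N.+2 -> Prop.
Hypotheses (sG' : subgroup_SL2Z G') (GG' : forall g, G g -> G' g).
Hypothesis eps_char : character_mod z G G' eps.

Local Notation V := (symb T N.+2).
Local Notation Rel := (rels act z G G' eps rel0).
Local Notation w := N.+1.

(* The kernel of the projection onto the coinvariants tensored with Q. *)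
Definition relsQ (x : V) : Prop := exists2 m : nat, (0 < m)%N & Rel (x *+ m).

Lemma relsQ_rels x : Rel x -> relsQ x.
Proof. by move=> Hx; exists 1%N. Qed.

Lemma rels_relsQ x : integral z x -> relsQ x -> Rel x.
Proof. by move=> Ix [m m0 Hm]; apply: rels_torsion Hm. Qed.

Lemma rels_muln x m : Rel x -> Rel (x *+ m).
Proof.
move=> Hx; elim: m => [|m IHm]; first by rewrite mulr0n; exact: rels_0.
by rewrite mulrS; exact: rels_add.
Qed.

Lemma relsQ0 : relsQ 0. Proof. exact/relsQ_rels/rels_0. Qed.

Lemma relsQD x y : relsQ x -> relsQ y -> relsQ (x + y).
Proof.
move=> [m m0 Hx] [n n0 Hy]; exists (m * n)%N; first by rewrite muln_gt0 m0.
rewrite mulrnDl; apply: rels_add; first by rewrite mulrnA; exact: rels_muln.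
by rewrite mulnC mulrnA; exact: rels_muln.
Qed.

Lemma relsQZ c x : in_Qz z c -> relsQ x -> relsQ (c *: x).
Proof.
move=> /in_Qz_clear[n n0 Hc] [m m0 Hx]; exists (n * m)%N; first by rewrite muln_gt0 n0.
have -> : (c *: x) *+ (n * m) = (c *+ n) *: (x *+ m).
  by rewrite mulrnA scalerMnl scalerMnr.
exact: rels_scale.
Qed.

Lemma relsQN x : relsQ x -> relsQ (- x).
Proof. by move=> Hx; rewrite -scaleN1r; apply: relsQZ => //; exact: (in_Qz_int z (-1)). Qed.

Lemma relsQB x y : relsQ x -> relsQ y -> relsQ (x - y).
Proof. by move=> Hx Hy; apply: relsQD => //; exact: relsQN. Qed.

Lemma relsQ_congr x y : relsQ (x - y) -> relsQ x -> relsQ y.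
Proof. by move=> Hxy Hx; rewrite -[y](subKr x); exact: relsQB. Qed.

Lemma relsQ_sum (I : Type) (r : seq I) (F : I -> V) :
  (forall i, relsQ (F i)) -> relsQ (\sum_(i <- r) F i).
Proof. by move=> HF; elim/big_ind: _ => // [|x y]; [exact: relsQ0 | exact: relsQD]. Qed.

Lemma relsQ_Mn x m : (0 < m)%N -> relsQ (x *+ m) -> relsQ x.
Proof.
move=> m0 [n n0 Hn]; exists (m * n)%N; first by rewrite muln_gt0 m0.
by rewrite mulrnA.
Qed.

Lemma relsQZV (d : int) x : d != 0 -> relsQ (d%:~R *: x) -> relsQ x.
Proof.
move=> d0 Hx; rewrite -[x]scale1r -(@mulVf _ (d%:~R : algC)) ?intr_eq0 // -scalerA.
apply: relsQZ => //; rewrite -[d%:~R]ratr_int -fmorphV; exact: in_Qz_rat.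
Qed.

Lemma eps_Qz g : G' g -> in_Qz z (eps g).
Proof. by case: eps_char => _ _ H /H []. Qed.

Lemma G'_SL2Z g : G' g -> SL2Z g. Proof. by case: sG' => H _ _ _; exact: H. Qed.
Lemma G'M g h : G' g -> G' h -> G' (g *m h). Proof. by case: sG' => _ _ H _; exact: H. Qed.
Lemma G'V g : G' g -> G' (invmx g). Proof. by case: sG' => _ _ _; exact. Qed.

Lemma epsM g h : G' g -> G' h -> eps (g *m h) = eps g * eps h.
Proof. by case: eps_char => H _ _; exact: H. Qed.

Lemma integral_gen (it : 'I_w * T) : integral z (<< it >> : V).
Proof.
move=> it'; rewrite coeffU mul1r.
by case: (it == it'); [exact: (in_Zz_int z 1) | exact: (in_Zz_int z 0)].
Qed.

Lemma integralZ c (x : V) : in_Zz z c -> integral z x -> integral z (c *: x).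
Proof. by move=> Hc Hx it; rewrite coeffZ; exact: in_ZzM. Qed.

Lemma in_ZzD c d : in_Zz z c -> in_Zz z d -> in_Zz z (c + d).
Proof. by move=> [p ->] [q ->]; exists (p + q); rewrite evalZD. Qed.

Lemma integral_sum (I : Type) (r : seq I) (F : I -> V) :
  (forall i, integral z (F i)) -> integral z (\sum_(i <- r) F i).
Proof.
move=> HF it; rewrite raddf_sum; elim/big_ind: _ => [||i _] /=; last exact: HF.
  exact: (in_Zz_int z 0).
exact: in_ZzD.
Qed.

Lemma sym_actE (g : 'M[int]_2) (a : 'I_w) : @sym_act N.+2 g a = symn N g a.
Proof. by rewrite /sym_act /symn !subSS subn0. Qed.

Lemma symb_actE g (a : 'I_w) t : symb_act act g (<< (a, t) >> : V) =
  \sum_(b < w) ((symn N g a)`_b)%:~R *: << (b, act g t) >>.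
Proof.
rewrite /symb_act fglift1; apply: eq_bigr => b _.
by rewrite sym_actE freeg_scaleU.
Qed.

Lemma symb_act_lin g (x : V) :
  symb_act act g x = \sum_(it <- dom x) coeff it x *: symb_act act g << it >>.
Proof.
rewrite {1}[x]freeg_lin_sum /symb_act fglift_sum.
by apply: eq_bigr => it _; rewrite fgliftZ.
Qed.

(** Coinvariance under [G] is the case where [eps] is 1, and torsion dies because [algC] has
    characteristic 0. Hence only [rel0] and equivariance on generators need checking. *)
Lemma linear_kills (phi : 'I_w * T -> algC^o) :
  (forall x, rel0 x -> fglift phi x = 0) ->
  (forall g (a : 'I_w) t, G' g -> \sum_(b < w) ((symn N g a)`_b)%:~R * phi (b, act g t) =
     eps g * phi (a, t)) ->
  forall x, relsQ x -> fglift phi x = 0.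
Proof.
move=> H0 Heps; have Hact g (x : V) : G' g -> fglift phi (symb_act act g x - eps g *: x) = 0.
  move=> Gg; rewrite fgliftB fgliftZ; apply/eqP; rewrite subr_eq0; apply/eqP.
  rewrite symb_act_lin [in RHS](freeg_lin_sum x) !fglift_sum scaler_sumr.
  apply: eq_bigr => [[a t] _]; rewrite !fgliftZ scalerA mulrC -scalerA.
  congr (_ *: _); rewrite symb_actE fglift_sum fglift1 -[RHS]Heps //.
  by apply: eq_bigr => b _; rewrite fgliftZ fglift1.
have HRel x : Rel x -> fglift phi x = 0.
  elim=> [{}x /H0 //|g {}x Gg _|g {}x Gg _||{}x y _ Ex _ Ey|c {}x _ _ Ex|m {}x m0 _ _ Ex].
  - have := Hact g x (GG' Gg); case: eps_char => _ /(_ g Gg) -> _.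
    by rewrite scale1r.
  - exact: Hact.
  - exact: raddf0.
  - by rewrite fgliftD Ex Ey addr0.
  - by rewrite fgliftZ Ex scaler0.
  - move/eqP: Ex; rewrite raddfMn /= -[_ *+ m]mulr_natr mulf_eq0 pnatr_eq0.
    by case: m m0 => // m _; rewrite orbF => /eqP.
move=> x [m m0 /HRel /eqP]; rewrite raddfMn /= -[_ *+ m]mulr_natr mulf_eq0 pnatr_eq0.
by case: m m0 => // m _; rewrite orbF => /eqP.
Qed.

Variable t0 : T.
Hypothesis act0M : forall g h, SL2Z g -> SL2Z h -> act (g *m h) t0 = act g (act h t0).
Variable R' : seq 'M[int]_2.
Hypothesis HR' : coset_reps G' SL2Z R'.
Local Notation r' := (size R').

(** [g] moves the symbol only, the monomial stays fixed. Manin's relations therefore carry no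
    polynomial action; it appears only on returning to coset representatives, in [gen_reduce]. *)
Definition gen (g : 'M[int]_2) (a : nat) : V := << (inord a, act g t0) >>.
Definition genl (l : nat) : V := gen (nth 0 R' (l %/ w)) (l %% w).

Lemma rep_SL2Z j : (j < r')%N -> SL2Z (nth 0 R' j).
Proof. by move=> jr; case: HR' => H _; apply/H/mem_nth. Qed.

(** Write the generator as [g] applied to the monomial transformed by [g^-1] at [h t0], then replace
    the action of [g] by the scalar [eps g]. *)
Lemma gen_reduce g h a : G' g -> SL2Z h -> (a < w)%N ->
  relsQ (gen (g *m h) a -
         eps g *: \sum_(b < w) ((symn N (invmx g) a)`_b)%:~R *: gen h b).
Proof.
move=> Gg Hh aw; have Hg := G'_SL2Z Gg.
set x := \sum_(b < w) _; suff -> : gen (g *m h) a = symb_act act g x.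
  apply: relsQ_rels; apply: rels_eps => //; apply: integral_sum => b.
  by apply: integralZ; [exact: in_Zz_int | exact: integral_gen].
rewrite {}/x /symb_act fglift_sum.
under eq_bigr => b _.
  rewrite fgliftZ -[fglift _ _]/(symb_act act g _) symb_actE inord_val -act0M // scaler_sumr.
  over.
rewrite exchange_big /=.
have E c : \sum_(b < w) (symn N (invmx g) a)`_b * (symn N g b)`_c = (c == a)%:R.
  have := symnM g (invmx g) (aw : (a <= N)%N).
  rewrite mulmxV ?SL2Z_unit // symn1 => /(congr1 (fun p : {poly int} => p`_c)).
  by rewrite coefXn coef_sum => ->; apply: eq_bigr => b _; rewrite coefZ.
under eq_bigr => c _.
  under eq_bigr => b _ do rewrite scalerA -intrM.
  rewrite -scaler_suml -rmorph_sum /= E; over.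
rewrite (bigD1 (inord a)) //= inordK // eqxx scale1r big1 ?addr0 // => c c_neq.
have /negbTE -> : (c : nat) != a; last by rewrite scale0r.
by apply: contra c_neq => /eqP <-; rewrite inord_val.
Qed.

Lemma coset_decomp g : exists jh : nat * 'M[int]_2, SL2Z g ->
  [/\ (jh.1 < r')%N, G' jh.2 & g = jh.2 *m nth 0 R' jh.1].
Proof.
have [Hg|Hg] := eqVneq (\det g) 1; last by exists (0%N, 0) => E; rewrite E eqxx in Hg.
case: HR' => _ /(_ g Hg) [j [[jr [h Gh E]] _]]; by exists (j, h).
Qed.

Definition coset_of g : nat * 'M[int]_2 :=
  proj1_sig (constructive_indefinite_description _ (coset_decomp g)).

Lemma coset_ofP g : SL2Z g ->
  [/\ ((coset_of g).1 < r')%N, G' (coset_of g).2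
    & g = (coset_of g).2 *m nth 0 R' (coset_of g).1].
Proof. by rewrite /coset_of; case: constructive_indefinite_description. Qed.

Lemma coset_of_uniq g j h : (j < r')%N -> G' h -> g = h *m nth 0 R' j ->
  coset_of g = (j, h).
Proof.
move=> jr Gh E; have Hg : SL2Z g by rewrite E; apply: SL2ZM (G'_SL2Z _) (rep_SL2Z _).
have [jr1 Gh1 E1] := coset_ofP Hg; case: (coset_of g) => j1 h1 /= in jr1 Gh1 E1 *.
have Ej : j1 = j.
  case: HR' => _ /(_ g Hg) [j0 [_ U]].
  by rewrite -(U j1) ?(U j) //; split=> //; [exists h | exists h1].
rewrite Ej in E1 *; congr (_, _).
have U := SL2Z_unit (rep_SL2Z jr).
by rewrite -[LHS](mulmxK U) -E1 E mulmxK.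
Qed.

(* The extension of a functional on the free module with basis [genl] to all
   the symbols [gen], by equivariance. *)
Definition ext (phi : nat -> algC) (g : 'M[int]_2) (a : nat) : algC :=
  let: (j, h) := coset_of g in
  eps h * \sum_(b < w) ((symn N (invmx h) a)`_b)%:~R * phi (j * w + b)%N.

Lemma extE phi j h a : (j < r')%N -> G' h ->
  ext phi (h *m nth 0 R' j) a =
  eps h * \sum_(b < w) ((symn N (invmx h) a)`_b)%:~R * phi (j * w + b)%N.
Proof. by move=> jr Gh; rewrite /ext (coset_of_uniq jr Gh erefl). Qed.

(** If [h = h0 r_j] then [g h = (g h0) r_j] lies in the same coset; multiplicativity of [eps] and of
    the symmetric power, with [h0^-1 = (g h0)^-1 g], give the equivariance. *)
Lemma ext_act phi g h a : G' g -> SL2Z h -> (a < w)%N ->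
  \sum_(b < w) ((symn N g a)`_b)%:~R * ext phi (g *m h) b = eps g * ext phi h a.
Proof.
move=> Gg Hh aw; have [jr Gh0 {1 2}->] := coset_ofP Hh.
case: (coset_of h) => j h0 /= in jr Gh0 *.
rewrite mulmxA extE //; under eq_bigr => b _.
  rewrite (extE _ _ jr (G'M Gg Gh0)) epsM // mulrCA mulr_sumr; over.
rewrite -mulr_sumr -mulrA; congr (_ * (_ * _)); rewrite exchange_big /=.
apply: eq_bigr => c _; under eq_bigr => b _ do rewrite mulrA -intrM.
rewrite -mulr_suml -rmorph_sum /=; congr (_%:~R * _).
have Ug := SL2Z_unit (G'_SL2Z Gg); have Uh := SL2Z_unit (G'_SL2Z Gh0).
have -> : invmx h0 = invmx (g *m h0) *m g.
  have Ugh : g *m h0 \in unitmx by rewrite unitmx_mul Ug.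
  by rewrite -[LHS]mul1mx -(mulVmx Ugh) -!mulmxA mulmxV // mulmx1.
by rewrite symnM // coef_sum; apply: eq_bigr => b _; rewrite coefZ.
Qed.

(* [row] is [d] times the coordinate vector of [gen g a]. *)
Definition coord_row (d : int) (g : 'M[int]_2) (a : nat) (row : nat -> algC) : Prop :=
  exists j h, [/\ (j < r')%N, G' h, g = h *m nth 0 R' j
    & forall l, (l < r' * w)%N -> row l = if (l %/ w)%N == j
        then d%:~R * eps h * ((symn N (invmx h) a)`_(l %% w))%:~R else 0].

Lemma coord_row_sum (V0 : lmodType algC) d j h a row (F : nat -> V0) :
  (j < r')%N -> (forall l, (l < r' * w)%N -> row l = if (l %/ w)%N == j
        then d%:~R * eps h * ((symn N (invmx h) a)`_(l %% w))%:~R else 0) ->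
  \sum_(l < r' * w) row l *: F l = d%:~R *: (eps h *:
     \sum_(b < w) ((symn N (invmx h) a)`_b)%:~R *: F (j * w + b)%N).
Proof.
move=> jr Erow; rewrite (eq_bigr (fun l : 'I_(r' * w) => if (l %/ w)%N == j then
  (d%:~R * eps h * ((symn N (invmx h) a)`_(l %% w))%:~R) *: F l else 0)); last first.
  by move=> l _; rewrite Erow //; case: ifP; rewrite ?scale0r.
rewrite -big_mkcond /= (@sum_divmod _ _ _ _ (fun l =>
  (d%:~R * eps h * ((symn N (invmx h) a)`_(l %% w))%:~R) *: F l)) //.
rewrite !scaler_sumr; apply: eq_bigr => b _.
by rewrite modnMDl modn_small ?scalerA ?mulrA.
Qed.

Lemma coord_row_gen d g a row : coord_row d g a row -> (a < w)%N ->
  relsQ (d%:~R *: gen g a - \sum_(l < r' * w) row l *: genl l).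
Proof.
move=> [j [h [jr Gh -> Erow]]] aw; rewrite (coord_row_sum _ jr Erow) -scalerBr.
apply: relsQZ; first exact: in_Qz_int.
have := gen_reduce Gh (rep_SL2Z jr) aw; congr (relsQ (_ - _ *: _)).
apply: eq_bigr => b _; congr (_ *: _).
by rewrite /genl divnMDl // divn_small // addn0 modnMDl modn_small.
Qed.

Lemma coord_row_ext d g a row (phi : nat -> algC) : coord_row d g a row ->
  \sum_(l < r' * w) row l * phi l = d%:~R * ext phi g a.
Proof.
move=> [j [h [jr Gh -> Erow]]]; rewrite extE //.
exact: (coord_row_sum (phi : nat -> algC^o) jr Erow).
Qed.

Lemma ext_rep phi l : (l < r' * w)%N -> G' 1%:M ->
  ext phi (nth 0 R' (l %/ w)) (l %% w) = phi l.
Proof.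
move=> lw G1; have jr : (l %/ w < r')%N by rewrite ltn_divLR.
have aw : (l %% w < w)%N by rewrite ltn_pmod.
have e1 : eps 1%:M = 1.
  case: eps_char => _ _ /(_ _ G1) [_ n0]; apply: (mulfI n0).
  by rewrite -epsM // mul1mx mulr1.
rewrite -[nth _ _ _]mul1mx extE // e1 mul1r invmx1 symn1.
rewrite (bigD1 (Ordinal aw)) //= coefXn eqxx mul1r big1 ?addr0 => [|b bn].
  by rewrite -divn_eq.
by rewrite coefXn; move: bn; rewrite -val_eqE /= => /negbTE ->; rewrite mul0r.
Qed.

(** By equivariance a relation at [g = g0 r_j] is a combination of the relations at [r_j], up to the
    nonzero factor [eps (g0^-1)]; so finitely many tests suffice. *)
Lemma ext_rel_extend phi (hs : seq (algC * 'M[int]_2)) :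
  (forall h, h \in hs -> SL2Z h.2) ->
  (forall i a, (i < r')%N -> (a < w)%N ->
     \sum_(h <- hs) h.1 * ext phi (nth 0 R' i *m h.2) a = 0) ->
  forall g a, SL2Z g -> (a < w)%N -> \sum_(h <- hs) h.1 * ext phi (g *m h.2) a = 0.
Proof.
move=> Hhs H g a Hg aw; have [jr Gh E] := coset_ofP Hg.
case: (coset_of g) => j g0 /= in jr Gh E *; have Gh' := G'V Gh.
have U := SL2Z_unit (G'_SL2Z Gh).
have e0 : eps (invmx g0) != 0 by case: eps_char => _ _ /(_ _ Gh') [].
apply: (mulfI e0); rewrite mulr0 mulr_sumr.
rewrite (eq_big_seq (fun h : algC * 'M[int]_2 =>
  \sum_(b < w) ((symn N (invmx g0) a)`_b)%:~R * (h.1 * ext phi (nth 0 R' j *m h.2) b))).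
  by rewrite exchange_big big1 // => b _; rewrite -mulr_sumr H ?mulr0.
move=> h hin; rewrite mulrCA -ext_act //; last exact: SL2ZM (Hhs _ hin).
rewrite mulr_sumr; apply: eq_bigr => b _; rewrite mulrCA; congr (_ * (_ * ext _ _ _)).
by rewrite E !mulmxA mulVmx // mul1mx.
Qed.

Definition reducible (x : V) : Prop := exists2 c : nat -> algC,
  forall l, in_Qz z (c l) & relsQ (x - \sum_(l < r' * w) c l *: genl l).

Lemma reducible_relsQ x : relsQ x -> reducible x.
Proof.
exists (fun _ => 0) => [_|]; first exact: (in_Qz_int z 0).
by rewrite big1 ?subr0 // => l _; rewrite scale0r.
Qed.

Lemma reducibleD x y : reducible x -> reducible y -> reducible (x + y).
Proof.
move=> [c Hc Hx] [d Hd Hy]; exists (fun l => c l + d l) => [l|]; first exact: in_QzD.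
have -> : \sum_(l < r' * w) (c l + d l) *: genl l =
   \sum_(l < r' * w) c l *: genl l + \sum_(l < r' * w) d l *: genl l.
  by rewrite -big_split; apply: eq_bigr => l _; rewrite scalerDl.
by rewrite opprD addrACA; exact: relsQD.
Qed.

Lemma reducibleZ e x : in_Qz z e -> reducible x -> reducible (e *: x).
Proof.
move=> He [c Hc Hx]; exists (fun l => e * c l) => [l|]; first exact: in_QzM.
have -> : \sum_(l < r' * w) (e * c l) *: genl l = e *: \sum_(l < r' * w) c l *: genl l.
  by rewrite scaler_sumr; apply: eq_bigr => l _; rewrite scalerA.
by rewrite -scalerBr; exact: relsQZ.
Qed.

Lemma reducible_sum (I : Type) (r : seq I) (F : I -> V) :
  (forall i, reducible (F i)) -> reducible (\sum_(i <- r) F i).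
Proof.
move=> HF; elim/big_ind: _ => // [|x y]; [exact/reducible_relsQ/relsQ0 | exact: reducibleD].
Qed.

Lemma reducible_gen g a : SL2Z g -> (a < w)%N -> reducible (gen g a).
Proof.
move=> Hg aw; have [jr Gh E] := coset_ofP Hg.
case: (coset_of g) => j h /= in jr Gh E *.
have H := gen_reduce Gh (rep_SL2Z jr) aw; rewrite -E in H.
rewrite -[gen g a](subrK (eps h *: \sum_(b < w) ((symn N (invmx h) a)`_b)%:~R *: gen (nth 0 R' j) b)).
apply: reducibleD; first exact: reducible_relsQ.
apply: reducibleZ; first exact: eps_Qz.
apply: reducible_sum => b; apply: reducibleZ; first exact: in_Qz_int.
have lw : (j * w + b < r' * w)%N.
  by rewrite -ltn_divLR // divnMDl // divn_small // addn0.
exists (fun l => (l == j * w + b)%:R) => [l|].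
  by case: (_ == _); [exact: (in_Qz_int z 1) | exact: (in_Qz_int z 0)].
rewrite (bigD1 (Ordinal lw)) //= eqxx scale1r big1 ?addr0 => [|l].
  rewrite /genl divnMDl // divn_small // addn0 modnMDl modn_small // subrr.
  exact: relsQ0.
by rewrite -val_eqE /= => /negbTE ->; rewrite scale0r.
Qed.

Lemma reducible_all : (forall a t, reducible (<< (a, t) >> : V)) ->
  forall x : V, integral z x -> reducible x.
Proof.
move=> Hgen x Ix; rewrite [x]freeg_lin_sum; apply: reducible_sum => [[a t]].
by apply: reducibleZ => //; apply: in_Zz_Qz.
Qed.

End Coinvariants.

(** * Manin's presentation *)

Section Presentation.
Variable A : zmodType.
Variables (m : nat) (r1 rS rU rU2 rT rN : nat -> nat -> A).

(** Stated over an arbitrary group so that the same definition serves the computed polynomial rows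
    and their values at [z]. [r1] stands for the rows of the identity, which carry the same scale
    factor as the other rows. *)
Definition manin_rels (l j : nat) : A :=
  if (l < m)%N then r1 l j + rS l j
  else r1 (l - m)%N j + rU (l - m)%N j + rU2 (l - m)%N j.

Definition cusp_rels (l j : nat) : A :=
  if (l < m)%N then rT l j - r1 l j else rN (l - m)%N j - r1 (l - m)%N j.

Definition boundary_mx (l j : nat) : A := rS l j - r1 l j.

End Presentation.

Section ModularSymbolsModel.
Variable N : nat.
Variables (z : algC) (G G' : 'M[int]_2 -> Prop) (eps : 'M[int]_2 -> algC).
Hypotheses (sG' : subgroup_SL2Z G') (GG' : forall g, G g -> G' g).
Hypothesis eps_char : character_mod z G G' eps.
Variable R' : seq 'M[int]_2.
Hypothesis HR' : coset_reps G' SL2Z R'.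

Local Notation w := N.+1.
Local Notation r' := (size R').
Local Notation m := (r' * w)%N.
Local Notation MrelsQ := (relsQ mobius2 z G G' eps (@three_term N.+2)).
Local Notation BrelsQ := (relsQ mobius z G G' eps (fun _ : Bsymb N.+2 => False)).
Local Notation Mgen := (@gen _ mobius2 N (Some 0, None)).
Local Notation Bgen := (@gen _ mobius N None).
Definition Mgenl : nat -> Msymb N.+2 := @genl _ mobius2 N (Some 0, None) R'.
Definition Bgenl : nat -> Bsymb N.+2 := @genl _ mobius N None R'.
Local Notation ext := (@ext N G' eps R' HR').

Variables (d : int) (r1 rS rU rU2 rT rN : nat -> nat -> algC).
Hypothesis d0 : d != 0.
Let row_of h (rho : nat -> nat -> algC) := forall l, (l < m)%N ->
  coord_row N G' eps R' d (nth 0 R' (l %/ w) *m h) (l %% w) (rho l).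
Hypotheses (H1 : row_of 1%:M r1) (HS : row_of Smx rS) (HU : row_of Umx rU)
  (HU2 : row_of U2mx rU2) (HT : row_of Tmx rT) (HN : row_of Nmx rN).

Let G1 : G' 1%:M. Proof. by case: sG'. Qed.
Let Hrep j : (j < r')%N -> SL2Z (nth 0 R' j).
Proof. exact: rep_SL2Z HR' j. Qed.

Let SL2Z_S : SL2Z Smx. Proof. by apply/SL2ZE; rewrite !mxE. Qed.
Let SL2Z_U : SL2Z Umx. Proof. by apply/SL2ZE; rewrite !mxE. Qed.
Let SL2Z_U2 : SL2Z U2mx. Proof. by apply/SL2ZE; rewrite !mxE. Qed.
Let SL2Z_T : SL2Z Tmx. Proof. by apply/SL2ZE; rewrite !mxE. Qed.
Let SL2Z_N : SL2Z Nmx. Proof. by apply/SL2ZE; rewrite !mxE. Qed.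
Let SL2Z_1 : SL2Z 1%:M. Proof. exact: det1. Qed.

Let mobius2M' g h : SL2Z g -> SL2Z h ->
  mobius2 (g *m h) (Some 0, None) = mobius2 g (mobius2 h (Some 0, None)).
Proof. exact: mobius2M. Qed.
Let mobiusM' g h : SL2Z g -> SL2Z h -> mobius (g *m h) None = mobius g (mobius h None).
Proof. exact: mobiusM. Qed.

Let divw l : (l < m)%N -> (l %/ w < r')%N. Proof. by rewrite ltn_divLR. Qed.
Let modw l : (l %% w < w)%N. Proof. by rewrite ltn_pmod. Qed.

Let Mrow h rho l : SL2Z h -> row_of h rho -> (l < m)%N ->
  MrelsQ (d%:~R *: Mgen (nth 0 R' (l %/ w) *m h) (l %% w) -
          \sum_(j < m) rho l j *: Mgenl j).
Proof.
move=> Hh Hrho lm; exact: (coord_row_gen _ _ _ sG' _ HR' (Hrho l lm)).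
Qed.

Let Brow h rho l : SL2Z h -> row_of h rho -> (l < m)%N ->
  BrelsQ (d%:~R *: Bgen (nth 0 R' (l %/ w) *m h) (l %% w) -
          \sum_(j < m) rho l j *: Bgenl j).
Proof.
move=> Hh Hrho lm; exact: (coord_row_gen _ _ _ sG' _ HR' (Hrho l lm)).
Qed.

Let subBB (V : zmodType) (a b c e : V) : (a - b) - (c - e) = (a - c) - (b - e).
Proof. by rewrite !opprD !opprK addrACA. Qed.

Let sumD (V : lmodType algC) (a b : nat -> algC) (F : nat -> V) :
  \sum_(j < m) (a j + b j) *: F j = \sum_(j < m) a j *: F j + \sum_(j < m) b j *: F j.
Proof. by rewrite -big_split; apply: eq_bigr => j _; rewrite scalerDl. Qed.

Let sumB (V : lmodType algC) (a b : nat -> algC) (F : nat -> V) :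
  \sum_(j < m) (a j - b j) *: F j = \sum_(j < m) a j *: F j - \sum_(j < m) b j *: F j.
Proof. by rewrite -sumrB; apply: eq_bigr => j _; rewrite scalerBl. Qed.

Lemma three_termQ (i : 'I_w) (a b c : P1Q) :
  MrelsQ (<< (i, (a, b)) >> + << (i, (b, c)) >> + << (i, (c, a)) >>).
Proof. exact/relsQ_rels/rels_base/ThreeTerm. Qed.

Lemma symbol_refl (i : 'I_w) (a : P1Q) : MrelsQ << (i, (a, a)) >>.
Proof.
(* Three equal points in the three-term relation give three times the symbol. *)
apply: (@relsQ_Mn _ _ _ _ _ _ _ _ _ 3) => //.
by have := three_termQ i a a a; rewrite !mulrS mulr0n addr0 addrA.
Qed.

Lemma symbol_sym (i : 'I_w) (a b : P1Q) : MrelsQ (<< (i, (a, b)) >> + << (i, (b, a)) >>).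
Proof.
have := relsQB (three_termQ i a b a) (symbol_refl i a).
by rewrite addrK.
Qed.

Let mobius_S g : SL2Z g -> mobius (g *m Smx) None = mobius g (Some 0).
Proof. by move=> Hg; rewrite mobiusM // mobius_inf !mxE. Qed.

Lemma manin_relsP i : (i < m + m)%N ->
  MrelsQ (\sum_(j < m) manin_rels m r1 rS rU rU2 i j *: Mgenl j).
Proof.
move=> im; rewrite /manin_rels; case: ltnP => [{}im|mi].
  rewrite sumD; have E := relsQD (Mrow SL2Z_1 H1 im) (Mrow SL2Z_S HS im).
  rewrite addrACA -opprD in E; apply: relsQ_congr E _; rewrite -scalerDr mulmx1.
  apply: relsQZ; first exact: in_Qz_int.
  have Hg := Hrep (divw im).
  rewrite /gen /mobius2 /= mobius_S // mobiusM // (_ : mobius Smx (Some 0) = None).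
    exact: symbol_sym.
  by rewrite mobius_0 !mxE.
have {}im : (i - m < m)%N by lia.
rewrite (sumD (fun j => r1 (i - m)%N j + rU (i - m)%N j) (rU2 _)) (sumD (r1 _) (rU _)).
have E := relsQD (relsQD (Mrow SL2Z_1 H1 im) (Mrow SL2Z_U HU im))
  (Mrow SL2Z_U2 HU2 im).
rewrite (addrACA (_ *: Mgen (_ *m 1%:M) _)) -opprD addrACA -opprD in E.
apply: relsQ_congr E _; rewrite -!scalerDr mulmx1.
apply: relsQZ; first exact: in_Qz_int.
have Hg := Hrep (divw im).
rewrite /gen /mobius2 /= !mobiusM // !mobius_0 !mobius_inf !mxE /=.
rewrite -!mobius_inf -!mobius_0.
have -> : pt (-1) (-1) = Some 1 by rewrite ptN.
rewrite addrAC; exact: three_termQ.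
Qed.

Let ext_rel (phi : nat -> algC) h1 h2 h3 (c1 c2 c3 : algC) rho1 rho2 rho3 :
  SL2Z h1 -> SL2Z h2 -> SL2Z h3 ->
  row_of h1 rho1 -> row_of h2 rho2 -> row_of h3 rho3 ->
  (forall l, (l < m)%N -> \sum_(j < m) (c1 * rho1 l j + c2 * rho2 l j + c3 * rho3 l j) * phi j = 0) ->
  forall g a, SL2Z g -> (a < w)%N ->
  c1 * ext phi (g *m h1) a + c2 * ext phi (g *m h2) a + c3 * ext phi (g *m h3) a = 0.
Proof.
move=> S1 S2 S3 R1 R2 R3 Hphi g a Hg aw.
have := ext_rel_extend (HR' := HR') (phi := phi)
  (hs := [:: (c1, h1); (c2, h2); (c3, h3)]) sG' eps_char _ _ Hg aw.
rewrite !big_cons big_nil addr0 /= addrA; apply.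
  by move=> h; rewrite !inE => /or3P[] /eqP->.
move=> i b ir bw; rewrite !big_cons big_nil addr0 /=.
have lm : (i * w + b < m)%N by rewrite -ltn_divLR // divnMDl // divn_small // addn0.
have := Hphi _ lm; move: (R1 _ lm) (R2 _ lm) (R3 _ lm).
rewrite divnMDl // divn_small // addn0 modnMDl modn_small // => E1 E2 E3 E.
have d0' : d%:~R != 0 :> algC by rewrite intr_eq0.
apply: (mulfI d0'); rewrite mulr0 !mulrDr !(mulrCA d%:~R).
rewrite -(coord_row_ext sG' HR' phi E1) -(coord_row_ext sG' HR' phi E2).
rewrite -(coord_row_ext sG' HR' phi E3) -[RHS]E !mulr_sumr -!big_split.
by apply: eq_bigr => j _ /=; ring.
Qed.

(** Completeness of Manin's relations in dual form: a functional compatible with the finitely many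
    relations is extended equivariantly to all [g], integrated to a potential on cusps, and then
    defined on every symbol. *)
Lemma manin_rels_ext (phi : nat -> algC) :
  (forall i, (i < m + m)%N ->
     \sum_(j < m) manin_rels m r1 rS rU rU2 i j * phi j = 0) ->
  exists L : 'I_w * (P1Q * P1Q) -> algC^o,
    (forall x, MrelsQ x -> fglift L x = 0) /\
    (forall l, (l < m)%N -> fglift L (Mgenl l) = phi l).
Proof.
move=> Hphi.
have eS g a : SL2Z g -> (a < w)%N -> ext phi g a + ext phi (g *m Smx) a = 0.
  move=> Hg aw; have := @ext_rel phi _ _ _ 1 1 0 _ _ _ SL2Z_1 SL2Z_S SL2Z_1 H1 HS H1 _ g a Hg aw.
  rewrite !mul1r mul0r addr0 mulmx1; apply=> l lm.
  rewrite -[RHS](Hphi l (ltn_addl _ lm)) /manin_rels lm.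
  by apply: eq_bigr => j _; rewrite !mul1r mul0r addr0.
have eU g a : SL2Z g -> (a < w)%N ->
    ext phi g a + ext phi (g *m Umx) a + ext phi (g *m U2mx) a = 0.
  move=> Hg aw; have := @ext_rel phi _ _ _ 1 1 1 _ _ _ SL2Z_1 SL2Z_U SL2Z_U2 H1 HU HU2 _ g a Hg aw.
  rewrite !mul1r mulmx1; apply=> l lm.
  have lm' : (m + l < m + m)%N by rewrite ltn_add2l.
  rewrite -[RHS](Hphi _ lm') /manin_rels ltnNge leq_addr /= addKn.
  by apply: eq_bigr => j _; rewrite !mul1r.
pose F (a : 'I_w) := manin (fun g => ext phi g a).
have FE g (a : 'I_w) : SL2Z g ->
    ext phi g a = F a (mobius g None) - F a (mobius g (Some 0)).
  by apply: manin_edge => h Hh; [exact: eS | exact: eU].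
(* Being a difference of potentials, [L] satisfies the three-term relation automatically; the sign
   makes [{g 0, g oo}] evaluate to [ext phi g]. *)
pose L (it : 'I_w * (P1Q * P1Q)) : algC^o := F it.1 it.2.2 - F it.1 it.2.1.
exists L; split; last first.
  move=> l lm; rewrite /Mgenl /genl /gen fglift1 /L /= -FE ?inordK //; last exact/Hrep/divw.
  exact: (ext_rep sG' eps_char HR' phi lm G1).
apply: (linear_kills GG' eps_char).
  move=> _ [i a b c]; rewrite !fgliftD !fglift1 /L /=; ring.
move=> g a [x y] Gg; have Hg := G'_SL2Z sG' Gg.
(* A potential is equivariant only up to a constant. By [ext_act] the defect is the same at both
   ends of every Farey edge, so it equals its value at infinity everywhere and cancels in [L]. *)
have key u : \sum_(b < w) ((symn N g a)`_b)%:~R * F b (mobius g u) - eps g * F a u =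
    \sum_(b < w) ((symn N g a)`_b)%:~R * F b (mobius g None) - eps g * F a None.
  elim/farey_ind: u => // h Hh <-; set A0 := \sum_(b < w) _; set A1 := \sum_(b < w) _.
  have E : A0 - A1 = eps g * ext phi h a.
    rewrite -(ext_act sG' eps_char HR' phi Gg Hh (ltn_ord a)) -sumrB.
    by apply: eq_bigr => b _; rewrite -mulrBr (FE _ _ (SL2ZM Hg Hh)) !mobiusM.
  by move/eqP: E; rewrite subr_eq FE // => /eqP ->; ring.
have E : \sum_(b < w) ((symn N g a)`_b)%:~R * L (b, mobius2 g (x, y)) =
  \sum_(b < w) ((symn N g a)`_b)%:~R * F b (mobius g y) -
  \sum_(b < w) ((symn N g a)`_b)%:~R * F b (mobius g x).
  by rewrite -sumrB; apply: eq_bigr => b _; rewrite /L /= mulrBr.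
rewrite E /L /= mulrBr; move: (key x) (key y).
move=> /eqP; rewrite subr_eq => /eqP -> /eqP; rewrite subr_eq => /eqP ->; ring.
Qed.

(** Manin's trick: [{oo, g oo}] is [{oo, g 0}] plus the generator [{g 0, g oo}], so Farey descent
    reduces [{oo, u}]; a general symbol is the difference of two of these. *)
Lemma symbols_reducible x : integral z x ->
  reducible mobius2 z G G' eps (@three_term N.+2) (Some 0, None) R' x.
Proof.
move: x; apply: reducible_all => a [x y].
set red := reducible _ _ _ _ _ _ _ _.
have redB u v : red u -> red v -> red (u - v).
  move=> Hu Hv; apply: reducibleD => //; rewrite -scaleN1r; apply: reducibleZ => //.
  exact: (in_Qz_int z (-1)).
have key u : red << (a, (None, u)) >>.
  elim/farey_ind: u => [|g Hg IH]; first exact/reducible_relsQ/symbol_refl.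
  have E := relsQB (three_termQ a None (mobius g (Some 0)) (mobius g None))
                   (symbol_sym a (mobius g None) None).
  rewrite opprD addrA addrK in E.
  have Hgen : red << (a, (mobius g (Some 0), mobius g None)) >>.
    by have := reducible_gen (@three_term N.+2) sG' eps_char mobius2M' HR' Hg (ltn_ord a);
       rewrite /gen inord_val.
  have := redB _ _ (reducibleD IH Hgen) (reducible_relsQ _ _ E).
  by rewrite subKr.
have E := relsQB (three_termQ a None x y) (symbol_sym a y None).
rewrite opprD addrA addrK in E.
have := redB _ _ (reducible_relsQ _ _ E) (redB _ _ (key x) (key y)).
by rewrite opprB addrA subrK addrAC subrr add0r.
Qed.

Lemma cusps_reducible x : integral z x ->
  reducible mobius z G G' eps (fun _ : Bsymb N.+2 => False) None R' x.
Proof.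
move: x; apply: reducible_all => a y; have [g Hg ->] := mobius_inf_surj y.
by have := reducible_gen (fun _ : Bsymb N.+2 => False) sG' eps_char mobiusM' HR' Hg (ltn_ord a);
   rewrite /gen inord_val.
Qed.

Let mobius_T g : SL2Z g -> mobius (g *m Tmx) None = mobius g None.
Proof. by move=> Hg; rewrite mobiusM // (mobius_inf Tmx) !mxE. Qed.

Let mobius_N g : SL2Z g -> mobius (g *m Nmx) None = mobius g None.
Proof. by move=> Hg; rewrite mobiusM // (mobius_inf Nmx) !mxE. Qed.

Lemma cusp_relsP i : (i < m + m)%N ->
  BrelsQ (\sum_(j < m) cusp_rels m r1 rT rN i j *: Bgenl j).
Proof.
move=> im; rewrite /cusp_rels; case: ltnP => [{}im|mi].
  rewrite sumB; have E := relsQB (Brow SL2Z_T HT im) (Brow SL2Z_1 H1 im).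
  rewrite subBB in E.
  apply: relsQ_congr E _; rewrite -scalerBr mulmx1 /gen mobius_T ?subrr ?scaler0; last exact/Hrep/divw.
  exact: relsQ0.
have {}im : (i - m < m)%N by lia.
rewrite sumB; have E := relsQB (Brow SL2Z_N HN im) (Brow SL2Z_1 H1 im).
rewrite subBB in E.
apply: relsQ_congr E _; rewrite -scalerBr mulmx1 /gen mobius_N ?subrr ?scaler0; last exact/Hrep/divw.
exact: relsQ0.
Qed.

(** The relations make the equivariant extension invariant under right multiplication by [T] and -1,
    hence dependent on the cusp [g oo] alone. *)
Lemma cusp_rels_ext (phi : nat -> algC) :
  (forall i, (i < m + m)%N ->
     \sum_(j < m) cusp_rels m r1 rT rN i j * phi j = 0) ->
  exists L : 'I_w * P1Q -> algC^o,
    (forall x, BrelsQ x -> fglift L x = 0) /\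
    (forall l, (l < m)%N -> fglift L (Bgenl l) = phi l).
Proof.
move=> Hphi.
have eT g a : SL2Z g -> (a < w)%N -> ext phi (g *m Tmx) a = ext phi g a.
  move=> Hg aw; apply/eqP; rewrite -subr_eq0; apply/eqP.
  have := @ext_rel phi _ _ _ 1 (-1) 0 _ _ _ SL2Z_T SL2Z_1 SL2Z_1 HT H1 H1 _ g a Hg aw.
  rewrite mul1r mulN1r mul0r addr0 mulmx1; apply=> l lm.
  rewrite -[RHS](Hphi l (ltn_addl _ lm)) /cusp_rels lm.
  by apply: eq_bigr => j _; rewrite mul1r mulN1r mul0r addr0.
have eN g a : SL2Z g -> (a < w)%N -> ext phi (g *m Nmx) a = ext phi g a.
  move=> Hg aw; apply/eqP; rewrite -subr_eq0; apply/eqP.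
  have := @ext_rel phi _ _ _ 1 (-1) 0 _ _ _ SL2Z_N SL2Z_1 SL2Z_1 HN H1 H1 _ g a Hg aw.
  rewrite mul1r mulN1r mul0r addr0 mulmx1; apply=> l lm.
  have lm' : (m + l < m + m)%N by rewrite ltn_add2l.
  rewrite -[RHS](Hphi _ lm') /cusp_rels ltnNge leq_addr /= addKn.
  by apply: eq_bigr => j _; rewrite mul1r mulN1r mul0r addr0.
have HTn (t : int) : SL2Z (mx2 1 t 0 1) by apply/SL2ZE; rewrite !mxE /=; ring.
have eTn (t : nat) g a : SL2Z g -> (a < w)%N -> ext phi (g *m mx2 1 t%:Z 0 1) a = ext phi g a.
  move=> Hg aw; elim: t => [|t IHt].
    by congr (ext _ _ _); apply: mx2P; rewrite !mulmx2E !mxE /=; ring.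
  rewrite -IHt -(eT _ _ (SL2ZM Hg (HTn t)) aw) -mulmxA; congr (ext _ (_ *m _) _).
  by apply: mx2P; rewrite !mulmx2E !mxE /=; lia.
have eTz (t : int) g a : SL2Z g -> (a < w)%N -> ext phi (g *m mx2 1 t 0 1) a = ext phi g a.
  move=> Hg aw; case: t => t; first exact: eTn.
  rewrite -(eTn t.+1 _ _ (SL2ZM Hg (HTn (Negz t))) aw) -mulmxA -[g in RHS]mulmx1.
  by congr (ext _ (_ *m _) _); apply: mx2P; rewrite !mulmx2E !mxE /=; lia.
have ext_inf g h a : SL2Z g -> SL2Z h -> (a < w)%N -> mobius g None = mobius h None ->
    ext phi g a = ext phi h a.
  move=> Hg Hh aw Egh; pose u := invmx g *m h.
  have Hu : SL2Z u by apply: SL2ZM => //; exact: SL2ZV.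
  have Ug := SL2Z_unit Hg.
  have u10 : u 1 0 = 0.
    have : mobius u None = None.
      rewrite (mobiusM _ (SL2ZV Hg) Hh) -Egh -(mobiusM _ (SL2ZV Hg) Hg) mulVmx // mobius_inf !mxE //.
    by rewrite mobius_inf /pt; case: eqP.
  have -> : h = g *m u by rewrite mulmxA mulmxV // mul1mx.
  clearbody u; move/SL2ZE: (Hu); rewrite u10 mulr0 subr0 => E.
  (* [u] fixes infinity, so it is upper triangular of determinant 1: a power of [T], up to the sign
     matrix [Nmx]. *)
  have [[E1 E2]|[E1 E2]] : u 0 0 = 1 /\ u 1 1 = 1 \/ u 0 0 = -1 /\ u 1 1 = -1.
    have : (`|u 0%R 0%R| * `|u 1%R 1%R|)%N == 1%N by rewrite -abszM E.
    rewrite muln_eq1 => /andP[/eqP Ea /eqP Eb].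
    by move: (u 0 0) (u 1 1) E Ea Eb => x y; lia.
    have -> : u = mx2 1 (u 0 1) 0 1 by apply: mx2P; rewrite [RHS]mxE.
    by rewrite eTz.
  have -> : u = Nmx *m mx2 1 (- u 0 1) 0 1.
    by apply: mx2P; rewrite mulmx2E !mxE /= ?E1 ?E2 ?u10; lia.
  by rewrite mulmxA (eTz _ _ _ (SL2ZM Hg SL2Z_N) aw) eN.
have surj y : exists g, SL2Z g /\ y = mobius g None.
  by have [g Hg ->] := mobius_inf_surj y; exists g.
pose rep y := proj1_sig (constructive_indefinite_description _ (surj y)).
have repP y : SL2Z (rep y) /\ y = mobius (rep y) None.
  by rewrite /rep; case: constructive_indefinite_description.
pose L (it : 'I_w * P1Q) : algC^o := ext phi (rep it.2) it.1.
have LE g (a : 'I_w) : SL2Z g -> L (a, mobius g None) = ext phi g a.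
  by move=> Hg; have [Hr Er] := repP (mobius g None); apply: ext_inf.
exists L; split; last first.
  move=> l lm; rewrite /Bgenl /genl /gen fglift1 LE ?inordK //; last exact/Hrep/divw.
  exact: (ext_rep sG' eps_char HR' phi lm G1).
apply: (linear_kills GG' eps_char) => // g a y Gg; have Hg := G'_SL2Z sG' Gg.
have [h Hh ->] := mobius_inf_surj y; rewrite LE //.
rewrite -(ext_act sG' eps_char HR' phi Gg Hh (ltn_ord a)).
by apply: eq_bigr => b _; rewrite -mobiusM // LE //; exact: SL2ZM.
Qed.

Lemma boundary_genl l : (l < m)%N ->
  BrelsQ (d%:~R *: boundary (Mgenl l) -
          \sum_(j < m) boundary_mx r1 rS l j *: Bgenl j).
Proof.
move=> lm; rewrite /boundary_mx sumB.
have E := relsQB (Brow SL2Z_S HS lm) (Brow SL2Z_1 H1 lm).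
rewrite subBB -scalerBr mulmx1 in E.
move: E; congr (BrelsQ (_ *: _ - _)).
by rewrite /boundary /Mgenl /genl /gen fglift1 /= mobius_S //; exact/Hrep/divw.
Qed.

Lemma boundary_act g x :
  boundary (symb_act mobius2 g x) = symb_act mobius g (boundary x) :> Bsymb N.+2.
Proof.
have Ex : boundary x = \sum_(it <- dom x) coeff it x *: boundary << it >> :> Bsymb N.+2.
  rewrite {1}[x]freeg_lin_sum /boundary fglift_sum.
  by apply: eq_bigr => it _; rewrite fgliftZ.
rewrite symb_act_lin Ex {1}/boundary [RHS]/symb_act !fglift_sum.
apply: eq_bigr => [[a [u v]] _]; rewrite !fgliftZ; congr (_ *: _).
rewrite -/(symb_act mobius g _) /boundary fglift1 symb_actE fglift_sum.
rewrite {1}/symb_act fgliftB -!/(symb_act mobius g _) !symb_actE -sumrB.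
by apply: eq_bigr => b _; rewrite fgliftZ fglift1 scalerBr.
Qed.

Lemma boundary_integral x : integral z x -> integral z (boundary x : Bsymb N.+2).
Proof.
move=> Ix; rewrite [x]freeg_lin_sum /boundary fglift_sum; apply: integral_sum => it.
rewrite fgliftZ fglift1; apply: integralZ => //.
move=> jt; rewrite -scaleN1r coeffD coeffZ; apply: in_ZzD; first exact: integral_gen.
by apply: in_ZzM; [exact: (in_Zz_int z (-1)) | exact: integral_gen].
Qed.

Lemma boundary_rels x : Mrels z G G' eps x -> Brels z G G' eps (boundary x : Bsymb N.+2).
Proof.
elim=> [{}x [i a b c]|g {}x Gg Ix|g {}x Gg Ix||{}x y _ IHx _ IHy|c {}x Hc _ IHx|n {}x n0 Ix _ IHx].
- rewrite /boundary !fgliftD !fglift1 /=.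
  rewrite !addrA !subrK subrr; exact: rels_0.
- rewrite /boundary fgliftB -!/(boundary _) boundary_act; apply: rels_coinv => //.
  exact: boundary_integral.
- rewrite /boundary fgliftB fgliftZ -!/(boundary _) boundary_act; apply: rels_eps => //.
  exact: boundary_integral.
- by rewrite /boundary raddf0; exact: rels_0.
- by rewrite /boundary fgliftD; exact: rels_add.
- by rewrite /boundary fgliftZ; exact: rels_scale.
- apply: (rels_torsion n0); first exact: boundary_integral.
  by rewrite /boundary -raddfMn.
Qed.

Lemma boundary_relsQ x : MrelsQ x -> BrelsQ (boundary x).
Proof.
move=> [n n0 Hx]; exists n => //; have := boundary_rels Hx.
by rewrite /boundary raddfMn.
Qed.

End ModularSymbolsModel.

(** * Certificates for bases of subquotients *)

(** Programs handle entries as functions of two naturals; this cuts out the finite block on which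
    matrix algebra is done. *)
Definition fmx (R : Type) (m n : nat) (f : nat -> nat -> R) : 'M[R]_(m, n) :=
  \matrix_(i, j) f i j.

(* [V] is a basis of the kernel of the map induced by [bd] between the cokernels
   of [rel] and [relB]: [Phi] gives the coordinates with respect to [V], and [X]
   is a family of functionals on the cokernel of [relB]. *)
Definition certificate (R : nzRingType) m p pb s (rel : 'M[R]_(p, m))
    (relB : 'M[R]_(pb, m)) (bd : 'M[R]_m) (V : 'M[R]_(s, m)) (Y : 'M[R]_(s, pb))
    (Phi : 'M[R]_(m, s)) (P : 'M[R]_(m, p)) (X : 'M[R]_m) (e : R) : Prop :=
  [/\ V *m bd = Y *m relB, rel *m Phi = 0, V *m Phi = e%:M, relB *m X = 0
    & e%:M = Phi *m V + P *m rel + bd *m X].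

Lemma certificate_exists (F : fieldType) m p pb (rel : 'M[F]_(p, m))
    (relB : 'M[F]_(pb, m)) (bd : 'M[F]_m) :
  rel *m bd *m cokermx relB = 0 ->
  exists s V Y Phi P X, @certificate F m p pb s rel relB bd V Y Phi P X 1.
Proof.
(* [W] is the kernel of the induced boundary map, [D] a complement of the relations inside it, [C] a
   complement of [W]. The identity then splits into a part in [D], giving [V] and [Phi], a part in
   the span of [rel], giving [P], and the projection to [C], giving [X]. *)
move=> Hrel; pose Q := bd *m cokermx relB; pose W := kermx Q.
have relW : (rel <= W)%MS by apply/sub_kermxP; rewrite /Q mulmxA.
pose U := <<rel>>%MS; pose D := (W :\: U)%MS; pose C := (W^C)%MS.
have UW : (U <= W)%MS by rewrite genmxE.
have DU0 : (D :&: U = 0)%MS by exact: capmx_diff.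
have UD0 : (U :&: D = 0)%MS by rewrite capmxC.
have WDU : (W <= D + U)%MS.
  by rewrite -(addsmx_diff_cap_eq W U) addsmxS // capmxSr.
have WC0 : (W :&: C = 0)%MS by exact: capmx_compl.
have CW0 : (C :&: W = 0)%MS by rewrite capmxC.
have WC1 : (1%:M <= W + C)%MS by rewrite sub1mx addsmx_compl_full.
pose pW := proj_mx W C; pose pC := proj_mx C W.
have E1 : pW + pC = 1%:M.
  by have := add_proj_mx WC0 WC1; rewrite !mul1mx.
have pWW : (pW <= W)%MS by rewrite -[pW]mul1mx; exact: proj_mx_sub.
pose A := pW *m proj_mx D U; pose V := row_base D.
have AD : (A <= V)%MS by rewrite eq_row_base; exact: proj_mx_sub.
have VD : (V <= D)%MS by rewrite eq_row_base.
have DW : (D <= W)%MS by exact: diffmxSl.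
have VW := submx_trans VD DW.
have VA : V *m A = V by rewrite mulmxA !proj_mx_id.
have relA : rel *m A = 0.
  by rewrite mulmxA [rel *m _]proj_mx_id // proj_mx_0 // genmxE.
have EA : A *m pinvmx V *m V = A by exact: mulmxKpV.
pose B := pW *m proj_mx U D.
have BU : (B <= rel)%MS by rewrite -(genmxE rel); exact: proj_mx_sub.
have AB : A + B = pW by apply: add_proj_mx => //; exact: submx_trans pWW WDU.
have EB : B *m pinvmx rel *m rel = B by exact: mulmxKpV.
(* The rows of [1 - Q Q^+] lie in the kernel [W] of [Q], which the projection to [C] annihilates; so
   that projection factors through [Q]. *)
have EC : Q *m pinvmx Q *m pC = pC.
  have : ((1%:M - Q *m pinvmx Q) <= W)%MS.
    by apply/sub_kermxP; rewrite mulmxBl mul1mx mulmxKpV // subrr.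
  move=> /(proj_mx_0 CW0); rewrite mulmxBl mul1mx => /eqP.
  by rewrite subr_eq0 => /eqP.
exists _, V, (V *m bd *m pinvmx relB), (A *m pinvmx V), (B *m pinvmx rel),
  (cokermx relB *m pinvmx Q *m pC); split.
- rewrite mulmxKpV // submxE -mulmxA; exact/eqP/sub_kermxP.
- by rewrite mulmxA relA mul0mx.
- by rewrite mulmxA VA mulmxVp // row_base_free.
- by rewrite mulmxA [relB *m _]mulmxA mulmx_coker !mul0mx.
- by rewrite EA EB AB mulmxA [bd *m _]mulmxA EC E1.
Qed.

Lemma certificate_map (R S : nzRingType) (f : {rmorphism R -> S}) m p pb s
    rel relB bd V Y Phi P X e :
  @certificate R m p pb s rel relB bd V Y Phi P X e ->
  certificate (map_mx f rel) (map_mx f relB) (map_mx f bd) (map_mx f V)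
    (map_mx f Y) (map_mx f Phi) (map_mx f P) (map_mx f X) (f e).
Proof.
case=> E1 E2 E3 E4 E5; split; rewrite -?map_mxM ?E1 ?E2 ?E3 ?E4 ?map_mx0 ?map_scalar_mx //.
by rewrite -!map_mxD -E5 map_scalar_mx.
Qed.

(** [V] and [Phi] each absorb one factor [d], so their product forces the scalar [d * d], and [P]
    and [X] must absorb both factors. *)
Lemma certificate_scale (R : comNzRingType) m p pb s rel relB bd V Y Phi P X (d : R) :
  @certificate R m p pb s rel relB bd V Y Phi P X 1 ->
  certificate rel relB bd (d *: V) (d *: Y) (d *: Phi) ((d * d) *: P)
    ((d * d) *: X) (d * d).
Proof.
case=> E1 E2 E3 E4 E5; split.
- by rewrite -!scalemxAl E1.
- by rewrite -scalemxAr E2 scaler0.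
- by rewrite -scalemxAl -scalemxAr E3 scalerA scale_scalar_mx mulr1.
- by rewrite -scalemxAr E4 scaler0.
- by rewrite -!scalemxAl -!scalemxAr scalerA -!scalerDr -E5 scale_scalar_mx mulr1.
Qed.

(** * Certificates with entries in Z[z] *)

Section IntegralCertificate.
Variable z : algC.

(** Allowing every multiple of [m] lets one factor clear several matrices at once. *)
Lemma clear_mx a b (A : 'M[algC]_(a, b)) : (forall i j, in_Qz z (A i j)) ->
  exists2 m : nat, (0 < m)%N & forall m', (m %| m')%N ->
    exists F : nat -> nat -> {poly int},
      fmx a b (fun i j => evalZ z (F i j)) = m'%:R *: A.
Proof.
move=> HA; pose c l := if insub l is Some ij then A (enum_val (ij : 'I_#|{: 'I_a * 'I_b}|)).1 (enum_val ij).2 else 0.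
have [|m m0 Hm] := @in_Qz_clear_family z #|{: 'I_a * 'I_b}| c.
  by move=> l; rewrite /c; case: insub => [ij|]; [exact: HA | exact: (in_Qz_int z 0)].
exists m => // m' dv; have HF i j : exists p, forall (ia : (i < a)%N) (jb : (j < b)%N),
    evalZ z p = m'%:R * A (Ordinal ia) (Ordinal jb).
  have /orP[ia|ia] := orbN (i < a)%N; last by exists 0 => ia'; case/negP: ia.
  have /orP[jb|jb] := orbN (j < b)%N; last by exists 0 => ia' jb'; case/negP: jb.
  have := Hm (enum_rank (Ordinal ia, Ordinal jb)) (ltn_ord _).
  rewrite /c valK enum_rankK /= => -[p Ep].
  exists (p * (m' %/ m)%:Z%:P) => ia' jb'; rewrite evalZM evalZC -Ep.
  rewrite (bool_irrelevance ia' ia) (bool_irrelevance jb' jb).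
  rewrite -{2}(divnK dv) natrM -pmulrn -mulr_natr; ring.
pose F i j := proj1_sig (constructive_indefinite_description _ (HF i j)).
exists F; apply/matrixP => i j; rewrite !mxE /F; case: constructive_indefinite_description => p /= Hp.
by rewrite (Hp (ltn_ord i) (ltn_ord j)); congr (_ * A _ _); apply/val_inj.
Qed.

Lemma integral_certificate_exists m p pb (rel relB bd : nat -> nat -> {poly int}) :
  let ev F := fun i j : nat => evalZ z (F i j) in
  (forall psi : 'cV[algC]_m, fmx pb m (ev relB) *m psi = 0 ->
     fmx p m (ev rel) *m fmx m m (ev bd) *m psi = 0) ->
  exists (s : nat) (e : int) (V Y Phi P X : nat -> nat -> {poly int}), e != 0 /\
    certificate (fmx p m (ev rel)) (fmx pb m (ev relB)) (fmx m m (ev bd))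
      (fmx s m (ev V)) (fmx s pb (ev Y)) (fmx m s (ev Phi)) (fmx m p (ev P))
      (fmx m m (ev X)) e%:~R.
Proof.
move=> ev Hcond.
(* Q(z) is realized as a number field [K] embedded in [algC], so that elimination over [K] keeps all
   entries in Q(z). *)
have [K [iota [[|zK [|? ?]] // [Ez] Efull]]] := num_field_exists [:: z].
pose evK (F : nat -> nat -> {poly int}) i j := (map_poly intr (F i j)).[zK] : K.
have Eev a b F : map_mx iota (fmx a b (evK F)) = fmx a b (ev F).
  apply/matrixP => i j; rewrite !mxE /ev /evK /evalZ -horner_map Ez -map_poly_comp.
  by congr horner; apply: eq_map_poly => x /=; rewrite rmorph_int.
have HK (x : K) : in_Qz z (iota x).
  have : x \in <<1; zK>>%VS by rewrite -[<<1; zK>>%VS]adjoin_seq1 Efull memvf.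
  move=> /Fadjoin_polyP[q /polyOver1P[r ->] ->]; exists r.
  rewrite /evalQ -horner_map Ez -map_poly_comp; congr horner.
  by apply: eq_map_poly => y /=; rewrite rmorphZ_num rmorph1 mulr1.
have HrelK : fmx p m (evK rel) *m fmx m m (evK bd) *m cokermx (fmx pb m (evK relB)) = 0.
  set Q := cokermx _; apply/matrixP => i j.
  (* Each column of the cokernel matrix is a functional killed by [relB], to which the hypothesis
     applies. *)
  have HQ : fmx pb m (ev relB) *m map_mx iota (col j Q) = 0.
    rewrite -Eev -map_mxM colE mulmxA mulmx_coker mul0mx.
    by apply/matrixP => a b; rewrite !mxE rmorph0.
  apply: (fmorph_inj iota); rewrite [in RHS]mxE rmorph0.
  have /matrixP/(_ i 0) := Hcond _ HQ; rewrite -!Eev -!map_mxM [RHS]mxE => E.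
  by move: E; rewrite colE mulmxA -colE [LHS]mxE [X in iota X]mxE.
have [s [V [Y [Phi [P [X /(certificate_map iota)]]]]]] := certificate_exists HrelK.
rewrite !Eev rmorph1 => HC.
have HQ a b (A : 'M[K]_(a, b)) i j : in_Qz z (map_mx iota A i j) by rewrite mxE.
have [mV mV0 HV] := clear_mx (HQ _ _ V); have [mY mY0 HY] := clear_mx (HQ _ _ Y).
have [mF mF0 HF] := clear_mx (HQ _ _ Phi); have [mP mP0 HP] := clear_mx (HQ _ _ P).
have [mX mX0 HX] := clear_mx (HQ _ _ X).
pose d := (mV * mY * mF * mP * mX)%N.
have d0 : (0 < d)%N by rewrite !muln_gt0 mV0 mY0 mF0 mP0.
have [V' EV] := HV d ltac:(by rewrite /d -!mulnA dvdn_mulr).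
have [Y' EY] := HY d ltac:(by rewrite /d -!mulnA dvdn_mull // dvdn_mulr).
have [F' EF] := HF d ltac:(by rewrite /d -!mulnA; apply/dvdn_mull/dvdn_mull/dvdn_mulr).
have [P' EP] := HP (d * d)%N ltac:(by apply: dvdn_mulr; rewrite /d -!mulnA; apply/dvdn_mull/dvdn_mull/dvdn_mull/dvdn_mulr).
have [X' EX] := HX (d * d)%N ltac:(by rewrite dvdn_mulr // /d dvdn_mull).
exists s, (d * d)%:Z, V', Y', F', P', X'; split; first by rewrite -lt0n muln_gt0 d0.
rewrite EV EY EF EP EX -pmulrn natrM; exact: certificate_scale.
Qed.

End IntegralCertificate.

(** * Bases from matrix identities *)

Section BasisCriterion.
Variables (T : choiceType) (act : 'M[int]_2 -> T -> T) (N : nat).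
Variables (z : algC) (G G' : 'M[int]_2 -> Prop) (eps : 'M[int]_2 -> algC).
Variable rel0 : symb T N.+2 -> Prop.
Local Notation relsQ := (relsQ act z G G' eps rel0).
Variables (m p : nat) (gen : nat -> symb T N.+2) (rel : nat -> nat -> algC).
Hypothesis Hrel : forall i, (i < p)%N -> relsQ (\sum_(j < m) rel i j *: gen j).
Hypothesis Hext : forall phi : nat -> algC,
  (forall i, (i < p)%N -> \sum_(j < m) rel i j * phi j = 0) ->
  exists L : 'I_N.+1 * T -> algC^o, (forall x, relsQ x -> fglift L x = 0) /\
    (forall l, (l < m)%N -> fglift L (gen l) = phi l).
Variables (s : nat) (V Phi P : nat -> nat -> algC) (e : int).
Hypothesis HPhi : forall i j, in_Qz z (Phi i j).
Hypothesis HP : forall i j, in_Qz z (P i j).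
Hypothesis e0 : e != 0.
Hypothesis relPhi : fmx p m rel *m fmx m s Phi = 0.
Hypothesis VPhi : fmx s m V *m fmx m s Phi = (e%:~R)%:M.
Variable S : symb T N.+2 -> Prop.
Hypothesis S_int : forall x, S x -> integral z x.
Hypothesis VS : forall i, (i < s)%N -> S (\sum_(l < m) V i l *: gen l).
Hypothesis Sred : forall x, S x -> exists a : nat -> algC,
  [/\ forall l, in_Qz z (a l), relsQ (x - \sum_(l < m) a l *: gen l)
    & e%:~R *: fmx 1 m (fun _ => a) =
      fmx 1 m (fun _ => a) *m fmx m s Phi *m fmx s m V +
      fmx 1 m (fun _ => a) *m fmx m p P *m fmx p m rel].

(** The columns of [Phi] extend to functionals on the quotient that are dual to [B] up to the factor
    [e], which gives independence. For generation, [e a = a Phi V + a P rel] expresses [x] through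
    [B] modulo the relations. *)
Lemma basis_criterion (B : seq (symb T N.+2)) : size B = s ->
  (forall i, (i < s)%N -> B`_i = \sum_(l < m) V i l *: gen l) ->
  basis_mod z S (rels act z G G' eps rel0) B.
Proof.
move=> sB EB; split.
- by move=> b /(nthP 0)[i]; rewrite sB => si <-; rewrite EB //; exact: VS.
- move=> c Hc; rewrite sB => HN i si.
  have [|L [L0 Lphi]] := Hext (phi := fun l => Phi l i).
    move=> l lp; have /matrixP/(_ (Ordinal lp) (Ordinal si)) := relPhi.
    by rewrite !mxE => E; rewrite -[RHS]E; apply: eq_bigr => j _; rewrite !mxE.
  have := L0 _ (relsQ_rels HN); rewrite fglift_sum (bigD1 (Ordinal si)) //= => E.
  have EL k : (k < s)%N -> fglift L (c k *: B`_k) = c k * (e%:~R *+ (k == i)).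
    move=> sk; rewrite fgliftZ EB // fglift_sum; congr (_ * _).
    have /matrixP/(_ (Ordinal sk) (Ordinal si)) := VPhi; rewrite !mxE => <-.
    by apply: eq_bigr => l _; rewrite fgliftZ Lphi // !mxE.
  move: E; rewrite EL // eqxx big1 ?addr0 => [/eqP|k]; last first.
    by rewrite -val_eqE /= => /negbTE ki; rewrite EL // ki mulr0n mulr0.
  by rewrite mulf_eq0 intr_eq0 (negbTE e0) orbF => /eqP.
- move=> x Sx; have [a [Ha Hx Ea]] := Sred Sx.
  have e0' : e%:~R != 0 :> algC by rewrite intr_eq0.
  (* The coordinates of [x] are the entries of [a Phi], divided by [e]; the combination [a P] of
     relations accounts for the rest. *)
  pose c i := e%:~R^-1 * \sum_(l < m) a l * Phi l i.
  have Hc i : in_Qz z (c i).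
    apply: in_QzM; last by apply: in_Qz_sum => l; exact: in_QzM.
    rewrite -[e%:~R]ratr_int -fmorphV; exact: in_Qz_rat.
  have Hxc : relsQ (x - \sum_(i < s) c i *: B`_i).
    rewrite -[x](subrK (\sum_(l < m) a l *: gen l)) -addrA; apply: relsQD => //.
    apply: (relsQZV e0).
    pose b k := \sum_(l < m) a l * P l k.
    have -> : e%:~R *: (\sum_(l < m) a l *: gen l - \sum_(i < s) c i *: B`_i) =
        \sum_(k < p) b k *: \sum_(j < m) rel k j *: gen j; last first.
      rewrite big_seq_cond; elim/big_ind: _ => [||k _]; [exact: relsQ0 | exact: relsQD |].
      apply: relsQZ; last exact: Hrel.
      by apply: in_Qz_sum => l; exact: in_QzM.
    have El (l : 'I_m) : e%:~R * a l =
        \sum_(i < s) (e%:~R * c i) * V i l + \sum_(k < p) b k * rel k l.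
      have /matrixP/(_ 0 l) := Ea; rewrite !mxE => ->; congr (_ + _); apply: eq_bigr => i _.
        by rewrite !mxE /c mulVKf //; congr (_ * _); apply: eq_bigr => k _; rewrite !mxE.
      by rewrite !mxE; congr (_ * _); apply: eq_bigr => k _; rewrite !mxE.
    rewrite scalerBr !scaler_sumr.
    under eq_bigr => l _ do rewrite scalerA El scalerDl !scaler_suml.
    rewrite big_split /= exchange_big /= [X in _ + X - _]exchange_big /=.
    rewrite [X in X + _ - _](_ : _ = \sum_(i < s) e%:~R *: (c i *: B`_i)).
      rewrite addrAC subrr add0r; apply: eq_bigr => k _; rewrite scaler_sumr.
      by apply: eq_bigr => j _; rewrite scalerA.
    apply: eq_bigr => i _; rewrite scalerA EB // scaler_sumr.
    by apply: eq_bigr => l _; rewrite scalerA.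
  have [n n0 Hn] := in_Qz_clear_family s Hc.
  (* Denominators were cleared for the first [s] coefficients only, while [basis_mod] asks for
     integrality at every index; hence the value 0 beyond. *)
  exists n, (fun i => if (i < s)%N then c i *+ n else 0); split=> //.
    by move=> i; case: ifP => [/Hn //|_]; exact: (in_Zz_int z 0).
  rewrite sB; have -> : x *+ n - \sum_(i < s) (if (i < s)%N then c i *+ n else 0) *: B`_i =
      (x - \sum_(i < s) c i *: B`_i) *+ n.
    rewrite mulrnBl -sumrMnl; congr (_ - _); apply: eq_bigr => i _.
    by rewrite ltn_ord scalerMnl.
  apply: rels_relsQ.
    have -> : (x - \sum_(i < s) c i *: B`_i) *+ n = n%:R *: x + (-1) *: \sum_(i < s) (c i *+ n) *: B`_i.
      rewrite mulrnBl -sumrMnl scaler_nat scaleN1r; congr (_ - _); apply: eq_bigr => i _.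
      by rewrite scalerMnl.
    move=> it; rewrite coeffD; apply: in_ZzD.
      by rewrite coeffZ; apply: in_ZzM (in_Zz_int z n%:Z) _; exact: S_int.
    rewrite coeffZ; apply: in_ZzM; first exact: (in_Zz_int z (-1)).
    rewrite raddf_sum; elim/big_ind: _ => [||i _]; [exact: (in_Zz_int z 0) | exact: in_ZzD |].
    rewrite /= coeffZ; apply: in_ZzM; first exact: Hn.
    by apply: S_int; rewrite EB //; exact: VS.
  case: Hxc => k k0 Hk; exists k => //; rewrite -mulrnA mulnC mulrnA.
  exact: rels_muln.
Qed.

End BasisCriterion.

Definition evmx (z : algC) (F : nat -> nat -> {poly int}) (i j : nat) : algC :=
  evalZ z (F i j).

Section CertifiedBasis.
Variable N : nat.
Variables (z : algC) (G G' : 'M[int]_2 -> Prop) (eps : 'M[int]_2 -> algC).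
Hypotheses (sG' : subgroup_SL2Z G') (GG' : forall g, G g -> G' g).
Hypothesis eps_char : character_mod z G G' eps.
Variable R' : seq 'M[int]_2.
Hypothesis HR' : coset_reps G' SL2Z R'.

Local Notation w := N.+1.
Local Notation r' := (size R').
Local Notation m := (r' * w)%N.

Variables (d : int) (r1 rS rU rU2 rT rN : nat -> nat -> {poly int}).
Hypothesis d0 : d != 0.
Let row_of h (rho : nat -> nat -> {poly int}) := forall l, (l < m)%N ->
  coord_row N G' eps R' d (nth 0 R' (l %/ w) *m h) (l %% w) (evmx z rho l).
Hypotheses (H1 : row_of 1%:M r1) (HS : row_of Smx rS) (HU : row_of Umx rU)
  (HU2 : row_of U2mx rU2) (HT : row_of Tmx rT) (HN : row_of Nmx rN).

Local Notation ev := (evmx z).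
Local Notation mrel := (manin_rels m r1 rS rU rU2).
Local Notation crel := (cusp_rels m r1 rT rN).
Local Notation bdm := (boundary_mx r1 rS).
Local Notation MrelsQ := (relsQ mobius2 z G G' eps (@three_term N.+2)).
Local Notation BrelsQ := (relsQ mobius z G G' eps (fun _ : Bsymb N.+2 => False)).
Local Notation Mgenl := (Mgenl N R').
Local Notation Bgenl := (Bgenl N R').

Let mrelE i j : ev mrel i j = manin_rels m (ev r1) (ev rS) (ev rU) (ev rU2) i j.
Proof. by rewrite /evmx /manin_rels; case: ifP => _; rewrite !evalZD. Qed.

Let crelE i j : ev crel i j = cusp_rels m (ev r1) (ev rT) (ev rN) i j.
Proof. by rewrite /evmx /cusp_rels; case: ifP => _; rewrite !evalZB. Qed.

Let bdE i j : ev bdm i j = boundary_mx (ev r1) (ev rS) i j.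
Proof. by rewrite /evmx /boundary_mx evalZB. Qed.

Let mrelP i : (i < m + m)%N -> MrelsQ (\sum_(j < m) ev mrel i j *: Mgenl j).
Proof.
move=> im; under eq_bigr => j _ do rewrite mrelE.
exact: (manin_relsP z G sG' HR' d0 H1 HS HU HU2 im).
Qed.

Let crelP i : (i < m + m)%N -> BrelsQ (\sum_(j < m) ev crel i j *: Bgenl j).
Proof.
move=> im; under eq_bigr => j _ do rewrite crelE.
exact: (cusp_relsP z G sG' HR' d0 H1 HT HN im).
Qed.

Let mext (phi : nat -> algC) :
  (forall i, (i < m + m)%N -> \sum_(j < m) ev mrel i j * phi j = 0) ->
  exists L : 'I_w * (P1Q * P1Q) -> algC^o,
    (forall x, MrelsQ x -> fglift L x = 0) /\
    (forall l, (l < m)%N -> fglift L (Mgenl l) = phi l).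
Proof.
move=> Hphi; apply: (manin_rels_ext sG' GG' eps_char HR' d0 H1 HS HU HU2) => i im.
by rewrite -[RHS](Hphi i im); apply: eq_bigr => j _; rewrite mrelE.
Qed.

Let cext (phi : nat -> algC) :
  (forall i, (i < m + m)%N -> \sum_(j < m) ev crel i j * phi j = 0) ->
  exists L : 'I_w * P1Q -> algC^o,
    (forall x, BrelsQ x -> fglift L x = 0) /\
    (forall l, (l < m)%N -> fglift L (Bgenl l) = phi l).
Proof.
move=> Hphi; apply: (cusp_rels_ext sG' GG' eps_char HR' d0 H1 HT HN) => i im.
by rewrite -[RHS](Hphi i im); apply: eq_bigr => j _; rewrite crelE.
Qed.

Let bdP l : (l < m)%N ->
  BrelsQ (d%:~R *: boundary (Mgenl l) - \sum_(j < m) ev bdm l j *: Bgenl j).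
Proof.
move=> lm; under eq_bigr => j _ do rewrite bdE.
exact: (boundary_genl z G sG' HR' H1 HS lm).
Qed.

(** A functional on the cusp side is pulled back along the boundary; the matrix represents [d] times
    the boundary, which does not affect vanishing. *)
Let bd_functional (phi : nat -> algC) :
  (forall i, (i < m + m)%N -> \sum_(j < m) ev crel i j * phi j = 0) ->
  exists L : 'I_w * P1Q -> algC^o,
    (forall x, BrelsQ x -> fglift L x = 0) /\
    (forall a : nat -> algC, BrelsQ (boundary (\sum_(l < m) a l *: Mgenl l)) ->
       \sum_(l < m) a l * \sum_(k < m) ev bdm l k * phi k = 0).
Proof.
move=> /cext[L [L0 Lphi]]; exists L; split=> // a /L0 E.
have d0' : d%:~R != 0 :> algC by rewrite intr_eq0.
transitivity (d%:~R * fglift L (boundary (\sum_(l < m) a l *: Mgenl l)));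
  last by rewrite E mulr0.
rewrite /boundary !fglift_sum mulr_sumr.
apply: eq_bigr => l _; rewrite !fgliftZ -/(boundary _).
have /L0 := bdP (ltn_ord l); rewrite fgliftB fgliftZ => /eqP.
rewrite subr_eq0 => /eqP El; rewrite mulrCA; congr (_ * _).
rewrite [RHS]El fglift_sum; apply: eq_bigr => k _.
by rewrite fgliftZ Lphi.
Qed.

(** This is the hypothesis under which a certificate exists: the boundary of a Manin relation
    vanishes in the cusp module, so every functional on that module kills it. *)
Lemma boundary_compatible (psi : 'cV[algC]_m) :
  fmx (m + m) m (ev crel) *m psi = 0 ->
  fmx (m + m) m (ev mrel) *m fmx m m (ev bdm) *m psi = 0.
Proof.
move=> Hpsi; pose phi l := if insub l is Some i then psi i 0 else 0.
have Ephi (i : 'I_m) : phi i = psi i 0 by rewrite /phi valK.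
have [|L [_ HL]] := bd_functional (phi := phi).
  move=> i im; have /matrixP/(_ (Ordinal im) 0) := Hpsi; rewrite !mxE => E.
  by rewrite -[RHS]E; apply: eq_bigr => j _; rewrite mxE Ephi.
rewrite -mulmxA; apply/matrixP => i j; rewrite ord1 [RHS]mxE mxE.
rewrite -[RHS](HL (ev mrel i)); last exact/boundary_relsQ/mrelP.
apply: eq_bigr => l _; rewrite !mxE; congr (_ * _).
by apply: eq_bigr => k _; rewrite mxE Ephi.
Qed.

Section Sound.
Variables (s : nat) (e : int) (V Y Phi P X : nat -> nat -> {poly int}).
Hypothesis e0 : e != 0.
Hypothesis HC : certificate (fmx (m + m) m (ev mrel)) (fmx (m + m) m (ev crel))
  (fmx m m (ev bdm)) (fmx s m (ev V)) (fmx s (m + m) (ev Y)) (fmx m s (ev Phi))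
  (fmx m (m + m) (ev P)) (fmx m m (ev X)) e%:~R.

Lemma certificate_basis_S (B : seq (Msymb N.+2)) : size B = s ->
  (forall i, (i < s)%N -> B`_i = \sum_(l < m) evalZ z (V i l) *: Mgenl l) ->
  basis_S z G G' eps B.
Proof.
case: HC => E1 E2 E3 E4 E5.
have inQ F i j : in_Qz z (ev F i j) by apply: in_Zz_Qz; exact: in_Zz_eval.
apply: (@basis_criterion _ mobius2 N z G G' eps (@three_term N.+2) m (m + m) Mgenl
  (ev mrel) mrelP mext s (ev V) (ev Phi) (ev P) e) => //.
- by move=> x [].
- move=> i si; have Ib : integral z (\sum_(l < m) ev V i l *: Mgenl l).
    apply: integral_sum => l; apply: integralZ; first exact: in_Zz_eval.
    exact: integral_gen.
  split=> //; apply: rels_relsQ; first exact: boundary_integral.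
  apply: (relsQZV d0).
  apply: (@relsQ_congr _ _ _ _ _ _ _ _ (\sum_(k < m) (\sum_(l < m) ev V i l * ev bdm l k) *: Bgenl k)).
    rewrite /boundary fglift_sum scaler_sumr.
    under eq_bigr => k _ do rewrite scaler_suml.
    rewrite exchange_big /= -sumrB; apply: relsQ_sum => l.
    rewrite fgliftZ -/(boundary _) scalerA mulrC -scalerA.
    under eq_bigr => k _ do rewrite -scalerA.
    rewrite -scaler_sumr -scalerBr; apply: relsQZ => //.
    by rewrite -opprB; apply: relsQN; exact: bdP.
  have E k : (k < m)%N -> \sum_(l < m) ev V i l * ev bdm l k =
      \sum_(l < m + m) ev Y i l * ev crel l k.
    move=> km; have /matrixP/(_ (Ordinal si) (Ordinal km)) := E1; rewrite !mxE => E.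
    by move: E; under eq_bigr => l _ do rewrite !mxE;
       under [RHS]eq_bigr => l _ do rewrite !mxE.
  under eq_bigr => k _ do rewrite E // scaler_suml.
  rewrite exchange_big /=; apply: big_ind => [||l _]; [exact: relsQ0 | exact: relsQD |].
  under eq_bigr => k _ do rewrite -scalerA.
  by rewrite -scaler_sumr; apply: relsQZ => //; exact: crelP.
- move=> x [Ix Bx]; have [a Ha Hx] := symbols_reducible sG' eps_char HR' Ix.
  exists a; split=> //.
  (* The columns of [X] are functionals on the cusp module, and the boundary of [x] is zero there;
     thus the term with [X] disappears from the last identity of the certificate. *)
  have HbX : fmx 1 m (fun _ => a) *m fmx m m (ev bdm) *m fmx m m (ev X) = 0.
    rewrite -mulmxA; apply/matrixP => i j; rewrite [RHS]mxE mxE.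
    have [|L [_ HL]] := bd_functional (phi := fun l => ev X l j).
      move=> k km; have /matrixP/(_ (Ordinal km) j) := E4; rewrite !mxE => E.
      by rewrite -[RHS]E; apply: eq_bigr => l _; rewrite !mxE.
    rewrite -[RHS](HL a).
      apply: eq_bigr => l _; rewrite !mxE; congr (_ * _).
      by apply: eq_bigr => k _; rewrite !mxE.
    have := relsQB (relsQ_rels Bx) (boundary_relsQ Hx).
    by rewrite /boundary fgliftB subKr.
  by rewrite -mulmxA -mul_mx_scalar E5 !mulmxDr !mulmxA HbX addr0.
Qed.

End Sound.

(** With zero boundary map and no relations in the target the kernel is the whole module, so the
    certificate yields a basis of it. *)
Lemma cusps_dim : exists c, has_dim z (@integral P1Q N.+2 z) (@Brels z G G' eps N.+2) c.
Proof.
have [|s [e [V [Y [Phi [P [X [e0 [E1 E2 E3 E4 E5]]]]]]]]] :=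
  @integral_certificate_exists z m (m + m) 0 crel (fun _ _ => 0) (fun _ _ => 0).
  move=> psi _; have -> : fmx m m (fun _ _ : nat => evalZ z 0) = 0.
    by apply/matrixP => i j; rewrite !mxE evalZ0.
  by rewrite mulmx0 mul0mx.
have inQ F i j : in_Qz z (ev F i j) by apply: in_Zz_Qz; exact: in_Zz_eval.
exists s; exists (mkseq (fun i => \sum_(l < m) evalZ z (V i l) *: Bgenl l) s);
  last by rewrite size_mkseq.
apply: (@basis_criterion _ mobius N z G G' eps (fun _ => False) m (m + m) Bgenl
  (ev crel) crelP cext s (ev V) (ev Phi) (ev P) e) => //.
- move=> i _; apply: integral_sum => l; apply: integralZ; first exact: in_Zz_eval.
  exact: integral_gen.
- move=> x Ix; have [a Ha Hx] := cusps_reducible sG' eps_char HR' Ix.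
  exists a; split=> //.
  have E0 : fmx m m (fun _ _ : nat => evalZ z 0) = 0.
    by apply/matrixP => i j; rewrite !mxE evalZ0.
  move: E5; rewrite E0 mul0mx addr0 => E5.
  by rewrite -mul_mx_scalar E5 mulmxDr !mulmxA.
- by rewrite size_mkseq.
- by move=> i si; rewrite nth_mkseq.
Qed.

End CertifiedBasis.

(** * Zero test in Z[z] *)

(* For p in Z[X] and z of order n, p(z) = 0 iff X^n - 1 divides the product of p
   and the polynomials X^d - 1 for 0 < d < n. *)
Definition cyclic_coef (n : nat) (Q : {poly int}) (t : nat) : int :=
  \sum_(0 <= i < size Q) (if (i %% n)%N == t then Q`_i else 0).

Definition zero_test (n : nat) (p : {poly int}) : bool :=
  all (fun t => cyclic_coef n
      (p * \prod_(0 <= d < n - 1) ('X^(d.+1) - 1%:P)) t == 0) (iota 0 n).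

Lemma comp_zero_test A `{Enc A} (n : A -> nat) (p : A -> {poly int}) :
  computable n -> computable p -> computable (fun x => zero_test (n x) (p x)).
Proof.
move=> cn cp; rewrite /zero_test /cyclic_coef.
have cQ : computable (fun x => p x * \prod_(0 <= d < n x - 1) ('X^(d.+1) - 1%:P)).
  by solve_comp.
by solve_comp.
Qed.

Section ZeroTest.
Variables (n : nat) (z : algC).
Hypothesis zn : n.-primitive_root z.

Let n0 : (0 < n)%N. Proof. exact: prim_order_gt0 zn. Qed.

(** At an n-th root of unity exponents matter modulo [n] only: this is evaluation of the remainder
    modulo X^n - 1. *)
Let fold_eval (Q : {poly int}) (y : algC) : y ^+ n = 1 ->
  (map_poly intr Q).[y] = \sum_(t < n) (cyclic_coef n Q t)%:~R * y ^+ t.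
Proof.
move=> yn; rewrite (horner_coef_wide _ (size_poly _ _ : (size (map_poly intr Q) <= size Q)%N)).
transitivity (\sum_(i < size Q) \sum_(t < n)
    (if (i %% n)%N == t then (Q`_i)%:~R * y ^+ t else 0)).
  apply: eq_bigr => i _; rewrite coef_map -big_mkcond /=.
  rewrite (big_pred1 (Ordinal (ltn_pmod i n0))) => [|t]; last first.
    by rewrite /= -val_eqE /= eq_sym.
  congr (_ * _); rewrite /= [in LHS](divn_eq i n) exprD mulnC exprM yn expr1n.
  by rewrite mul1r.
rewrite exchange_big /=; apply: eq_bigr => t _.
rewrite /cyclic_coef big_mkord rmorph_sum mulr_suml; apply: eq_bigr => i _ /=.
by case: ifP => _; rewrite ?mul0r.
Qed.

Let cyclo : {poly int} := \prod_(0 <= d < n - 1) ('X^(d.+1) - 1%:P).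

Let cyclo_eval (y : algC) : (map_poly intr cyclo).[y] = \prod_(0 <= d < n - 1) (y ^+ d.+1 - 1).
Proof.
rewrite /cyclo rmorph_prod horner_prod; apply: eq_bigr => d _.
by rewrite rmorphB /= map_polyXn map_polyC /= hornerD hornerN hornerXn hornerC.
Qed.

(** If p(z) = 0, then p vanishes at all primitive n-th roots of unity, the roots of the minimal
    polynomial of z, and the product vanishes at the other n-th roots; a remainder of degree below n
    with n roots is zero. Conversely, no factor z^d - 1 with 0 < d < n vanishes. *)
Lemma zero_testP p : zero_test n p = (evalZ z p == 0).
Proof.
have zn1 := prim_expr_order zn.
apply/allP/eqP => [H|pz t]; last first.
  rewrite mem_iota add0n => /= tn; rewrite -/cyclo.
  pose Q := p * cyclo; pose c i : algC := (cyclic_coef n Q i)%:~R.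
  have root_pow j : (map_poly intr Q).[z ^+ j] = 0.
    rewrite rmorphM hornerM cyclo_eval; have [co|nco] := boolP (coprime j n).
      suff -> : (map_poly intr p).[z ^+ j] = 0 by rewrite mul0r.
      have [p0 [Ep0 _] Hp0] := minCpolyP z.
      have Ep : map_poly intr p = map_poly ratr (map_poly intr p : {poly rat}) :> {poly algC}.
        by rewrite -map_poly_comp; apply: eq_map_poly => x /=; rewrite ratr_int.
      have : root (map_poly ratr (map_poly intr p : {poly rat}) : {poly algC}) z.
        by rewrite -Ep; apply/rootP.
      rewrite Hp0 => /dvdpP[q Eq].
      apply/rootP; rewrite Ep Eq rmorphM /= -Ep0 (minCpoly_cyclotomic zn) rootM.
      by rewrite (root_cyclotomic zn) prim_root_exp_coprime // co orbT.
    (* When [j] is not prime to [n], the order [n / gcd(j, n)] of [z ^+ j] is smaller than [n], so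
       one factor of the product vanishes there. *)
    have dn : (n %/ gcdn j n < n)%N.
      rewrite ltn_Pdiv //; have : (0 < gcdn j n)%N by rewrite gcdn_gt0 n0 orbT.
      by move: nco; rewrite /coprime; case: (gcdn j n) => [|[|]].
    have d0 : (0 < n %/ gcdn j n)%N.
      by rewrite divn_gt0 ?gcdn_gt0 ?n0 ?orbT // dvdn_leq // dvdn_gcdr.
    have E : (z ^+ j) ^+ (n %/ gcdn j n) = 1.
      exact: prim_expr_order (exp_prim_root zn j).
    rewrite [X in _ * X](_ : _ = 0) ?mulr0 //; apply/eqP; rewrite prodf_seq_eq0.
    apply/hasP; exists (n %/ gcdn j n).-1; last by rewrite /= prednK // E subrr.
    by rewrite mem_index_iota /=; lia.
  have c0 : \poly_(i < n) c i = 0.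
    apply: (@roots_geq_poly_eq0 _ _ [seq z ^+ j | j <- iota 0 n]).
    - apply/allP => y /mapP[j _ ->]; apply/rootP.
      rewrite horner_poly -[RHS](root_pow j) [RHS]fold_eval //.
      by rewrite exprAC zn1 expr1n.
    - rewrite map_inj_in_uniq ?iota_uniq // => i j; rewrite !mem_iota !add0n => /= ni nj /eqP.
      by rewrite (eq_prim_root_expr zn) !modn_small // => /eqP.
    - by rewrite size_map size_iota; exact: size_poly.
  by have /polyP/(_ t) := c0; rewrite coef_poly tn coef0 => /eqP; rewrite intr_eq0.
have : (map_poly intr (p * cyclo)).[z] = 0.
  rewrite fold_eval // big1 // => t _; have /H/eqP -> : (t : nat) \in iota 0 n.
    by rewrite mem_iota add0n /=.
  by rewrite mul0r.
rewrite rmorphM hornerM cyclo_eval => /eqP; rewrite mulf_eq0 => /orP[/eqP //|].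
rewrite prodf_seq_eq0 => /hasP[d]; rewrite mem_index_iota => /= dn.
by rewrite subr_eq0 -(prim_order_dvd zn) => /dvdn_leq; lia.
Qed.

End ZeroTest.

(** * Enumeration, search and coset queries *)

(** Walks through the pairs antidiagonal by antidiagonal, so that decoding is plain iteration. *)
Definition unpair_step (xy : nat * nat) : nat * nat :=
  if xy.1 == 0%N then (xy.2.+1, 0%N) else ((xy.1 - 1)%N, xy.2.+1).

Definition unpair (n : nat) : nat * nat := iter n unpair_step (0%N, 0%N).

Lemma unpair_surj x y : exists n, unpair n = (x, y).
Proof.
have [s] := ubnP (x + y); elim: s x y => // s IHs x y xys.
suff H y' x' : (x' + y' = x + y)%N -> exists n, unpair n = (x', y') by exact: H.
elim: y' x' => [|y' IHy] x' E.
  case: x' E => [|x'] E; first by exists 0%N.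
  have [n En] : exists n, unpair n = (0%N, x') by apply: IHs; lia.
  by exists n.+1; rewrite /unpair iterS -/(unpair n) En.
have [n En] := IHy x'.+1 ltac:(lia).
by exists n.+1; rewrite /unpair iterS -/(unpair n) En /unpair_step /= subn1.
Qed.

Lemma computable_unpair A `{Enc A} (f : A -> nat) :
  computable f -> computable (fun x => unpair (f x)).
Proof.
move=> cf; apply: comp_iter => //; first by rewrite /unpair_step; solve_comp.
by solve_comp.
Qed.

Definition enumerable A `{Enc A} (f : nat -> A) : Prop :=
  computable f /\ forall a, exists n, f n = a.

Definition enum_int (n : nat) : int := (unpair n).1%:Z - (unpair n).2%:Z.

Lemma enumerable_int : enumerable enum_int.
Proof.
split=> [|a].
  have c := computable_unpair (@comp_id nat _); rewrite /enum_int; by solve_comp.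
have [n En] : exists n, unpair n = (`|Num.max a 0|%N, `|Num.max (- a) 0|%N).
  exact: unpair_surj.
by exists n; rewrite /enum_int En /=; lia.
Qed.

(** The number codes the length and a nested pairing of indices; each step splits off one index.
    Elements are pushed on the front, so the list comes out reversed. *)
Definition enum_seq_step A (f : nat -> A) (cs : nat * seq A) : nat * seq A :=
  ((unpair cs.1).2, f (unpair cs.1).1 :: cs.2).

Definition enum_seq A (f : nat -> A) (n : nat) : seq A :=
  (iter (unpair n).1 (enum_seq_step f) ((unpair n).2, [::])).2.

Lemma enumerable_seq A `{Enc A} (f : nat -> A) : enumerable f -> enumerable (enum_seq f).
Proof.
move=> [cf f_surj]; split.
  have c := computable_unpair (@comp_id nat _).
  rewrite /enum_seq; apply: comp_snd; apply: comp_iter; [by solve_comp | | by solve_comp].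
  rewrite /enum_seq_step.
  have c1 : computable (fun x : nat * (nat * seq A) => unpair x.2.1).
    by apply: computable_unpair; solve_comp.
  by solve_comp.
move=> s; rewrite -[s]revK; move: (rev s) => {}s.
have [c Hc] : exists c, forall acc,
    iter (size s) (enum_seq_step f) (c, acc) = (0%N, catrev s acc).
  elim: s => [|x s [c Hc]]; first by exists 0%N.
  have [n En] := f_surj x; have [c' Ec'] := unpair_surj n c; exists c' => acc.
  by rewrite [size _]/= iterSr {2}/enum_seq_step Ec' /= En Hc.
have [n En] := unpair_surj (size s) c; exists n.
by rewrite /enum_seq En /= Hc.
Qed.

Definition enum_poly (n : nat) : {poly int} := Poly (enum_seq enum_int n).

Lemma enumerable_poly : enumerable enum_poly.
Proof.
have [c s] := enumerable_seq enumerable_int; split=> [|p].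
  by rewrite /enum_poly; solve_comp.
by have [n En] := s p; exists n; rewrite /enum_poly En polyseqK.
Qed.

(** Unbounded search through the enumeration: it stops at the first candidate passing the test,
    provided that one exists, and asks no query. *)
Lemma run_search A C O `{Enc A} `{Enc C} `{Enc O} (dec : nat -> C)
    (chk : A -> C -> bool) (out : A -> C -> O) :
  enumerable dec -> computable (fun x => chk x.1 x.2) ->
  computable (fun x => out x.1 x.2) ->
  exists P, forall G G' a, (exists c, chk a c) ->
    exists2 c, chk a c & run G G' P (enc a) (enc (out a c)) 0.
Proof.
move=> [cdec dec_surj] cchk cout.
have [cond Hcond] : computable (fun x : A * nat => ~~ chk x.1 (dec x.2)).
  apply: comp_negb; apply: (comp_seq cchk (_ : computable (fun x : A * nat => (x.1, dec x.2)))).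
  by solve_comp.
have [body Hbody] : computable (fun x : A * nat => (x.1, x.2.+1)) by solve_comp.
have [fin Hfin] : computable (fun x : A * nat => out x.1 (dec x.2)).
  apply: (comp_seq cout (_ : computable (fun x : A * nat => (x.1, dec x.2)))).
  by solve_comp.
have [init Hinit] : computable (fun x : A => (x, 0%N)) by solve_comp.
exists (Seq (Seq init (While cond body)) fin) => G G' a [c0].
have [n0 <-] := dec_surj c0 => Hn0.
have ex : exists n, chk a (dec n) by exists n0.
have [n Hn nmin] := ex_minnP ex; exists (dec n) => //.
have Hwhile i : (i <= n)%N -> run G G' (While cond body) (enc (a, (n - i)%N)) (enc (a, n)) 0.
  elim: i => [|i IHi] ni.
    rewrite subn0; apply: run_While_false.
    by have := Hcond G G' (a, n); rewrite /= Hn.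
  have Hc : ~~ chk a (dec (n - i.+1)%N).
    by apply/negP => /nmin; lia.
  apply: (@run_While_true _ _ _ _ _ (VInt 1) (enc (a, (n - i)%N)) _ 0 0 0) => //.
  - by have := Hcond G G' (a, (n - i.+1)%N); rewrite /= Hc.
  - by have := Hbody G G' (a, (n - i.+1)%N); rewrite /= subnSK.
  - by apply: IHi; exact: ltnW.
apply: (@run_Seq _ _ _ _ _ (enc (a, n)) _ 0 0); last exact: (Hfin G G' (a, n)).
apply: (@run_Seq _ _ _ _ _ (enc (a, 0%N)) _ 0 0); first exact: Hinit.
by have := Hwhile n (leqnn n); rewrite subnn.
Qed.

Lemma computable_rev A `{Enc A} (d : A) : computable (@rev A).
Proof.
apply: (@comp_ext _ _ _ _ (fun s => mkseq (fun i => nth d s (size s - i.+1)) (size s))).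
  move=> s; apply: (@eq_from_nth _ d); rewrite size_mkseq ?size_rev // => i si.
  by rewrite nth_mkseq // nth_rev.
by solve_comp.
Qed.

Lemma run_queries (primed : bool) : exists P, forall G G' (L xs : seq 'M[int]_2),
  let D := if primed then G' else G in
  coset_reps D SL2Z L -> (forall x, x \in xs -> SL2Z x) ->
  exists js : seq nat, [/\ size js = size xs,
    forall t, (t < size xs)%N ->
      (nth 0%N js t < size L)%N /\ in_coset D (nth 0 xs t) (nth 0 L (nth 0%N js t))
    & run G G' P (enc (L, xs)) (enc js) (size xs)].
Proof.
have [init Hinit] : computable (fun x : seq 'M[int]_2 * seq 'M[int]_2 =>
  (x, [::] : seq nat)) by solve_comp.
have [fin Hfin] : computable (fun x : (seq 'M[int]_2 * seq 'M[int]_2) * seq nat => rev x.2).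
  apply: (comp_seq (computable_rev 0%N)); by solve_comp.
have [cond Hcond] : computable (fun x : (seq 'M[int]_2 * seq 'M[int]_2) * seq nat => x.1.2).
  by solve_comp.
have [next Hnext] : computable (fun x : (seq 'M[int]_2 * seq 'M[int]_2) * seq nat =>
  (x.1.1, behead x.1.2)) by solve_comp.
have [arg Harg] : computable (fun x : (seq 'M[int]_2 * seq 'M[int]_2) * seq nat =>
  ((primed : nat), (head 0 x.1.2, x.1.1))) by solve_comp.
have [acc Hacc] : computable (fun x : (seq 'M[int]_2 * seq 'M[int]_2) * seq nat => x.2).
  by solve_comp.
pose body := MkPair next (MkPair (Seq arg CosetIndex) acc).
exists (Seq (Seq init (While cond body)) fin) => G G' L xs D HL Hxs.
have Hwhile a : exists js : seq nat, [/\ size js = size xs,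
    forall t, (t < size xs)%N ->
      (nth 0%N js t < size L)%N /\ in_coset D (nth 0 xs t) (nth 0 L (nth 0%N js t))
    & run G G' (While cond body) (enc ((L, xs), a))
        (enc ((L, [::] : seq 'M[int]_2), catrev js a)) (size xs)].
  elim: xs a Hxs => [|x xs IHxs] a Hxs.
    by exists [::]; split=> //; apply: run_While_false; exact: Hcond.
  have Hx : SL2Z x by apply: Hxs; rewrite inE eqxx.
  have [j [[jL Hj] _]] := HL.2 x Hx.
  have [|js [sjs Hjs Hrun]] := IHxs (j :: a).
    by move=> y yxs; apply: Hxs; rewrite inE yxs orbT.
  exists (j :: js); split; first by rewrite /= sjs.
    by case=> [|t] //= tx; exact: Hjs.
  (* Condition, body and remaining loop: only the body asks a query, exactly one. *)
  rewrite -[size (x :: xs)]/(0 + 1 + size xs)%N.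
  apply: run_While_true (Hcond G G' (L, x :: xs, a)) _ _ Hrun => //.
  apply: (@run_MkPair _ _ _ _ _ _ _ 0 1); first exact: (Hnext G G' (L, x :: xs, a)).
  apply: (@run_MkPair _ _ _ _ _ _ _ 1 0); last exact: (Hacc G G' (L, x :: xs, a)).
  apply: (@run_Seq _ _ _ _ _ _ _ 0 1); first exact: (Harg G G' (L, x :: xs, a)).
  exact: run_CosetIndex.
have [js [sjs Hjs Hrun]] := Hwhile [::]; exists js; split=> //.
rewrite -[size xs]addn0 -{1}[size xs]add0n.
apply: run_Seq; first exact: (run_Seq (Hinit G G' (L, xs)) Hrun).
by have := Hfin G G' ((L, [::]), catrev js [::]); rewrite /= -/(rev js) revK.
Qed.

(** * The algorithm *)

Lemma comp_prodn A `{Enc A} (n : A -> nat) (f : A -> nat -> nat) :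
  computable n -> computable (fun x => f x.1 x.2) ->
  computable (fun x => (\prod_(0 <= i < n x) f x i)%N).
Proof.
move=> cn cf; apply: (@comp_ext _ _ _ _ (fun x => iteri (n x)
  (fun i a => a * f x i)%N 1%N)) => [x|].
  elim: (n x) => [|m IHm]; first by rewrite big_geq.
  by rewrite big_nat_recr //= IHm.
apply: comp_iteri => //; last by solve_comp.
apply: comp_muln; first by solve_comp.
by apply: (comp_seq cf); solve_comp.
Qed.

Lemma comp_numq A `{Enc A} (f : A -> rat) : computable f -> computable (fun x => numq (f x)).
Proof. by apply: comp_seq; exists Fst => G G' x; exact: run_Fst. Qed.

Lemma comp_absdenq A `{Enc A} (f : A -> rat) :
  computable f -> computable (fun x => `|denq (f x)|%N).
Proof.
apply: (comp_seq (g := fun q => `|denq q|%N)); exists Snd => G G' x.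
have -> : enc `|denq x|%N = VInt (denq x) by rewrite /enc /Enc_nat /enc_nat absz_denq.
exact: run_Snd.
Qed.

(** The plain product of all denominators in the table: any positive common multiple will do as
    scale factor. *)
Definition common_den (E : seq ('M[int]_2 * {poly rat})) : nat :=
  (\prod_(0 <= e < size E) \prod_(0 <= t < size (polyseq (nth (0%R, 0%R) E e).2))
     `|denq (nth 0%R (polyseq (nth (0%R, 0%R) E e).2) t)|)%N.

Definition scaled_value (E : seq ('M[int]_2 * {poly rat})) (e : nat) : {poly int} :=
  \poly_(t < size (polyseq (nth (0%R, 0%R) E e).2))
    (numq (polyseq (nth (0%R, 0%R) E e).2)`_t *
     (common_den E %/ `|denq (polyseq (nth (0%R, 0%R) E e).2)`_t|)%N%:Z).

Lemma comp_common_den A `{Enc A} (E : A -> seq ('M[int]_2 * {poly rat})) :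
  computable E -> computable (fun x => common_den (E x)).
Proof.
move=> cE; apply: comp_prodn; first by solve_comp.
apply: comp_prodn; first by solve_comp.
by apply: comp_absdenq; solve_comp.
Qed.

Lemma comp_scaled_value A `{Enc A} (E : A -> seq ('M[int]_2 * {poly rat})) (e : A -> nat) :
  computable E -> computable e -> computable (fun x => scaled_value (E x) (e x)).
Proof.
move=> cE ce; rewrite /scaled_value; solve_comp.
- by apply: comp_numq; solve_comp.
- by apply: comp_common_den; solve_comp.
- by apply: comp_absdenq; solve_comp.
Qed.

Lemma common_den_gt0 E : (0 < common_den E)%N.
Proof.
rewrite /common_den big_mkord; apply: prodn_gt0 => e; rewrite big_mkord.
by apply: prodn_gt0 => t; rewrite absz_gt0 denq_neq0.
Qed.

Lemma scaled_valueE z E e : (e < size E)%N ->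
  evalZ z (scaled_value E e) = (common_den E)%:R * evalQ z (nth (0%R, 0%R) E e).2.
Proof.
move=> eE; rewrite /evalZ /evalQ -hornerZ; congr horner; apply/polyP => t.
rewrite coefZ !coef_map coef_poly /=; case: ltnP => tE; last first.
  by rewrite nth_default // -[X in ratr X]/(0%:~R) ratr_int mulr0.
set q := _`_t; have dvd : (`|denq q| %| common_den E)%N.
  rewrite /common_den (big_rem e) ?mem_index_iota //=; apply: dvdn_mulr.
  by rewrite (big_rem t) ?mem_index_iota //=; exact: dvdn_mulr.
have d0 : (denq q)%:~R != 0 :> algC by rewrite intr_eq0 denq_neq0.
rewrite -{2}(divnK dvd) natrM intrM /= /ratr.
rewrite -[(_ %/ _)%N%:R]/((_ %/ _)%N%:Z%:~R) -[`|denq q|%:R]/(`|denq q|%N%:Z%:~R).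
by rewrite absz_denq -mulrA [RHS]mulrCA mulrA; field.
Qed.

(** The scan keeps the last occurrence; any occurrence serves, since equal indices mean equal
    cosets. *)
Definition lookup (v : nat) (s : seq nat) : nat :=
  iteri (size s) (fun i a => if nth 0%N s i == v then i else a) 0%N.

Lemma lookupP v s : v \in s -> (lookup v s < size s)%N /\ nth 0%N s (lookup v s) = v.
Proof.
move=> vs; rewrite /lookup; suff H n : (n <= size s)%N ->
    (exists2 i, (i < n)%N & nth 0%N s i = v) ->
    (iteri n (fun i a => if nth 0%N s i == v then i else a) 0 < n)%N /\
    nth 0%N s (iteri n (fun i a => if nth 0%N s i == v then i else a) 0%N) = v.
  by apply: H => //; exists (index v s); rewrite ?index_mem ?nth_index.
elim: n => [|n IHn] ns [i]; first by [].
rewrite ltnS leq_eqVlt /= => /predU1P[-> Ei|ltin Ei]; first by rewrite Ei eqxx ltnSn.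
case: eqP => [Ev|_]; first by rewrite ltnSn.
have [lt1 E1] := IHn (ltnW ns) (ex_intro2 _ _ i ltin Ei).
by split=> //; exact: ltnW.
Qed.

Lemma comp_lookup A `{Enc A} (v : A -> nat) (s : A -> seq nat) :
  computable v -> computable s -> computable (fun x => lookup (v x) (s x)).
Proof. by move=> cv cs; apply: comp_iteri; solve_comp. Qed.

Lemma comp_symn A `{Enc A} (N : A -> nat) (g : A -> 'M[int]_2) (a : A -> nat) :
  computable N -> computable g -> computable a ->
  computable (fun x => symn (N x) (g x) (a x)).
Proof. by move=> cN cg ca; rewrite /symn; solve_comp. Qed.

Lemma comp_adj2 A `{Enc A} (g : A -> 'M[int]_2) :
  computable g -> computable (fun x => adj2 (g x)).
Proof. by move=> cg; rewrite /adj2; solve_comp. Qed.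

Definition input : Type :=
  (nat * (nat * (seq 'M[int]_2 * (seq 'M[int]_2 * seq ('M[int]_2 * {poly rat})))))%type.

(* The input, followed by the answers to the three series of queries. *)
Definition state : Type := (input * seq nat * seq nat * seq nat)%type.

(** The position in this list is the first argument of [rho] and fixes the layout of the queries:
    the one for [r_i] and multiplier [h] sits at [h * size R' + i]. *)
Definition multipliers : seq 'M[int]_2 := [:: 1%:M; Smx; Umx; U2mx; Tmx; Nmx].

Section State.
Variable st : state.

Definition st_n : nat := st.1.1.1.1.
Definition st_k : nat := st.1.1.1.2.1.
Definition st_R' : seq 'M[int]_2 := st.1.1.1.2.2.2.1.
Definition st_E : seq ('M[int]_2 * {poly rat}) := st.1.1.1.2.2.2.2.
Definition st_J : seq nat := st.1.1.2.
Definition st_g : seq nat := st.1.2.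
Definition st_e : seq nat := st.2.
Definition st_m : nat := (size st_R' * (st_k - 1))%N.

(** The computed form of [coord_row]: the first answers give [j] with [r_i h] in [G' r_j], the
    second ones the [G]-coset of [g = r_i h r_j^-1], and matching it with the cosets of the table
    entries gives the scaled value of [eps g]. *)
Definition rho (h l j : nat) : {poly int} :=
  if (j %/ (st_k - 1))%N == nth 0%N st_J (h * size st_R' + l %/ (st_k - 1)) then
    scaled_value st_E
      (lookup (nth 0%N st_g (h * size st_R' + l %/ (st_k - 1))) st_e) *
    ((polyseq (symn (st_k - 2)
       (adj2 (nth 0 st_R' (l %/ (st_k - 1)) *m nth 0 multipliers h *m
              adj2 (nth 0 st_R' (nth 0%N st_J (h * size st_R' + l %/ (st_k - 1))))))
       (l %% (st_k - 1))%N))`_(j %% (st_k - 1))%N)%:P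
  else 0.

Definition st_mrel := manin_rels st_m (rho 0) (rho 1) (rho 2) (rho 3).
Definition st_crel := cusp_rels st_m (rho 0) (rho 4) (rho 5).
Definition st_bd := boundary_mx (rho 0) (rho 1).

End State.

Section ComputableState.
Context {A : Type} `{Enc A}.
Variables (st : A -> state) (h l j : A -> nat).
Hypotheses (cst : computable st) (ch : computable h) (cl : computable l) (cj : computable j).

Lemma comp_st_m : computable (fun x => st_m (st x)).
Proof. by rewrite /st_m /st_R' /st_k; solve_comp. Qed.

Lemma comp_rho : computable (fun x => rho (st x) (h x) (l x) (j x)).
Proof.
rewrite /rho.
have cR' : computable (fun x => st_R' (st x)) by rewrite /st_R'; solve_comp.
have cE : computable (fun x => st_E (st x)) by rewrite /st_E; solve_comp.
have cJ : computable (fun x => st_J (st x)) by rewrite /st_J; solve_comp.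
have cg : computable (fun x => st_g (st x)) by rewrite /st_g; solve_comp.
have ce : computable (fun x => st_e (st x)) by rewrite /st_e; solve_comp.
have ck : computable (fun x => st_k (st x)) by rewrite /st_k; solve_comp.
have ct : computable (fun x => h x * size (st_R' (st x)) + l x %/ (st_k (st x) - 1))%N.
  by solve_comp.
have cv : computable (fun x => scaled_value (st_E (st x))
    (lookup (nth 0%N (st_g (st x)) (h x * size (st_R' (st x)) + l x %/ (st_k (st x) - 1)))
       (st_e (st x)))).
  by apply: comp_scaled_value => //; apply: comp_lookup => //; solve_comp.
solve_comp; apply: comp_symn; [by solve_comp | | by solve_comp].
by apply: comp_adj2; solve_comp; apply: comp_adj2; solve_comp.
Qed.

End ComputableState.

Section ComputableRelations.
Context {A : Type} `{Enc A}.
Variables (st : A -> state) (l j : A -> nat).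
Hypotheses (cst : computable st) (cl : computable l) (cj : computable j).

Lemma comp_st_mrel : computable (fun x => st_mrel (st x) (l x) (j x)).
Proof.
have cm := comp_st_m cst; rewrite /st_mrel /manin_rels.
by repeat (comp_step || (apply: comp_rho)).
Qed.

Lemma comp_st_crel : computable (fun x => st_crel (st x) (l x) (j x)).
Proof.
have cm := comp_st_m cst; rewrite /st_crel /cusp_rels.
by repeat (comp_step || (apply: comp_rho)).
Qed.

Lemma comp_st_bd : computable (fun x => st_bd (st x) (l x) (j x)).
Proof.
by rewrite /st_bd /boundary_mx; repeat (comp_step || (apply: comp_rho)).
Qed.

End ComputableRelations.

(** * Checking a certificate *)

Definition zero_mx_test (n a b : nat) (F : nat -> nat -> {poly int}) : bool :=
  all (fun i => all (fun j => zero_test n (F i j)) (iota 0 b)) (iota 0 a).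

Definition prodmx (m : nat) (F H : nat -> nat -> {poly int}) (i j : nat) : {poly int} :=
  \sum_(0 <= l < m) F i l * H l j.

Definition scalmx (e : int) (i j : nat) : {poly int} := if i == j then e%:P else 0.

Section MatrixTests.
Variables (n : nat) (z : algC).
Hypothesis zn : n.-primitive_root z.

Lemma zero_mx_testP a b F :
  reflect (fmx a b (evmx z F) = 0) (zero_mx_test n a b F).
Proof.
apply: (iffP allP) => [H|H i].
  apply/matrixP => i j; rewrite !mxE /evmx; apply/eqP; rewrite -(zero_testP zn).
  have /H/allP : (i : nat) \in iota 0 a by rewrite mem_iota add0n /=.
  by apply; rewrite mem_iota add0n /=.
rewrite mem_iota add0n => /= ia; apply/allP => j; rewrite mem_iota add0n => /= jb.
rewrite (zero_testP zn).
by have /matrixP/(_ (Ordinal ia) (Ordinal jb)) := H; rewrite !mxE => /eqP.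
Qed.

Lemma fmx_prod a m b F H : fmx a b (evmx z (prodmx m F H)) =
  fmx a m (evmx z F) *m fmx m b (evmx z H).
Proof.
apply/matrixP => i j; rewrite !mxE /evmx /prodmx big_mkord evalZ_sum.
by apply: eq_bigr => l _; rewrite !mxE evalZM.
Qed.

Lemma fmxB a b F H : fmx a b (evmx z (fun i j => F i j - H i j)) =
  fmx a b (evmx z F) - fmx a b (evmx z H).
Proof. by apply/matrixP => i j; rewrite !mxE /evmx evalZB. Qed.

Lemma fmxD a b F H : fmx a b (evmx z (fun i j => F i j + H i j)) =
  fmx a b (evmx z F) + fmx a b (evmx z H).
Proof. by apply/matrixP => i j; rewrite !mxE /evmx evalZD. Qed.

Lemma fmx_scal a e : fmx a a (evmx z (scalmx e)) = (e%:~R)%:M.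
Proof.
apply/matrixP => i j; rewrite !mxE /evmx /scalmx val_eqE.
by case: eqP; rewrite ?evalZC ?evalZ0.
Qed.

End MatrixTests.

(** Position 0 holds the scalar [e], positions 1 to 5 hold [V], [Y], [Phi], [P], [X]. Missing
    entries read as 0, so every value is a candidate and no shape test is needed. *)
Definition cert : Type := seq (seq (seq {poly int})).

Section Check.
Variables (st : state) (C : cert).

Definition entry (a i j : nat) : {poly int} := nth 0 (nth [::] (nth [::] C a) i) j.
Definition cert_size : nat := size (nth [::] C 1).
Definition cert_scalar : int := (polyseq (entry 0 0 0))`_0.

Local Notation n := (st_n st).
Local Notation m := (st_m st).
Local Notation s := cert_size.

Definition check : bool :=
  [&& cert_scalar != 0,
      zero_mx_test n s m (fun i j =>
        prodmx m (entry 1) (st_bd st) i j - prodmx (m + m) (entry 2) (st_crel st) i j),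
      zero_mx_test n (m + m) s (prodmx m (st_mrel st) (entry 3)),
      zero_mx_test n s s (fun i j =>
        prodmx m (entry 1) (entry 3) i j - scalmx cert_scalar i j),
      zero_mx_test n (m + m) m (prodmx m (st_crel st) (entry 5))
    & zero_mx_test n m m (fun i j => scalmx cert_scalar i j -
        (prodmx s (entry 3) (entry 1) i j + prodmx (m + m) (entry 4) (st_mrel st) i j +
         prodmx m (st_bd st) (entry 5) i j))].

Lemma checkP (z : algC) : n.-primitive_root z ->
  reflect (cert_scalar != 0 /\
    certificate (fmx (m + m) m (evmx z (st_mrel st))) (fmx (m + m) m (evmx z (st_crel st)))
      (fmx m m (evmx z (st_bd st))) (fmx s m (evmx z (entry 1)))
      (fmx s (m + m) (evmx z (entry 2))) (fmx m s (evmx z (entry 3)))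
      (fmx m (m + m) (evmx z (entry 4))) (fmx m m (evmx z (entry 5)))
      cert_scalar%:~R) check.
Proof.
move=> zn; apply: (iffP andP).
  move=> [e0] /and5P[] /(zero_mx_testP zn); rewrite fmxB !fmx_prod => E1.
  move=> /(zero_mx_testP zn); rewrite !fmx_prod => E2.
  move=> /(zero_mx_testP zn); rewrite fmxB !fmx_prod fmx_scal => E3.
  move=> /(zero_mx_testP zn); rewrite !fmx_prod => E4.
  move=> /(zero_mx_testP zn) E5; rewrite fmxB !fmxD !fmx_prod fmx_scal in E5.
  by split=> //; split=> //; apply/eqP; rewrite -subr_eq0; apply/eqP.
move=> [e0 [E1 E2 E3 E4 E5]]; split=> //; apply/and5P; split; apply/(zero_mx_testP zn).
- by rewrite fmxB !fmx_prod E1 subrr.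
- by rewrite fmx_prod.
- by rewrite fmxB fmx_prod fmx_scal E3 subrr.
- by rewrite fmx_prod.
- by rewrite fmxB !fmxD !fmx_prod fmx_scal -E5 subrr.
Qed.

(** A column of a matrix gives a cusp up to sign; the output format wants a positive denominator,
    and [(1, 0)] for infinity. *)
Definition norm_pt (p q : int) : int * int :=
  if (0 <= q) && ~~ ((q == 0) && (p <= 0)) then (p, q) else (- p, - q).

Definition output : seq (seq ({poly int} * (nat * ((int * int) * (int * int))))) :=
  mkseq (fun i => mkseq (fun l =>
    (entry 1 i l, ((l %% (st_k st - 1))%N,
      (norm_pt (nth 0 (st_R' st) (l %/ (st_k st - 1)) 0 1)
               (nth 0 (st_R' st) (l %/ (st_k st - 1)) 1 1),
       norm_pt (nth 0 (st_R' st) (l %/ (st_k st - 1)) 0 0)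
               (nth 0 (st_R' st) (l %/ (st_k st - 1)) 1 0))))) m) cert_size.

End Check.

Lemma comp_entry A `{Enc A} (C : A -> cert) (a i j : A -> nat) :
  computable C -> computable a -> computable i -> computable j ->
  computable (fun x => entry (C x) (a x) (i x) (j x)).
Proof. by move=> cC ca ci cj; rewrite /entry; solve_comp. Qed.

Ltac comp_cert := repeat (first
  [ comp_step
  | match goal with
    | |- computable (fun x => rho _ _ _ _) => apply: comp_rho
    | |- computable (fun x => st_mrel _ _ _) => apply: comp_st_mrel
    | |- computable (fun x => st_crel _ _ _) => apply: comp_st_crel
    | |- computable (fun x => st_bd _ _ _) => apply: comp_st_bd
    | |- computable (fun x => st_m _) => apply: comp_st_m
    | |- computable (fun x => entry _ _ _ _) => apply: comp_entry
    | |- computable (fun x => zero_test _ _) => apply: comp_zero_test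
    end ]; cbv beta).

Lemma comp_check : computable (fun x : state * cert => check x.1 x.2).
Proof.
rewrite /check /zero_mx_test /prodmx /scalmx /cert_scalar /cert_size /st_n.
by comp_cert.
Qed.

Lemma comp_norm_pt A `{Enc A} (p q : A -> int) :
  computable p -> computable q -> computable (fun x => norm_pt (p x) (q x)).
Proof. by move=> cp cq; rewrite /norm_pt; solve_comp. Qed.

Lemma comp_output : computable (fun x : state * cert => output x.1 x.2).
Proof.
rewrite /output /cert_size /st_k /st_R'; comp_cert.
- by apply: comp_norm_pt; comp_cert.
- by apply: comp_norm_pt; comp_cert.
Qed.

Lemma enc_norm_pt p q : coprimez p q -> enc_P1Q (pt p q) = enc (norm_pt p q).
Proof.
move=> pq; rewrite /pt /norm_pt; case: (eqVneq q 0) => [q0|q0] /=.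
  move: pq; rewrite q0 /coprimez gcdz0 lexx /= => /eqP p1.
  by have [->|->] : p = 1 \/ p = -1 by lia.
rewrite andbT /= /enc_rat coprimeq_num // coprimeq_den // (negbTE q0).
case: lerP => q0'; first by rewrite gtr0_sg ?mul1r ?ger0_norm //; lia.
by rewrite ltr0_sg // mulN1r ltr0_norm.
Qed.

(** Sending a representative of [D \ H] to its [G]-coset is injective because [G] lies in [D]. It
    bounds both the index of [G'] and the length of the character table by the index of [G]. *)
Lemma reps_size_le (G D H : 'M[int]_2 -> Prop) (A R : seq 'M[int]_2) :
  subgroup_SL2Z G -> (forall g, G g -> D g) -> D 1%:M -> (forall g, H g -> SL2Z g) ->
  coset_reps D H A -> coset_reps G SL2Z R -> (size A <= size R)%N.
Proof.
move=> [GSL G1 GM GV] GD D1 HSL [HA UA] HR.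
(* Used here only to choose, for each element of [A], the index of its coset in [R]. *)
have [Q HQ] := run_queries false.
have [|js [sjs Hjs _]] := HQ G D R A HR; first by move=> x /HA /HSL.
rewrite -sjs -(size_iota 0 (size R)); apply: uniq_leq_size => [|j /(nthP 0%N)[t]].
  apply/(uniqP 0%N) => a b; rewrite !inE !sjs => aA bA E.
  have [aR [ga Gga Ea]] := Hjs a aA; have [bR [gb Ggb Eb]] := Hjs b bA.
  rewrite /= in Gga Ggb; rewrite -E in Eb.
  have [j [_ Uj]] := UA _ (HA _ (mem_nth 0 aA)).
  rewrite -(Uj a) ?(Uj b) //; split=> //; last by exists 1%:M; rewrite ?mul1mx.
  exists (ga *m invmx gb); first exact/GD/GM/GV.
  by rewrite Eb -mulmxA mulKmx // SL2Z_unit //; exact: GSL.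
by rewrite sjs mem_iota add0n => tA <-; have [] := Hjs t tA.
Qed.

Section Tables.
Variables (G G' : 'M[int]_2 -> Prop) (n : nat) (z : algC) (eps : 'M[int]_2 -> algC).
Variables (N : nat) (R R' : seq 'M[int]_2) (E : seq ('M[int]_2 * {poly rat})).
Variables J gs es : seq nat.
Hypotheses (sG : subgroup_SL2Z G) (sG' : subgroup_SL2Z G').
Hypothesis GG' : forall g, G g -> G' g.
Hypothesis eps_char : character_mod z G G' eps.
Hypotheses (HR : coset_reps G SL2Z R) (HR' : coset_reps G' SL2Z R').
Hypothesis HE : character_table z G G' eps E.

Let st : state := ((n, (N.+2, (R, (R', E)))), J, gs, es).
Local Notation r' := (size R').
Local Notation rep t := (nth 0 R' (t %% r') *m nth 0 multipliers (t %/ r')).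

Hypothesis HJ : forall t, (t < 6 * r')%N ->
  (nth 0%N J t < r')%N /\ in_coset G' (rep t) (nth 0 R' (nth 0%N J t)).
Hypothesis Hgs : forall t, (t < 6 * r')%N ->
  (nth 0%N gs t < size R)%N /\
  in_coset G (rep t *m adj2 (nth 0 R' (nth 0%N J t))) (nth 0 R (nth 0%N gs t)).
Hypothesis ses : size es = size E.
Hypothesis Hes : forall e, (e < size E)%N ->
  (nth 0%N es e < size R)%N /\
  in_coset G (nth (0%R, 0%R) E e).1 (nth 0 R (nth 0%N es e)).

(** [eps] is constant on the cosets [G g], and some table entry lies in the coset of [g], hence
    received the same answer [v]. *)
Lemma coset_valueP g v : G' g -> (v < size R)%N -> in_coset G g (nth 0 R v) ->
  (lookup v es < size E)%N /\ eps g = evalQ z (nth (0%R, 0%R) E (lookup v es)).2.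
Proof.
move=> Gg vR [a Ga Ea]; case: HE => [[HE1 HE2] HE3].
case: sG => GSL G1 GM GV; case: sG' => G'SL _ _ _.
have v_es : v \in es.
  have [e [[eE [b Gb Eb]] _]] := HE2 g Gg; rewrite size_map in eE.
  rewrite (nth_map (0%R, 0%R)) // in Eb.
  have [eR [c Gc Ec]] := Hes eE.
  have [j [_ Uj]] := HR.2 g (G'SL _ Gg).
  suff -> : v = nth 0%N es e by rewrite mem_nth // ses.
  rewrite -(Uj v); last by split=> //; exists a.
  by apply: Uj; split=> //; exists (b *m c); [exact: GM | rewrite Eb Ec mulmxA].
have [lt_es E_es] := lookupP v_es; rewrite ses in lt_es; split=> //.
have [_ [c Gc Ec]] := Hes lt_es; rewrite E_es in Ec.
have GE : G' (nth (0%R, 0%R) E (lookup v es)).1.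
  by apply: HE1; apply/map_f/mem_nth.
rewrite -(HE3 _ (mem_nth _ lt_es)).
have -> : g = (a *m invmx c) *m (nth (0%R, 0%R) E (lookup v es)).1.
  by rewrite Ea Ec -mulmxA mulKmx // SL2Z_unit //; exact: GSL.
have Gac : G (a *m invmx c) by apply/GM/GV.
case: eps_char => epsM eps1 _; rewrite epsM //; last exact: GG'.
by rewrite eps1 // mul1r.
Qed.

Lemma rho_coord_row h l : (h < 6)%N -> (l < r' * N.+1)%N ->
  coord_row N G' eps R' (common_den E)%:Z
    (nth 0 R' (l %/ N.+1) *m nth 0 multipliers h) (l %% N.+1) (evmx z (rho st h) l).
Proof.
move=> h6 lm; have ir : (l %/ N.+1 < r')%N by rewrite ltn_divLR.
set i := (l %/ N.+1)%N in ir *; pose t := (h * r' + i)%N.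
have r0 : (0 < r')%N by exact: leq_ltn_trans ir.
have t6 : (t < 6 * r')%N.
  by rewrite -ltn_divLR // /t divnMDl // divn_small // addn0.
have Et : rep t = nth 0 R' i *m nth 0 multipliers h.
  by rewrite /t modnMDl modn_small // divnMDl // divn_small // addn0.
have [Jr [g Gg Eg]] := HJ t6; have [gR Hg] := Hgs t6.
have HrJ : SL2Z (nth 0 R' (nth 0%N J t)) by apply: rep_SL2Z HR' _ Jr.
have Eg' : rep t *m adj2 (nth 0 R' (nth 0%N J t)) = g.
  by rewrite adj2E // Eg mulmxK // SL2Z_unit.
rewrite Eg' in Hg; rewrite Et in Eg Eg'.
have [lt_e Eeps] := coset_valueP Gg gR Hg.
exists (nth 0%N J t), g; split=> // j _.
rewrite /evmx /rho /st_k /st_R' /st_E /st_J /st_g /st_e /= !subn1 ?subn2 /=.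
rewrite -/i -/t Eg'; case: ifP => _; last by rewrite evalZ0.
rewrite evalZM evalZC scaled_valueE // -Eeps adj2E //.
by case: sG' => GSL _ _ _; exact: GSL.
Qed.

End Tables.

Definition cert_enum : nat -> cert := enum_seq (enum_seq (enum_seq enum_poly)).

Lemma enumerable_cert : enumerable cert_enum.
Proof. exact/enumerable_seq/enumerable_seq/enumerable_seq/enumerable_poly. Qed.

Definition query_list (x : input) : seq 'M[int]_2 :=
  mkseq (fun t => nth 0 x.2.2.2.1 (t %% size x.2.2.2.1) *m
                  nth 0 multipliers (t %/ size x.2.2.2.1)) (6 * size x.2.2.2.1).

(** The elements [r_i h r_j^-1] of [G'], available once the first answers have determined [j]. *)
Definition quotient_list (xJ : input * seq nat) : seq 'M[int]_2 :=
  mkseq (fun t => nth 0 (query_list xJ.1) t *m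
                  adj2 (nth 0 xJ.1.2.2.2.1 (nth 0%N xJ.2 t))) (6 * size xJ.1.2.2.2.1).

Lemma comp_query_list A `{Enc A} (x : A -> input) :
  computable x -> computable (fun a => query_list (x a)).
Proof. by move=> cx; rewrite /query_list; solve_comp. Qed.

Lemma comp_quotient_list : computable quotient_list.
Proof.
rewrite /quotient_list; apply: comp_mkseq; first by solve_comp.
apply: comp_mulmx; last by apply: comp_adj2; solve_comp.
by apply: comp_nth; [apply: comp_query_list; solve_comp | solve_comp].
Qed.

Lemma enc_seq_map A B (f : A -> B) (e : B -> value) s :
  enc_seq e (map f s) = enc_seq (fun a => e (f a)) s.
Proof. by elim: s => //= a s ->. Qed.

Lemma enc_seq_eq_in (A : eqType) (e1 e2 : A -> value) s :
  (forall a, a \in s -> e1 a = e2 a) -> enc_seq e1 s = enc_seq e2 s.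
Proof.
elim: s => //= a s IHs H; rewrite (H a) ?mem_head // IHs // => b bs.
by apply: H; rewrite inE bs orbT.
Qed.

Theorem mainTheorem6 :
  exists (P : prog) (C : nat),
  forall (G G' : 'M[int]_2 -> Prop) (n : nat) (z : algC)
         (eps : 'M[int]_2 -> algC) (k : nat)
         (R R' : seq 'M[int]_2) (E : seq ('M[int]_2 * {poly rat})),
    subgroup_SL2Z G -> subgroup_SL2Z G' ->
    (forall g, G g -> G' g) -> normal_in G G' ->
    (n.-primitive_root z)%R -> character_mod z G G' eps ->
    (2 <= k)%N ->
    coset_reps G SL2Z R -> coset_reps G' SL2Z R' ->
    character_table z G G' eps E ->
    exists (c q : nat) (B : seq (seq (symb_term k))),
      [/\ dim_B2 z G G' eps c,
          run G G' P (enc_input n k R R' E) (enc_output B) q,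
          basis_S z G G' eps [seq symb_of_terms z s | s <- B]
        & (q <= C * (size R' * c + size R))%N].
Proof.
have [Q' HQ'] := run_queries true; have [Q HQ] := run_queries false.
have [f1 Hf1] : computable (fun x : input => (x.2.2.2.1, query_list x)).
  by apply: comp_pair; [solve_comp | apply: comp_query_list; solve_comp].
have [f2 Hf2] : computable (fun x : input * seq nat => (x.1.2.2.1, quotient_list x)).
  by apply: comp_pair; [solve_comp | exact: comp_quotient_list].
have [f3 Hf3] : computable (fun x : input * seq nat * seq nat =>
    (x.1.1.2.2.1, mkseq (fun e => (nth (0%R, 0%R) x.1.1.2.2.2.2 e).1) (size x.1.1.2.2.2.2))).
  by solve_comp.
have [S HS] := run_search enumerable_cert comp_check comp_output.
(* Each stage pairs its input with the new answers, so that the search finally receives a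
   [state]. *)
exists (Seq (MkPair Id (Seq f1 Q'))
         (Seq (MkPair Id (Seq f2 Q)) (Seq (MkPair Id (Seq f3 Q)) S))), 13%N.
move=> G G' n z eps [|[|N]] // R R' E sG sG' GG' nGG' zn eps_char _ HR HR' HE.
pose x : input := (n, (N.+2, (R, (R', E)))).
have multSL t : (t < 6)%N -> SL2Z (nth 0 multipliers t).
  by do 6?[case: t => [|t]] => // _; apply/SL2ZE; rewrite !mxE.
have divr' t : (t < 6 * size R')%N -> (t %/ size R' < 6)%N /\ (t %% size R' < size R')%N.
  move=> t6; have r0 : (0 < size R')%N by case: (size R') t6 => //; rewrite muln0.
  by rewrite ltn_divLR // ltn_pmod.
have repSL t : (t < 6 * size R')%N ->
    SL2Z (nth 0 R' (t %% size R') *m nth 0 multipliers (t %/ size R')).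
  move=> /divr'[t1 t2]; apply: SL2ZM (multSL _ t1).
  by apply: HR'.1; exact: mem_nth.
have [|J [sJ HJ runJ]] := HQ' G G' R' (query_list x) HR'.
  move=> y /(nthP 0)[t]; rewrite size_mkseq => t6 <-; rewrite nth_mkseq //.
  exact: repSL.
rewrite size_mkseq /= in HJ.
have {}HJ t : (t < 6 * size R')%N -> (nth 0%N J t < size R')%N /\
    in_coset G' (nth 0 R' (t %% size R') *m nth 0 multipliers (t %/ size R'))
      (nth 0 R' (nth 0%N J t)).
  by move=> t6; have := HJ t t6; rewrite nth_mkseq.
have Equo t : (t < 6 * size R')%N -> nth 0 (quotient_list (x, J)) t =
    (nth 0 R' (t %% size R') *m nth 0 multipliers (t %/ size R')) *m
    adj2 (nth 0 R' (nth 0%N J t)).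
  by move=> t6; rewrite nth_mkseq //= nth_mkseq.
have [|gs [sgs Hgs rungs]] := HQ G G' R (quotient_list (x, J)) HR.
  move=> y /(nthP 0)[t]; rewrite size_mkseq => /= t6 <-; rewrite Equo //.
  have [Jr _] := HJ t t6; have HrJ : SL2Z (nth 0 R' (nth 0%N J t)) by apply: rep_SL2Z HR' _ Jr.
  by apply: SL2ZM; [exact: repSL | rewrite adj2E //; exact: SL2ZV].
rewrite size_mkseq /= in Hgs.
have {}Hgs t : (t < 6 * size R')%N -> (nth 0%N gs t < size R)%N /\
    in_coset G (nth 0 R' (t %% size R') *m nth 0 multipliers (t %/ size R') *m
      adj2 (nth 0 R' (nth 0%N J t))) (nth 0 R (nth 0%N gs t)).
  by move=> t6; have := Hgs t t6; rewrite Equo.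
pose El := mkseq (fun e => (nth (0%R, 0%R) E e).1) (size E).
have [|es [ses Hes runes]] := HQ G G' R El HR.
  move=> y /(nthP 0)[e]; rewrite size_mkseq => eE <-; rewrite nth_mkseq //.
  case: sG' => G'SL _ _ _; apply: G'SL; apply: HE.1.1; exact/map_f/mem_nth.
rewrite size_mkseq /= in ses Hes.
have {}Hes e : (e < size E)%N -> (nth 0%N es e < size R)%N /\
    in_coset G (nth (0%R, 0%R) E e).1 (nth 0 R (nth 0%N es e)).
  by move=> eE; have := Hes e eE; rewrite nth_mkseq.
pose st : state := (x, J, gs, es).
(* The answers do not involve the weight, so the same lists give coordinate rows in weight [N + 2]
   and in weight 2. *)
have rows N' h := @rho_coord_row G G' n z eps N' R R' E J gs es sG sG' GG' eps_char HR HR' HE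
  HJ Hgs ses Hes h.
have den0 : (common_den E)%:Z != 0 by rewrite -lt0n common_den_gt0.
(* Weight 2 is [N = 0]; the cusp relations use the multipliers 0, 4 and 5, that is 1, [T] and -1. *)
have [c Hc] := @cusps_dim 0 z G G' eps sG' GG' eps_char R' HR' _ _ _ _ den0
  (fun l => @rows 0%N 0%N l isT) (fun l => @rows 0%N 4%N l isT) (fun l => @rows 0%N 5%N l isT).
have Em : st_m st = (size R' * N.+1)%N by rewrite /st_m /st_k /= subn1.
have Hcert : exists C, check st C.
  have := @boundary_compatible N z G G' eps sG' GG' eps_char R' HR' _ _ _ _ _ _ _ den0
    (fun l => @rows N 0%N l isT) (fun l => @rows N 1%N l isT) (fun l => @rows N 2%N l isT)
    (fun l => @rows N 3%N l isT) (fun l => @rows N 4%N l isT) (fun l => @rows N 5%N l isT).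
  rewrite -Em => /integral_certificate_exists[s [e [V [Y [Phi [P [X [e0 HC]]]]]]]].
  pose m := st_m st.
  pose mk a b (F : nat -> nat -> {poly int}) := mkseq (fun i => mkseq (F i) b) a.
  exists [:: [:: [:: e%:P]]; mk s m V; mk s (m + m)%N Y; mk m s Phi; mk m (m + m)%N P; mk m m X].
  have Emk a b F : fmx a b (evmx z (fun i j => nth 0 (nth [::] (mk a b F) i) j)) =
      fmx a b (fun i j => evalZ z (F i j)).
    by apply/matrixP => i j; rewrite !mxE /evmx !nth_mkseq.
  apply/(@checkP st _ z zn); rewrite /cert_scalar /cert_size /entry /= size_mkseq polyseqC e0 /=.
  by split=> //; rewrite !Emk.
have [C /(@checkP st _ z zn)[e0 HC] runS] := HS G G' st Hcert.
pose gen (l : nat) : 'I_N.+1 * (P1Q * P1Q) :=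
  (inord (l %% N.+1), mobius2 (nth 0 R' (l %/ N.+1)) (Some 0, None)).
pose B : seq (seq (symb_term N.+2)) :=
  mkseq (fun i => mkseq (fun l => (entry C 1 i l, gen l)) (size R' * N.+1)) (cert_size C).
exists c, (0 + (0 + size (query_list x)) + (0 + (0 + size (quotient_list (x, J))) +
  (0 + (0 + size El) + 0)))%N, B; split=> //.
(* The program prints integer pairs; they encode the cusps correctly because the columns of a matrix
   in SL_2(Z) are coprime. *)
- have -> : enc_output B = enc (output st C).
    rewrite /enc_output /B /output Em /st_k /st_R' /= subn1 /= /mkseq.
    rewrite [RHS]enc_seq_map enc_seq_map; apply: enc_seq_eq_in => i _.
    rewrite [RHS]enc_seq_map enc_seq_map; apply: enc_seq_eq_in => l.
    rewrite mem_iota add0n => /= lm; have ir : (l %/ N.+1 < size R')%N by rewrite ltn_divLR.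
    have Hr : SL2Z (nth 0 R' (l %/ N.+1)) by apply: rep_SL2Z HR' _ ir.
    rewrite /enc_term /= mobius_0 mobius_inf !enc_norm_pt ?inordK ?ltn_pmod //.
      exact: SL2Z_coprime.
    exact: SL2Z_coprime1.
  apply: (@run_Seq _ _ _ _ _ (enc (x, J))).
    exact: run_MkPair (run_Id _ _ _) (run_Seq (Hf1 G G' x) runJ).
  apply: (@run_Seq _ _ _ _ _ (enc (x, J, gs))).
    exact: run_MkPair (run_Id _ _ _) (run_Seq (Hf2 G G' (x, J)) rungs).
  apply: run_Seq runS.
  exact: run_MkPair (run_Id _ _ _) (run_Seq (Hf3 G G' (x, J, gs)) runes).
- apply: (@certificate_basis_S N z G G' eps sG' GG' eps_char R' HR' _ _ _ _ _ _ _ den0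
    (fun l => @rows N 0%N l isT) (fun l => @rows N 1%N l isT) (fun l => @rows N 2%N l isT)
    (fun l => @rows N 3%N l isT) (fun l => @rows N 4%N l isT) (fun l => @rows N 5%N l isT)
    (cert_size C) (cert_scalar C) (entry C 1) (entry C 2) (entry C 3) (entry C 4) (entry C 5) e0).
  + by rewrite -Em; exact: HC.
  + by rewrite size_map size_mkseq.
  + move=> i si; rewrite (nth_map [::]) ?size_mkseq // nth_mkseq //.
    rewrite /symb_of_terms big_map -{1}[(size R' * N.+1)%N]subn0.
    rewrite -/(index_iota 0 _) big_mkord; apply: eq_bigr => l _.
    by rewrite freeg_scaleU.
- have leR' : (size R' <= size R)%N.
    apply: (reps_size_le sG GG' _ _ HR' HR) => //; by case: sG'.
  have leE : (size E <= size R)%N.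
    rewrite -(size_map fst); apply: (reps_size_le sG _ _ _ HE.1 HR) => //.
      by case: sG.
    by case: sG'.
  rewrite !size_mkseq /=; lia.
Qed.
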